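(* Let $Z_2,Z_{12},Z_{20},Z_{30}$ be the polynomials in ${\tt u}=(u_1,u_2,u_3,u_4)$, $P_1,\dots,P_4$ the degree-7 polynomials in ${\tt u}$, and $Z_2^{*},Z_{12}^{*},Z_{20}^{*},Z_{30}^{*}$ the conjugate polynomials, all defined in the context. Put $Y_j=Z_j^{*}(P_1({\tt u}),P_2({\tt u}),P_3({\tt u}),P_4({\tt u}))$ for $j=2,12,20,30$. Then $Y_2,Y_{12},Y_{20},Y_{30}$ are expressed as polynomials of $Z_2,Z_{12},Z_{20},Z_{30}$ as follows (in the display, Zk and Yk stand for $Z_k$ and $Y_k$, * is multiplication, ^ is exponentiation, and 1/(A)*(B) means $B/A$): \begin{verbatim} Y2= 1/(2^5*3^2*7^2)*(+3*7 * Z12*Z2+2 * Z2^7) Y12= 1/(2^32*3^14*5^2*7^12)*( +2^3*3^12*5^4*7 * Z12^2*Z30^2 +2^3*3^12*5^4*7 * Z20*Z2^2*Z30^2 +3^14*5^5*7 * Z20^2*Z12*Z2*Z30 +2*3^10*5^7*7 * Z20^3*Z12^2 +2*3^10*5^7*7 * Z20^4*Z2^2 -2^8*3^8*5^5 * Z12^7 -2^4*3^9*5^3*7*103 * Z12^4*Z2^3*Z30 -2^2*3^8*5^4*7*113 * Z20*Z12^5*Z2^2 +2^6*3^11*5^3*7 * Z12*Z2^6*Z30^2 +2^3*3^9*5^2*7*41*43 * Z20*Z12^2*Z2^5*Z30 +2^3*3^8*5^4*7*17 * Z20^2*Z12^3*Z2^4 -2*3^9*5^2*7*17*29 * Z20^2*Z2^7*Z30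 +2^2*3^9*5^3*7^2*137 * Z20^3*Z12*Z2^6 -2^4*3^6*5^2*7*1861 * Z12^6*Z2^6 -2^5*3^7*5^2*7*11*17 * Z12^3*Z2^9*Z30 -2^3*3^7*5*7*11*41*53 * Z20*Z12^4*Z2^8 +2^5*3^9*5^3*7 * Z2^12*Z30^2 +2^3*3^8*5*7*307 * Z20*Z12*Z2^11*Z30 +2^3*3^8*7*11*6089 * Z20^2*Z12^2*Z2^10 +2^5*3^6*7*97*307 * Z20^3*Z2^12 -2^4*3^5*7^3*13*277 * Z12^5*Z2^12 -2^5*3^6*5*7*17*23 * Z12^2*Z2^15*Z30 +2^5*3^5*5^2*7*13*139 * Z20*Z12^3*Z2^14 -2^4*3^6*5*7*17*19 * Z20*Z2^17*Z30 +2^4*3^7*5*7*3011 * Z20^2*Z12*Z2^16 -2^5*3^2*5^2*7^2*37*71 * Z12^4*Z2^18 -2^4*3^5*5*7*13*17 * Z12*Z2^21*Z30 +2^5*3^2*5*7^2*23*541 * Z20*Z12^2*Z2^20 +2^6*3^2*5*7*47*137 * Z20^2*Z2^22 -2^8*5^2*7*11*127 * Z12^3*Z2^24 -2^5*3*5*7*13*17 * Z2^27*Z30 +2^7*3*5*7*4793 * Z20*Z12*Z2^26 -2^7*3^2*5^2*7^2 * Z12^2*Z2^30 +2^7*3^2*5^2*7^2 * Z20*Z2^32 ) Y20= 1/(2^54*3^22*5^4*7^20)*( -2^5*3^20*5^8*7 * Z20*Z30^4 +3^18*5^11*7*11 * Z20^4*Z30^2 -2^4*3^16*5^13 * Z20^7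 -2^6*3^17*5^7*7*13 * Z12^4*Z2*Z30^3 +2^8*3^16*5^9*7 * Z20*Z12^5*Z30^2 -2^7*3^18*5^8*7 * Z12*Z2^4*Z30^4 +2^7*3^17*5^7*7*107 * Z20*Z12^2*Z2^3*Z30^3 +2^9*3^16*5^10*7 * Z20^2*Z12^3*Z2^2*Z30^2 +2^3*3^15*5^10*7*271 * Z20^3*Z12^4*Z2*Z30 +2^3*3^14*5^11*7*13 * Z20^4*Z12^5 +2^6*3^17*5^6*7*467 * Z20^2*Z2^5*Z30^3 +2^4*3^16*5^10*7*71 * Z20^3*Z12*Z2^4*Z30^2 +2^5*3^15*5^10*7*53 * Z20^4*Z12^2*Z2^3*Z30 +2^4*3^14*5^12*7*13 * Z20^5*Z12^3*Z2^2 -2^3*3^15*5^9*7*389 * Z20^5*Z2^5*Z30 +2^11*3^13*5^8*7*11 * Z12^9*Z2*Z30 -2^3*3^17*5^12*7 * Z20^6*Z12*Z2^4 +2^13*3^12*5^9*7 * Z20*Z12^10 +2^12*3^14*5^7*7^2 * Z12^6*Z2^4*Z30^2 +2^4*3^14*5^7*7*859 * Z20*Z12^7*Z2^3*Z30 +2^5*3^13*5^10*7*103 * Z20^2*Z12^8*Z2^2 +2^7*3^15*5^8*7*83 * Z12^3*Z2^7*Z30^3 +2^6*3^16*5^5*7^3*59 * Z20*Z12^4*Z2^6*Z30^2 +2^4*3^14*5^10*7^3 * Z20^2*Z12^5*Z2^5*Z30 -2^5*3^12*5^8*7^2*2917 * Z20^3*Z12^6*Z2^4 -2^7*3^17*5^7*7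 * Z2^10*Z30^4 +2^6*3^15*5^6*7*41*101 * Z20*Z12*Z2^9*Z30^3 +2^6*3^15*5^5*7*241*421 * Z20^2*Z12^2*Z2^8*Z30^2 +2^6*3^13*5^7*7*23*1031 * Z20^3*Z12^3*Z2^7*Z30 +2^5*3^14*5^8*7^2*479 * Z20^4*Z12^4*Z2^6 +2^4*3^14*5^4*7*77983 * Z20^3*Z2^10*Z30^2 -2^5*3^15*5^8*7*11*89 * Z20^4*Z12*Z2^9*Z30 -2^5*3^14*5^8*7*3917 * Z20^5*Z12^2*Z2^8 -2^5*3^12*5^7*7^2*11^2 * Z12^11*Z2^4 +2^6*3^13*5^5*7*23*2953 * Z12^8*Z2^7*Z30 +2^6*3^13*5^7*7^2*79 * Z20^6*Z2^10 +2^10*3^11*5^6*7^2*23*89 * Z20*Z12^9*Z2^6 -2^7*3^16*5^5*7^3*41 * Z12^5*Z2^10*Z30^2 -2^5*3^13*5^5*7^3*37*109 * Z20*Z12^6*Z2^9*Z30 -2^5*3^12*5^5*7*901679 * Z20^2*Z12^7*Z2^8 +2^9*3^15*5^6*7^2*23 * Z12^2*Z2^13*Z30^3 +2^8*3^14*5^5*7^2*13*127 * Z20*Z12^3*Z2^12*Z30^2 +2^6*3^13*5^3*7^2*171827 * Z20^2*Z12^4*Z2^11*Z30 +2^6*3^16*5^5*7^2*277 * Z20^3*Z12^5*Z2^10 +2^7*3^14*5^5*7^2*241 * Z20*Z2^15*Z30^3 +2^6*3^18*5^4*7^2*103 * Z20^2*Z12*Z2^14*Z30^2 -2^6*3^14*5^3*7^2*11*13*29*101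 * Z20^3*Z12^2*Z2^13*Z30 -2^7*3^12*5^5*7^2*137*599 * Z20^4*Z12^3*Z2^12 -2^5*3^13*5^2*7^3*111491 * Z20^4*Z2^15*Z30 +2^7*3^13*5^6*7^2*523 * Z20^5*Z12*Z2^14 +2^6*3^13*5^4*7*42589 * Z12^10*Z2^10 +2^6*3^10*5^3*7*17*2056963 * Z12^7*Z2^13*Z30 +2^11*3^9*5^3*7*11*295909 * Z20*Z12^8*Z2^12 -2^8*3^11*5^4*7^2*13*19*211 * Z12^4*Z2^16*Z30^2 -2^6*3^10*5^3*7^2*11*318431 * Z20*Z12^5*Z2^15*Z30 -2^6*3^9*5^3*7^2*191*38569 * Z20^2*Z12^6*Z2^14 +2^8*3^11*5^5*7^2*1621 * Z12*Z2^19*Z30^3 +2^9*3^10*5^5*7^2*11*233 * Z20*Z12^2*Z2^18*Z30^2 -2^7*3^10*5^3*7^2*5484503 * Z20^2*Z12^3*Z2^17*Z30 -2^11*3^10*5*7^2*11448077 * Z20^3*Z12^4*Z2^16 -2^5*3^10*5^3*7^2*163*1367 * Z20^2*Z2^20*Z30^2 -2^8*3^9*5^2*7^2*12136211 * Z20^3*Z12*Z2^19*Z30 +2^7*3^8*5*7^2*409*701*811 * Z20^4*Z12^2*Z2^18 +2^7*3^8*7^2*283*759631 * Z20^5*Z2^20 +2^7*3^10*5^2*7^2*1480541 * Z12^9*Z2^16 +2^7*3^7*5^2*7^3*14996291 * Z12^6*Z2^19*Z30 +2^8*3^6*5*7^2*798329969 * Z20*Z12^7*Z2^18 -2^14*3^8*5^4*7^2*3461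 * Z12^3*Z2^22*Z30^2 -2^8*3^7*5^2*7^2*661*93463 * Z20*Z12^4*Z2^21*Z30 -2^7*3^8*5*7^3*751*81553 * Z20^2*Z12^5*Z2^20 +2^9*3^10*5^3*7^2*1621 * Z2^25*Z30^3 -2^8*3^8*5^3*7^2*13*13597 * Z20*Z12*Z2^24*Z30^2 -2^12*3^9*5^2*7^2*601^2 * Z20^2*Z12^2*Z2^23*Z30 -2^13*3^6*5*7^2*701*3121 * Z20^3*Z12^3*Z2^22 -2^7*3^7*5^2*7^2*17*241877 * Z20^3*Z2^25*Z30 +2^8*3^7*5*7^2*95436673 * Z20^4*Z12*Z2^24 +2^8*3^6*5^2*7^3*4115879 * Z12^8*Z2^22 +2^10*3^7*5*7^2*8375963 * Z12^5*Z2^25*Z30 -2^13*3^5*5*7^2*131*233*331 * Z20*Z12^6*Z2^24 -2^10*3^9*5^3*7^2*11*743 * Z12^2*Z2^28*Z30^2 -2^8*3^6*5^2*7^2*28005389 * Z20*Z12^3*Z2^27*Z30 -2^8*3^7*5^3*7^3*402503 * Z20^2*Z12^4*Z2^26 -2^8*3^7*5^3*7^2*11*29*79 * Z20*Z2^30*Z30^2 -2^8*3^7*5^2*7^2*199*10889 * Z20^2*Z12*Z2^29*Z30 +2^9*3^6*5^3*7^2*421*5749 * Z20^3*Z12^2*Z2^28 +2^10*3^5*5^2*7^2*11*123191 * Z20^4*Z2^30 +2^9*3^6*5^2*7^3*17*139*157 * Z12^7*Z2^28 +2^9*3^4*5^3*7^2*41*25867 * Z12^4*Z2^31*Z30 -2^12*3^3*5^2*7^3*13*162263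 * Z20*Z12^5*Z2^30 -2^10*3^5*5^3*7^2*71*409 * Z12*Z2^34*Z30^2 -2^9*3^4*5^2*7^2*19*127*3109 * Z20*Z12^2*Z2^33*Z30 +2^9*3^3*5^2*7^2*607*32801 * Z20^2*Z12^3*Z2^32 -2^12*3^4*5^2*7^2*173*241 * Z20^2*Z2^35*Z30 +2^10*3^5*5^2*7^2*11*118493 * Z20^3*Z12*Z2^34 +2^10*3^5*5^4*7^2*17*751 * Z12^6*Z2^34 +2^10*3*5^4*7^2*13^2*439 * Z12^3*Z2^37*Z30 -2^11*5^3*7^2*17*901141 * Z20*Z12^4*Z2^36 -2^8*3^4*5^2*7^2*71*409 * Z2^40*Z30^2 -2^10*3*5^2*7^2*11*218947 * Z20*Z12*Z2^39*Z30 +2^10*3*5^2*7^2*53*430499 * Z20^2*Z12^2*Z2^38 +2^12*5^3*7^3*11*4021 * Z20^3*Z2^40 +2^12*5^5*7^3*853 * Z12^5*Z2^40 +2^11*3*5^3*7^3*13*17 * Z12^2*Z2^43*Z30 -2^14*5^3*7^3*10867 * Z20*Z12^3*Z2^42 -2^11*3*5^3*7^3*13*17 * Z20*Z2^45*Z30 +2^12*3*5^3*7^3*11^2*61 * Z20^2*Z12*Z2^44 +2^12*3^2*5^4*7^4 * Z12^4*Z2^46 -2^13*3^2*5^4*7^4 * Z20*Z12^2*Z2^48 +2^12*3^2*5^4*7^4 * Z20^2*Z2^50 ) Y30= 1/(2^79*3^34*5^6*7^30)*( -2^7*3^31*5^12 * Z30^7 +2^4*3^30*5^12*7*107 * Z20^3*Z30^5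 -3^28*5^16*7*71 * Z20^6*Z30^3 +2^9*3^28*5^10*7*23 * Z12^5*Z30^5 +2^4*3^25*5^19*7 * Z20^9*Z30 +2^10*3^29*5^12*7 * Z12^2*Z2^3*Z30^6 +2^10*3^28*5^11*7*23 * Z20*Z12^3*Z2^2*Z30^5 +2^5*3^27*5^12*7*1129 * Z20^2*Z12^4*Z2*Z30^4 -2^6*3^26*5^14*7*41 * Z20^3*Z12^5*Z30^3 +2^11*3^29*5^11*7 * Z20*Z2^5*Z30^6 +2^6*3^28*5^11*7*1789 * Z20^2*Z12*Z2^4*Z30^5 -2^6*3^27*5^12*7*2081 * Z20^3*Z12^2*Z2^3*Z30^4 -2^7*3^26*5^15*7*41 * Z20^4*Z12^3*Z2^2*Z30^3 -2^2*3^25*5^15*7*5393 * Z20^5*Z12^4*Z2*Z30^2 -2^2*3^24*5^18*7*11 * Z20^6*Z12^5*Z30 -2^5*3^27*5^11*7^3*239 * Z20^4*Z2^5*Z30^4 -2^3*3^26*5^15*7^2*199 * Z20^5*Z12*Z2^4*Z30^3 -2^15*3^24*5^12*7 * Z12^10*Z30^3 -2^4*3^25*5^15*7^2*157 * Z20^6*Z12^2*Z2^3*Z30^2 -2^3*3^24*5^19*7*11 * Z20^7*Z12^3*Z2^2*Z30 +2^4*3^23*5^18*7*23 * Z20^8*Z12^4*Z2 +2^7*3^25*5^10*7*1039 * Z12^7*Z2^3*Z30^4 +2^7*3^25*5^11*7*71*127 * Z20*Z12^8*Z2^2*Z30^3 +2^2*3^25*5^14*7*83*89 * Z20^7*Z2^5*Z30^2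 +2^9*3^23*5^13*7*13*73 * Z20^2*Z12^9*Z2*Z30^2 +2^2*3^24*5^19*7*37 * Z20^8*Z12*Z2^4*Z30 +2^11*3^22*5^15*7*23 * Z20^3*Z12^10*Z30 +2^5*3^24*5^18*7 * Z20^9*Z12^2*Z2^3 -2^9*3^26*5^10*7^2*373 * Z12^4*Z2^6*Z30^5 -2^7*3^26*5^9*7^2*59*163 * Z20*Z12^5*Z2^5*Z30^4 -2^7*3^26*5^11*7^2*1123 * Z20^2*Z12^6*Z2^4*Z30^3 +2^3*3^23*5^12*7*11*263*349 * Z20^3*Z12^7*Z2^3*Z30^2 +2^3*3^23*5^14*7*22811 * Z20^4*Z12^8*Z2^2*Z30 -2^4*3^24*5^17*7*19 * Z20^10*Z2^5 +2^6*3^21*5^16*7*17*37 * Z20^5*Z12^9*Z2 +2^9*3^28*5^11*7^2 * Z12*Z2^9*Z30^6 +2^10*3^27*5^10*7^2*59 * Z20*Z12^2*Z2^8*Z30^5 -2^6*3^26*5^10*7^2*36697 * Z20^2*Z12^3*Z2^7*Z30^4 -2^5*3^24*5^10*7^2*491*1493 * Z20^3*Z12^4*Z2^6*Z30^3 -2^3*3^24*5^12*7^2*24977 * Z20^4*Z12^5*Z2^5*Z30^2 +2^4*3^24*5^13*7^2*11*17*107 * Z20^5*Z12^6*Z2^4*Z30 +2^19*3^19*5^13*7 * Z12^15*Z30 +2^4*3^21*5^15*7^2*2053 * Z20^6*Z12^7*Z2^3 +2^6*3^26*5^9*7^2*23*31 * Z20^2*Z2^10*Z30^5 -2^5*3^25*5^12*7^2*19*307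 * Z20^3*Z12*Z2^9*Z30^4 -2^6*3^25*5^10*7^2*59*4219 * Z20^4*Z12^2*Z2^8*Z30^3 -2^5*3^24*5^12*7^4*373 * Z20^5*Z12^3*Z2^7*Z30^2 +2^10*3^20*5^11*7^2*7517 * Z12^12*Z2^3*Z30^2 +2^10*3^22*5^13*7^2*197 * Z20^6*Z12^4*Z2^6*Z30 +2^12*3^20*5^12*7^2*677 * Z20*Z12^13*Z2^2*Z30 +2^4*3^24*5^13*7^2*19087 * Z20^7*Z12^5*Z2^5 +2^14*3^19*5^14*7*107 * Z20^2*Z12^14*Z2 +2^3*3^24*5^9*7^2*805289 * Z20^5*Z2^10*Z30^3 -2^8*3^22*5^9*7^2*1559 * Z12^9*Z2^6*Z30^3 +2^4*3^23*5^13*7^2*46549 * Z20^6*Z12*Z2^9*Z30^2 -2^9*3^22*5^10*7^2*31*1049 * Z20*Z12^10*Z2^5*Z30^2 +2^4*3^24*5^13*7*290527 * Z20^7*Z12^2*Z2^8*Z30 -2^4*3^20*5^11*7^2*17*29^2*31 * Z20^2*Z12^11*Z2^4*Z30 +2^4*3^23*5^15*7*12569 * Z20^8*Z12^3*Z2^7 -2^13*3^18*5^13*7^2*683 * Z20^3*Z12^12*Z2^3 +2^8*3^22*5^9*7^5*977 * Z12^6*Z2^9*Z30^4 +2^8*3^23*5^8*7^2*139*8543 * Z20*Z12^7*Z2^8*Z30^3 +2^5*3^22*5^9*7^2*509*32057 * Z20^2*Z12^8*Z2^7*Z30^2 +2^3*3^24*5^12*7*31*3581 * Z20^8*Z2^10*Z30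 +2^5*3^19*5^11*7^2*521*4133 * Z20^3*Z12^9*Z2^6*Z30 -2^4*3^22*5^16*7*1453 * Z20^9*Z12*Z2^9 +2^5*3^19*5^11*7^2*31*193*983 * Z20^4*Z12^10*Z2^5 -2^11*3^23*5^11*7^3*17 * Z12^3*Z2^12*Z30^5 -2^9*3^23*5^8*7^4*11*13^3 * Z20*Z12^4*Z2^11*Z30^4 +2^6*3^22*5^7*7^3*9993337 * Z20^2*Z12^5*Z2^10*Z30^3 +2^4*3^21*5^9*7^3*44112559 * Z20^3*Z12^6*Z2^9*Z30^2 +2^4*3^21*5^10*7^2*7079*11617 * Z20^4*Z12^7*Z2^8*Z30 -2^5*3^22*5^12*7^2*41851 * Z20^5*Z12^8*Z2^7 -2^15*3^18*5^12*7*73 * Z12^17*Z2^3 +2^10*3^26*5^10*7^2 * Z2^15*Z30^6 +2^9*3^29*5^9*7^2 * Z20*Z12*Z2^14*Z30^5 -2^10*3^23*5^8*7^3*31*3469 * Z20^2*Z12^2*Z2^13*Z30^4 -2^7*3^21*5^8*7^3*173*71471 * Z20^3*Z12^3*Z2^12*Z30^3 +2^12*3^22*5^8*7^3*23*9043 * Z20^4*Z12^4*Z2^11*Z30^2 +2^5*3^22*5^10*7^4*271771 * Z20^5*Z12^5*Z2^10*Z30 +2^5*3^19*5^10*7*8052413 * Z12^14*Z2^6*Z30 +2^6*3^20*5^11*7^3*11*31*4391 * Z20^6*Z12^6*Z2^9 +2^8*3^18*5^11*7*19*193*211 * Z20*Z12^15*Z2^5 -2^6*3^22*5^7*7^2*11*1070429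 * Z20^3*Z2^15*Z30^4 +2^5*3^22*5^8*7^2*17*83*10627 * Z20^4*Z12*Z2^14*Z30^3 +2^5*3^23*5^8*7^3*15042373 * Z20^5*Z12^2*Z2^13*Z30^2 +2^8*3^21*5^8*7^2*11*149*457 * Z12^11*Z2^9*Z30^2 +2^11*3^21*5^10*7^4*11*2539 * Z20^6*Z12^3*Z2^12*Z30 +2^6*3^24*5^9*7^2*67*2027 * Z20*Z12^12*Z2^8*Z30 +2^7*3^22*5^11*7^2*43*19681 * Z20^7*Z12^4*Z2^11 +2^6*3^18*5^10*7^2*6673981 * Z20^2*Z12^13*Z2^7 -2^8*3^21*5^7*7^2*13*17*113*389 * Z12^8*Z2^12*Z30^3 +2^4*3^22*5^7*7^2*383*208697 * Z20^6*Z2^15*Z30^2 -2^12*3^20*5^7*7^2*53*197*421 * Z20*Z12^9*Z2^11*Z30^2 +2^5*3^23*5^11*7*89*13921 * Z20^7*Z12*Z2^14*Z30 -2^8*3^19*5^9*7^2*11*1327889 * Z20^2*Z12^10*Z2^10*Z30 -2^5*3^22*5^11*7^2*13*43*47 * Z20^8*Z12^2*Z2^13 +2^6*3^20*5^9*7^2*61*151*1609 * Z20^3*Z12^11*Z2^9 -2^16*3^24*5^8*7^2*43 * Z12^5*Z2^15*Z30^4 +2^8*3^25*5^7*7^2*1150987 * Z20*Z12^6*Z2^14*Z30^3 +2^5*3^20*5^6*7^2*523*56985457 * Z20^2*Z12^7*Z2^13*Z30^2 +2^6*3^19*5^7*7^2*13*427218427 * Z20^3*Z12^8*Z2^12*Z30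 -2^5*3^22*5^10*7*257*5003 * Z20^9*Z2^15 -2^6*3^19*5^9*7^2*127*1214933 * Z20^4*Z12^9*Z2^11 -2^9*3^22*5^9*7^2*19*241 * Z12^2*Z2^18*Z30^5 -2^9*3^22*5^8*7^2*1432103 * Z20*Z12^3*Z2^17*Z30^4 +2^7*3^21*5^6*7^2*37*47*272369 * Z20^2*Z12^4*Z2^16*Z30^3 +2^5*3^20*5^5*7^2*229*28477*38953 * Z20^3*Z12^5*Z2^15*Z30^2 +2^5*3^19*5^7*7^2*281*109191547 * Z20^4*Z12^6*Z2^14*Z30 +2^6*3^18*5^8*7^2*11*269192369 * Z20^5*Z12^7*Z2^13 -2^7*3^18*5^10*7^2*29989 * Z12^16*Z2^9 -2^8*3^22*5^8*7^2*3361 * Z20*Z2^20*Z30^5 -2^7*3^21*5^7*7^2*24413693 * Z20^2*Z12*Z2^19*Z30^4 +2^11*3^20*5^6*7^2*257*257903 * Z20^3*Z12^2*Z2^18*Z30^3 +2^6*3^20*5^7*7^2*101*1129*50101 * Z20^4*Z12^3*Z2^17*Z30^2 +2^6*3^19*5^6*7^2*389*631*747853 * Z20^5*Z12^4*Z2^16*Z30 +2^7*3^17*5^8*7^3*11*2122963 * Z12^13*Z2^12*Z30 +2^8*3^19*5^8*7^2*223*1931*2789 * Z20^6*Z12^5*Z2^15 +2^7*3^18*5^8*7^2*239*130099 * Z20*Z12^14*Z2^11 +2^4*3^20*5^5*7^2*12569*345689 * Z20^4*Z2^20*Z30^3 +2^8*3^19*5^6*7^2*11177*205211 * Z20^5*Z12*Z2^19*Z30^2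 +2^11*3^19*5^6*7^2*19*181213 * Z12^10*Z2^15*Z30^2 +2^6*3^18*5^6*7^2*191*567548017 * Z20^6*Z12^2*Z2^18*Z30 +2^7*3^19*5^6*7^2*18859*65519 * Z20*Z12^11*Z2^14*Z30 +2^7*3^19*5^8*7*263*347*30803 * Z20^7*Z12^3*Z2^17 +2^8*3^16*5^9*7^3*32820167 * Z20^2*Z12^12*Z2^13 +2^11*3^18*5^6*7^2*130881071 * Z12^7*Z2^18*Z30^3 +2^8*3^19*5^5*7^2*1229*1304753 * Z20*Z12^8*Z2^17*Z30^2 +2^6*3^18*5^5*7*13159*5789947 * Z20^7*Z2^20*Z30 -2^6*3^17*5^5*7^2*213751052731 * Z20^2*Z12^9*Z2^16*Z30 -2^10*3^17*5^10*7*11*1529413 * Z20^8*Z12*Z2^19 -2^9*3^16*5^6*7^2*173*127972109 * Z20^3*Z12^10*Z2^15 -2^9*3^19*5^7*7^2*37*97*4337 * Z12^4*Z2^21*Z30^4 +2^9*3^20*5^6*7^5*1018301 * Z20*Z12^5*Z2^20*Z30^3 +2^6*3^17*5^7*7^4*157*6334547 * Z20^2*Z12^6*Z2^19*Z30^2 +2^8*3^16*5^4*7^2*19*2417*2551*12037 * Z20^3*Z12^7*Z2^18*Z30 -2^7*3^17*5^5*7^2*89*191*17853503 * Z20^4*Z12^8*Z2^17 -2^10*3^21*5^8*7^2*2137 * Z12*Z2^24*Z30^5 -2^10*3^21*5^7*7^2*17*227*347 * Z20*Z12^2*Z2^23*Z30^4 +2^10*3^18*5^6*7^2*23*45166171 *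 Z20^2*Z12^3*Z2^22*Z30^3 +2^6*3^20*5^4*7^2*29*37*324827941 * Z20^3*Z12^4*Z2^21*Z30^2 +2^7*3^18*5^3*7^3*11*131*29027*48571 * Z20^4*Z12^5*Z2^20*Z30 +2^7*3^15*5^5*7^3*31*23099*1885459 * Z20^5*Z12^6*Z2^19 -2^10*3^17*5^5*7^3*827*14221 * Z12^15*Z2^15 -2^8*3^19*5^6*7^2*13928549 * Z20^2*Z2^25*Z30^4 +2^8*3^18*5^5*7^2*11*103*421*8707 * Z20^3*Z12*Z2^24*Z30^3 +2^12*3^19*5^4*7^3*13*47560897 * Z20^4*Z12^2*Z2^23*Z30^2 +2^7*3^16*5^4*7^2*13*719*1783*669241 * Z20^5*Z12^3*Z2^22*Z30 +2^7*3^14*5^5*7^2*548100080477 * Z12^12*Z2^18*Z30 +2^8*3^15*5^4*7^3*1780283701487 * Z20^6*Z12^4*Z2^21 +2^10*3^16*5^7*7^2*13*101*265459 * Z20*Z12^13*Z2^17 +2^7*3^17*5^2*7^2*709*7477*86131 * Z20^5*Z2^25*Z30^2 -2^16*3^16*5^6*7^2*13832521 * Z12^9*Z2^21*Z30^2 +2^6*3^16*5^4*7^2*13*23*4262123611 * Z20^6*Z12*Z2^24*Z30 +2^9*3^15*5^4*7^2*1033*1979*13001 * Z20*Z12^10*Z2^20*Z30 -2^10*3^18*5^4*7^2*32051*182159 * Z20^7*Z12^2*Z2^23 +2^8*3^14*5^4*7^3*11*19641133387 * Z20^2*Z12^11*Z2^19 +2^10*3^17*5^5*7^2*17*189716399 *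 Z12^6*Z2^24*Z30^3 +2^7*3^16*5^4*7^2*101*5777699071 * Z20*Z12^7*Z2^23*Z30^2 -2^8*3^16*5^3*7^2*4824842354177 * Z20^2*Z12^8*Z2^22*Z30 -2^9*3^16*5^2*7^2*13*21990109487 * Z20^8*Z2^25 -2^8*3^13*5^3*7^2*23*5623*1411172599 * Z20^3*Z12^9*Z2^21 -2^10*3^17*5^7*7^2*31*439667 * Z12^3*Z2^27*Z30^4 +2^9*3^17*5^5*7^3*13*19^2*173*2281 * Z20*Z12^4*Z2^26*Z30^3 +2^7*3^20*5^5*7^2*9184353733 * Z20^2*Z12^5*Z2^25*Z30^2 +2^12*3^15*5^3*7^2*2093780213323 * Z20^3*Z12^6*Z2^24*Z30 +2^9*3^14*5^2*7^2*29*101*33115141459 * Z20^4*Z12^7*Z2^23 -2^10*3^19*5^7*7^2*2137 * Z2^30*Z30^5 -2^9*3^19*5^6*7^2*19*321821 * Z20*Z12*Z2^29*Z30^4 +2^11*3^17*5^6*7^2*17*13839599 * Z20^2*Z12^2*Z2^28*Z30^3 +2^7*3^16*5^6*7^2*47*79^2*302009 * Z20^3*Z12^3*Z2^27*Z30^2 +2^7*3^15*5^2*7^3*29*101*367*3593*15277 * Z20^4*Z12^4*Z2^26*Z30 +2^9*3^15*7^2*11*5903837*31733797 * Z20^5*Z12^5*Z2^25 +2^9*3^13*5^5*7^3*569*977*1553 * Z12^14*Z2^21 +2^8*3^16*5^4*7^2*11*554789143 * Z20^3*Z2^30*Z30^3 +2^7*3^16*5^3*7^2*3307*5749*40763 *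 Z20^4*Z12*Z2^29*Z30^2 +2^10*3^18*5^2*7^2*13*283*613*122117 * Z20^5*Z12^2*Z2^28*Z30 +2^8*3^13*5^3*7^2*97*120517321303 * Z12^11*Z2^24*Z30 +2^8*3^15*5*7^2*2351*59753*315527 * Z20^6*Z12^3*Z2^27 +2^9*3^13*5^3*7^3*1019375392639 * Z20*Z12^12*Z2^23 -2^9*3^15*5^4*7^2*229*382783829 * Z12^8*Z2^27*Z30^2 +2^8*3^15*5^2*7^4*53*257*695689 * Z20^6*Z2^30*Z30 -2^14*3^13*5^6*7^2*79*761*46691 * Z20*Z12^9*Z2^26*Z30 -2^8*3^15*5*7^3*353*5954683957 * Z20^7*Z12*Z2^29 -2^10*3^12*5^2*7^2*29*59*149*157*1856221 * Z20^2*Z12^10*Z2^25 +2^10*3^18*5^3*7^3*359*3061027 * Z12^5*Z2^30*Z30^3 +2^8*3^15*5^3*7^3*340604380033 * Z20*Z12^6*Z2^29*Z30^2 -2^13*3^14*5^2*7^2*139*39383*152777 * Z20^2*Z12^7*Z2^28*Z30 -2^12*3^13*5*7^2*63378965258321 * Z20^3*Z12^8*Z2^27 -2^12*3^16*5^6*7^4*19*4483 * Z12^2*Z2^33*Z30^4 +2^11*3^16*5^5*7^4*41*563*1201 * Z20*Z12^3*Z2^32*Z30^3 +2^8*3^15*5^3*7^3*31*22664066651 * Z20^2*Z12^4*Z2^31*Z30^2 +2^10*3^14*5^2*7^3*541*569*16524979 * Z20^3*Z12^5*Z2^30*Z30 +2^9*3^13*5*7^3*41*3048495311723 * Z20^4*Z12^6*Z2^29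 -2^10*3^16*5^5*7^3*19*56501 * Z20*Z2^35*Z30^4 +2^11*3^15*5^4*7^3*11*13*3002269 * Z20^2*Z12*Z2^34*Z30^3 +2^8*3^18*5^3*7^4*812189933 * Z20^3*Z12^2*Z2^33*Z30^2 +2^8*3^14*5^2*7^3*19*235679*1825937 * Z20^4*Z12^3*Z2^32*Z30 +2^9*3^14*5^2*7^3*149*18380304779 * Z20^5*Z12^4*Z2^31 +2^10*3^12*5^2*7^2*13*911*164646281 * Z12^13*Z2^27 +2^8*3^16*5^3*7^3*15919*40127 * Z20^4*Z2^35*Z30^2 +2^15*3^16*5^2*7^3*365440423 * Z20^5*Z12*Z2^34*Z30 +2^9*3^11*5*7^2*11*1399*23867817047 * Z12^10*Z2^30*Z30 -2^10*3^14*5*7^3*12653*77512949 * Z20^6*Z12^2*Z2^33 +2^10*3^12*5*7^2*6073*7561*1419713 * Z20*Z12^11*Z2^29 -2^9*3^12*5^3*7^2*41*673*101739863 * Z12^7*Z2^33*Z30^2 -2^12*3^12*5^2*7^2*177823*45043877 * Z20*Z12^8*Z2^32*Z30 -2^12*3^17*5*7^3*29^2*37*101*139 * Z20^7*Z2^35 -2^11*3^10*5^3*7^2*43*139*5977447793 * Z20^2*Z12^9*Z2^31 +2^11*3^12*5^4*7^3*13^2*70718519 * Z12^4*Z2^36*Z30^3 +2^9*3^16*5^3*7^3*9043*1393387 * Z20*Z12^5*Z2^35*Z30^2 +2^10*3^12*5^2*7^3*67763*24003367 * Z20^2*Z12^6*Z2^34*Z30 +2^12*3^10*5^3*7^3*223*2486599937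 * Z20^3*Z12^7*Z2^33 -2^11*3^15*5^5*7^3*684121 * Z12*Z2^39*Z30^4 +2^12*3^13*5^4*7^3*73*353*36683 * Z20*Z12^2*Z2^38*Z30^3 +2^9*3^11*5^3*7^4*349021690219 * Z20^2*Z12^3*Z2^37*Z30^2 +2^11*3^10*5^2*7^3*11*587*3853542631 * Z20^3*Z12^4*Z2^36*Z30 +2^10*3^11*5^2*7^4*11*198879218137 * Z20^4*Z12^5*Z2^35 +2^8*3^12*5^4*7^4*41*419*15139 * Z20^2*Z2^40*Z30^3 +2^9*3^11*5^3*7^3*170173386991 * Z20^3*Z12*Z2^39*Z30^2 +2^9*3^11*5^2*7^3*47*8731*12540581 * Z20^4*Z12^2*Z2^38*Z30 -2^10*3^9*5^2*7^3*631*16453*714151 * Z20^5*Z12^3*Z2^37 +2^11*3^12*5^2*7^3*19*3630744617 * Z12^12*Z2^33 +2^11*3^10*5*7^4*11*3717589009 * Z20^5*Z2^40*Z30 +2^10*3^8*5^4*7^3*17*643*719*109903 * Z12^9*Z2^36*Z30 -2^11*3^9*5*7^3*4133*7243*304907 * Z20^6*Z12*Z2^39 +2^11*3^10*5^2*7^3*11*12131767093 * Z20*Z12^10*Z2^35 -2^10*3^9*5^3*7^3*83*29297*268283 * Z12^6*Z2^39*Z30^2 -2^14*3^11*5^2*7^3*139491370861 * Z20*Z12^7*Z2^38*Z30 -2^12*3^9*5^2*7^3*17^2*19861272577 * Z20^2*Z12^8*Z2^37 +2^18*3^10*5^4*7^3*1619*44357 * Z12^3*Z2^42*Z30^3 +2^12*3^11*5^3*7^3*151*282910193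 * Z20*Z12^4*Z2^41*Z30^2 +2^10*3^10*5^2*7^3*173*9311*2585293 * Z20^2*Z12^5*Z2^40*Z30 +2^12*3^7*5^2*7^3*45834651100351 * Z20^3*Z12^6*Z2^39 -2^12*3^12*5^4*7^3*684121 * Z2^45*Z30^4 +2^11*3^12*5^4*7^3*71*83*179*193 * Z20*Z12*Z2^44*Z30^3 +2^10*3^11*5^3*7^4*31*37*1019*6521 * Z20^2*Z12^2*Z2^43*Z30^2 +2^11*3^8*5^2*7^3*139*101441196979 * Z20^3*Z12^3*Z2^42*Z30 +2^11*3^9*5^2*7^3*351151*6647521 * Z20^4*Z12^4*Z2^41 +2^14*3^9*5^3*7^3*1327*309251 * Z20^3*Z2^45*Z30^2 +2^12*3^10*5^2*7^3*17*41*4937*13249 * Z20^4*Z12*Z2^44*Z30 -2^11*3^10*5^2*7^4*50776597931 * Z20^5*Z12^2*Z2^43 +2^12*3^7*5^4*7^4*29*43*281*31153 * Z12^11*Z2^39 +2^13*3^7*5^3*7^3*109*181*7354283 * Z12^8*Z2^42*Z30 -2^12*3^8*5^2*7^3*607*90804557 * Z20^6*Z2^45 -2^12*3^7*5^3*7^3*227*10651*279967 * Z20*Z12^9*Z2^41 -2^15*3^8*5^2*7^3*53^2*7401907 * Z12^5*Z2^45*Z30^2 -2^12*3^7*5^2*7^3*17*235269698801 * Z20*Z12^6*Z2^44*Z30 -2^12*3^6*5^2*7^3*33851*133712119 * Z20^2*Z12^7*Z2^43 +2^15*3^9*5^4*7^3*163*179*2917 * Z12^2*Z2^48*Z30^3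 +2^11*3^8*5^3*7^3*12577*11233711 * Z20*Z12^3*Z2^47*Z30^2 +2^12*3^7*5^3*7^3*13*29^2*59*850691 * Z20^2*Z12^4*Z2^46*Z30 +2^12*3^7*5^3*7^3*11*82987837567 * Z20^3*Z12^5*Z2^45 +2^11*3^9*5^4*7^3*41*1902613 * Z20*Z2^50*Z30^3 +2^11*3^8*5^3*7^3*311*3449*13781 * Z20^2*Z12*Z2^49*Z30^2 +2^12*3^7*5^4*7^4*35851*115807 * Z20^3*Z12^2*Z2^48*Z30 -2^13*3^8*5^3*7^3*31084535837 * Z20^4*Z12^3*Z2^47 +2^12*3^7*5^3*7^3*367*6651413 * Z20^4*Z2^50*Z30 -2^13*3^6*5^4*7^3*11*1196570233 * Z20^5*Z12*Z2^49 +2^16*3^6*5^4*7^4*254505289 * Z12^10*Z2^45 +2^12*3^5*5^3*7^3*8971*15690341 * Z12^7*Z2^48*Z30 -2^14*3^6*5^3*7^5*2411*769799 * Z20*Z12^8*Z2^47 -2^12*3^6*5^4*7^3*53*1019*43013 * Z12^4*Z2^51*Z30^2 -2^13*3^6*5^3*7^3*153073*402817 * Z20*Z12^5*Z2^50*Z30 +2^16*3^4*5^3*7^3*2017*60384263 * Z20^2*Z12^6*Z2^49 +2^13*3^8*5^4*7^3*27165209 * Z12*Z2^54*Z30^3 +2^12*3^7*5^3*7^3*18637*381001 * Z20*Z12^2*Z2^53*Z30^2 +2^12*3^5*5^3*7^3*113*2195698811 * Z20^2*Z12^3*Z2^52*Z30 +2^14*3^4*5^3*7^3*199*1061*743221 *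 Z20^3*Z12^4*Z2^51 +2^13*3^6*5^3*7^3*227639521 * Z20^2*Z2^55*Z30^2 +2^14*3^5*5^3*7^3*11*17*31217027 * Z20^3*Z12*Z2^54*Z30 -2^15*3^7*5^3*7^3*11689*201767 * Z20^4*Z12^2*Z2^53 -2^19*3^5*5^4*7^4*659*1979 * Z20^5*Z2^55 +2^14*3^5*5^4*7^3*11*4933*28661 * Z12^9*Z2^51 +2^16*3*5^6*7^3*179854793 * Z12^6*Z2^54*Z30 -2^14*3^4*5^4*7^3*13463475413 * Z20*Z12^7*Z2^53 -2^13*3^2*5^6*7^3*11*31*226669 * Z12^3*Z2^57*Z30^2 -2^16*3^2*5^4*7^3*41*2311*38767 * Z20*Z12^4*Z2^56*Z30 +2^14*3*5^4*7^3*37*41*397*533879 * Z20^2*Z12^5*Z2^55 +2^12*3^6*5^3*7^3*27165209 * Z2^60*Z30^3 +2^13*3^7*5^3*7^3*167*350503 * Z20*Z12*Z2^59*Z30^2 +2^15*3^2*5^3*7^3*1619*2861*4909 * Z20^2*Z12^2*Z2^58*Z30 -2^14*5^3*7^3*29*283*110896741 * Z20^3*Z12^3*Z2^57 +2^15*3*5^4*7^4*1289*39023 * Z20^3*Z2^60*Z30 -2^15*3*5^4*7^4*11*13*11210723 * Z20^4*Z12*Z2^59 +2^16*5^6*7^4*23055827 * Z12^8*Z2^57 +2^18*3*5^6*7^4*13*8233 * Z12^5*Z2^60*Z30 -2^16*5^5*7^6*59*120233 * Z20*Z12^6*Z2^59 -2^14*3^2*5^4*7^4*1151659 * Z12^2*Z2^63*Z30^2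 -2^17*3*5^4*7^4*17^2*47*883 * Z20*Z12^3*Z2^62*Z30 +2^16*3*5^4*7^4*29*19709777 * Z20^2*Z12^4*Z2^61 +2^14*3^2*5^4*7^4*1151659 * Z20*Z2^65*Z30^2 +2^17*3^2*5^4*7^4*11*31*43*151 * Z20^2*Z12*Z2^64*Z30 -2^16*3^3*5^4*7^4*19456027 * Z20^3*Z12^2*Z2^63 -2^17*3^2*5^5*7^5*11*4021 * Z20^4*Z2^65 +2^17*3^2*5^7*7^5*853 * Z12^7*Z2^63 +2^16*3^3*5^5*7^5*13*17 * Z12^4*Z2^66*Z30 -2^17*3^2*5^5*7^5*64793 * Z20*Z12^5*Z2^65 -2^17*3^3*5^5*7^5*13*17 * Z20*Z12^2*Z2^68*Z30 +2^17*3^2*5^5*7^7*13*103 * Z20^2*Z12^3*Z2^67 +2^16*3^3*5^5*7^5*13*17 * Z20^2*Z2^70*Z30 -2^17*3^3*5^5*7^5*11^2*61 * Z20^3*Z12*Z2^69 +2^18*3^3*5^6*7^6 * Z12^6*Z2^69 -2^18*3^4*5^6*7^6 * Z20*Z12^4*Z2^71 +2^18*3^4*5^6*7^6 * Z20^2*Z12^2*Z2^73 -2^18*3^3*5^6*7^6 * Z20^3*Z2^75 ) \end{verbatim}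
   Context: Put $\epsilon_1=u_1^2+u_2^2+u_3^2$, $\epsilon_2=u_1^2u_2^2+u_1^2u_3^2+u_2^2u_3^2$, $\epsilon_3=u_1^2u_2^2u_3^2$, $\delta=(u_1^2-u_2^2)(u_1^2-u_3^2)(u_2^2-u_3^2)$, and $$h_2=\epsilon_1,\quad h_6=-11\epsilon_3+\epsilon_1\epsilon_2+\sqrt5\,\delta,\quad h_{10}=95\epsilon_2\epsilon_3-32\epsilon_1^2\epsilon_3-5\epsilon_1\epsilon_2^2+2\epsilon_1^3\epsilon_2+3\sqrt5\,\epsilon_2\delta,$$ polynomials in $(u_1,u_2,u_3)$. Define polynomials in ${\tt u}=(u_1,u_2,u_3,u_4)$ (basic invariants, of degrees 2, 12, 20, 30, of the reflection group of type $H_4$): $$\begin{aligned} Z_2={}&h_2+u_4^2,\\ Z_{12}={}&-h_{10}h_2+\tfrac32h_6^2+(11h_{10}-2h_2^5)u_4^2+(6h_2^4-33h_2h_6)u_4^4-(14h_2^3-33h_6)u_4^6+6h_2^2u_4^8-2h_2u_4^{10},\\ Z_{20}={}&\tfrac12(2h_{10}^2-3h_2h_6^3)+\tfrac12(8h_{10}h_2^4-42h_2^3h_6^2+57h_6^3)u_4^2\\ &-2(38h_{10}h_2^3-2h_2^8+57h_{10}h_6-15h_2^5h_6-84h_2^2h_6^2)u_4^4\\ &+2h_2(148h_{10}h_2-10h_2^6-69h_2^3h_6-153h_6^2)u_4^6\\ &-2(232h_{10}h_2-22h_2^6-201h_2^3h_6-147h_6^2)u_4^8+2(90h_{10}-22h_2^5-201h_2^2h_6)u_4^{10}\\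 &+2h_2(22h_2^3+69h_6)u_4^{12}-10(2h_2^3+3h_6)u_4^{14}+4h_2^2u_4^{16},\\ Z_{30}={}&\tfrac1{15}(20h_{10}^3-45h_{10}h_2h_6^3+27h_6^5)\\ &+(8h_{10}^2h_2^4-42h_{10}h_2^3h_6^2-87h_{10}h_6^3-6h_2^5h_6^3+135h_2^2h_6^4)u_4^2\\ &+(-152h_{10}^2h_2^3+16h_{10}h_2^8+348h_{10}^2h_6+60h_{10}h_2^5h_6+408h_{10}h_2^2h_6^2-84h_2^7h_6^2+84h_2^4h_6^3-909h_2h_6^4)u_4^4\\ &+\tfrac23(1752h_{10}^2h_2^2-516h_{10}h_2^7+16h_2^{12}-3258h_{10}h_2^4h_6+180h_2^9h_6-2862h_{10}h_2h_6^2\\ &\qquad+1998h_2^6h_6^2+432h_2^3h_6^3+3591h_6^4)u_4^6\\ &-2(1616h_{10}^2h_2-1072h_{10}h_2^6+40h_2^{11}-5454h_{10}h_2^3h_6+336h_2^8h_6+453h_{10}h_6^2+3462h_2^5h_6^2+978h_2^2h_6^3)u_4^8\\ &+\tfrac25(8100h_{10}^2-17900h_{10}h_2^5+672h_2^{10}-63330h_{10}h_2^2h_6+4020h_2^7h_6+49920h_2^4h_6^2+18375h_2h_6^3)u_4^{10}\\ &+\tfrac43(10662h_{10}h_2^4-332h_2^9+17631h_{10}h_2h_6-936h_2^6h_6-20547h_2^3h_6^2-4347h_6^3)u_4^{12}\\ &-4(4214h_{10}h_2^3-68h_2^8+1905h_{10}h_6-4647h_2^2h_6^2)u_4^{14}\\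 &+4h_2(2506h_{10}h_2+68h_2^6+312h_2^3h_6-1407h_6^2)u_4^{16}\\ &-\tfrac83(1080h_{10}h_2+166h_2^6+603h_2^3h_6-405h_6^2)u_4^{18}\\ &+\tfrac{24}5(75h_{10}+56h_2^5+140h_2^2h_6)u_4^{20}-40h_2(2h_2^3+3h_6)u_4^{22}+\tfrac{32}3h_2^3u_4^{24}. \end{aligned}$$ Let $k_2,k_6,k_{10}$ be obtained from $h_2,h_6,h_{10}$ by replacing $\sqrt5$ by $-\sqrt5$, and let $Z_j^{*}=Z_j^{*}(u_1,u_2,u_3,u_4)$ be obtained from $Z_j$ by replacing $h_2,h_6,h_{10}$ by $k_2,k_6,k_{10}$ ($j=2,12,20,30$). Let $$f(u_1,u_2,u_3,u_4)=\tfrac1{168}u_4\left(-21h_6+14h_2^2u_4^2-14h_2u_4^4+2u_4^6\right)$$ with $h_2,h_6$ evaluated at $(u_1,u_2,u_3)$, and $$P_1({\tt u})=f(u_4,u_3,u_2,u_1),\quad P_2({\tt u})=f(u_3,u_4,u_1,u_2),\quad P_3({\tt u})=f(u_2,u_1,u_4,u_3),\quad P_4({\tt u})=f(u_1,u_2,u_3,u_4).$$ *)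

(* Defs.v *)
From Stdlib Require Import BinInt.
From mathcomp Require Import all_boot all_order all_algebra ssrZ mpoly.

Set Implicit Arguments.
Unset Strict Implicit.
Unset Printing Implicit Defensive.

Import Order.TTheory GRing.Theory Num.Theory.

Local Open Scope ring_scope.

(* Integer multiple with a binary literal: MathComp's own numerals are unary
   and cannot hold the coefficients below. As [**] has the precedence of [*],
   [2^5*3 ** x * y] reads as [((2^5*3) ** x) * y], with [2^5*3] in Z. *)
Local Notation "c ** x" := (x *~ int_of_Z c)
  (at level 40, left associativity).

(* The formulas are stated in an arbitrary commutative K-algebra A, so that they
   apply both to the variables and to other polynomials (the P_i, the Z_j).
   The parameter r5 stands for sqrt 5; conjugation is r5 |-> - r5. *)

Definition eps1 (K : fieldType) (A : comAlgType K) (u1 u2 u3 : A) : A :=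
  u1 ^+ 2 + u2 ^+ 2 + u3 ^+ 2.

Definition eps2 (K : fieldType) (A : comAlgType K) (u1 u2 u3 : A) : A :=
  u1 ^+ 2 * u2 ^+ 2 + u1 ^+ 2 * u3 ^+ 2 + u2 ^+ 2 * u3 ^+ 2.

Definition eps3 (K : fieldType) (A : comAlgType K) (u1 u2 u3 : A) : A :=
  u1 ^+ 2 * u2 ^+ 2 * u3 ^+ 2.

Definition delta (K : fieldType) (A : comAlgType K) (u1 u2 u3 : A) : A :=
  (u1 ^+ 2 - u2 ^+ 2) * (u1 ^+ 2 - u3 ^+ 2) * (u2 ^+ 2 - u3 ^+ 2).

Definition h2 (K : fieldType) (A : comAlgType K) (u1 u2 u3 : A) : A :=
  eps1 u1 u2 u3.

Definition h6 (K : fieldType) (A : comAlgType K) (r5 : K) (u1 u2 u3 : A) : A :=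
  let e1 := eps1 u1 u2 u3 in
  let e2 := eps2 u1 u2 u3 in
  let e3 := eps3 u1 u2 u3 in
  - (11 ** e3) + e1 * e2 + r5 *: delta u1 u2 u3.

Definition h10 (K : fieldType) (A : comAlgType K) (r5 : K) (u1 u2 u3 : A) : A :=
  let e1 := eps1 u1 u2 u3 in
  let e2 := eps2 u1 u2 u3 in
  let e3 := eps3 u1 u2 u3 in
  95 ** e2 * e3 - 32 ** e1 ^+ 2 * e3 - 5 ** e1 * e2 ^+ 2
  + 2 ** e1 ^+ 3 * e2 + (3 * r5) *: (e2 * delta u1 u2 u3).

Definition Z2_form (K : fieldType) (A : comAlgType K) (h2 u4 : A) : A :=
  h2 + u4 ^+ 2.

Definition Z12_form (K : fieldType) (A : comAlgType K) (h2 h6 h10 u4 : A) : A :=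
  - h10 * h2 + (3 / 2) *: h6 ^+ 2 + (11 ** h10 - 2 ** h2 ^+ 5) * u4 ^+ 2
    + (6 ** h2 ^+ 4 - 33 ** h2 * h6) * u4 ^+ 4 - (14 ** h2 ^+ 3
        - 33 ** h6) * u4 ^+ 6
    + 6 ** h2 ^+ 2 * u4 ^+ 8 - 2 ** h2 * u4 ^+ 10.

Definition Z20_form (K : fieldType) (A : comAlgType K) (h2 h6 h10 u4 : A) : A :=
  (1 / 2) *: (2 ** h10 ^+ 2 - 3 ** h2 * h6 ^+ 3)
    + (1 / 2) *: (8 ** h10 * h2 ^+ 4 - 42 ** h2 ^+ 3 * h6 ^+ 2
        + 57 ** h6 ^+ 3) * u4 ^+ 2
    - 2 ** (38 ** h10 * h2 ^+ 3 - 2 ** h2 ^+ 8 + 57 ** h10 * h6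
        - 15 ** h2 ^+ 5 * h6 - 84 ** h2 ^+ 2 * h6 ^+ 2) * u4 ^+ 4
    + 2 ** h2 * (148 ** h10 * h2 - 10 ** h2 ^+ 6 - 69 ** h2 ^+ 3 * h6
        - 153 ** h6 ^+ 2) * u4 ^+ 6
    - 2 ** (232 ** h10 * h2 - 22 ** h2 ^+ 6 - 201 ** h2 ^+ 3 * h6
        - 147 ** h6 ^+ 2) * u4 ^+ 8
    + 2 ** (90 ** h10 - 22 ** h2 ^+ 5 - 201 ** h2 ^+ 2 * h6) * u4 ^+ 10
    + 2 ** h2 * (22 ** h2 ^+ 3 + 69 ** h6) * u4 ^+ 12
    - 10 ** (2 ** h2 ^+ 3 + 3 ** h6) * u4 ^+ 14
    + 4 ** h2 ^+ 2 * u4 ^+ 16.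

Definition Z30_form (K : fieldType) (A : comAlgType K) (h2 h6 h10 u4 : A) : A :=
  (1 / 15) *: (20 ** h10 ^+ 3 - 45 ** h10 * h2 * h6 ^+ 3 + 27 ** h6 ^+ 5)
    + (8 ** h10 ^+ 2 * h2 ^+ 4 - 42 ** h10 * h2 ^+ 3 * h6 ^+ 2
        - 87 ** h10 * h6 ^+ 3 - 6 ** h2 ^+ 5 * h6 ^+ 3
       + 135 ** h2 ^+ 2 * h6 ^+ 4) * u4 ^+ 2
    + (- 152 ** h10 ^+ 2 * h2 ^+ 3 + 16 ** h10 * h2 ^+ 8 + 348 ** h10 ^+ 2 * h6
        + 60 ** h10 * h2 ^+ 5 * h6
       + 408 ** h10 * h2 ^+ 2 * h6 ^+ 2 - 84 ** h2 ^+ 7 * h6 ^+ 2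
           + 84 ** h2 ^+ 4 * h6 ^+ 3 - 909 ** h2 * h6 ^+ 4) * u4 ^+ 4
    + (2 / 3) *: (1752 ** h10 ^+ 2 * h2 ^+ 2 - 516 ** h10 * h2 ^+ 7
        + 16 ** h2 ^+ 12 - 3258 ** h10 * h2 ^+ 4 * h6
       + 180 ** h2 ^+ 9 * h6 - 2862 ** h10 * h2 * h6 ^+ 2
       + 1998 ** h2 ^+ 6 * h6 ^+ 2 + 432 ** h2 ^+ 3 * h6 ^+ 3
           + 3591 ** h6 ^+ 4) * u4 ^+ 6
    - 2 ** (1616 ** h10 ^+ 2 * h2 - 1072 ** h10 * h2 ^+ 6 + 40 ** h2 ^+ 11
        - 5454 ** h10 * h2 ^+ 3 * h6
       + 336 ** h2 ^+ 8 * h6 + 453 ** h10 * h6 ^+ 2 + 3462 ** h2 ^+ 5 * h6 ^+ 2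
           + 978 ** h2 ^+ 2 * h6 ^+ 3) * u4 ^+ 8
    + (2 / 5) *: (8100 ** h10 ^+ 2 - 17900 ** h10 * h2 ^+ 5 + 672 ** h2 ^+ 10
        - 63330 ** h10 * h2 ^+ 2 * h6
       + 4020 ** h2 ^+ 7 * h6 + 49920 ** h2 ^+ 4 * h6 ^+ 2
           + 18375 ** h2 * h6 ^+ 3) * u4 ^+ 10
    + (4 / 3) *: (10662 ** h10 * h2 ^+ 4 - 332 ** h2 ^+ 9
        + 17631 ** h10 * h2 * h6 - 936 ** h2 ^+ 6 * h6
       - 20547 ** h2 ^+ 3 * h6 ^+ 2 - 4347 ** h6 ^+ 3) * u4 ^+ 12
    - 4 ** (4214 ** h10 * h2 ^+ 3 - 68 ** h2 ^+ 8 + 1905 ** h10 * h6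
        - 4647 ** h2 ^+ 2 * h6 ^+ 2) * u4 ^+ 14
    + 4 ** h2 * (2506 ** h10 * h2 + 68 ** h2 ^+ 6 + 312 ** h2 ^+ 3 * h6
        - 1407 ** h6 ^+ 2) * u4 ^+ 16
    - (8 / 3) *: (1080 ** h10 * h2 + 166 ** h2 ^+ 6 + 603 ** h2 ^+ 3 * h6
        - 405 ** h6 ^+ 2) * u4 ^+ 18
    + (24 / 5) *: (75 ** h10 + 56 ** h2 ^+ 5 + 140 ** h2 ^+ 2 * h6) * u4 ^+ 20
    - 40 ** h2 * (2 ** h2 ^+ 3 + 3 ** h6) * u4 ^+ 22
    + (32 / 3) *: h2 ^+ 3 * u4 ^+ 24.

(* u_k is the variable of index k - 1. *)
Definition u1 (K : fieldType) : {mpoly K[4]} := 'X_(@Ordinal 4 0 isT).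
Definition u2 (K : fieldType) : {mpoly K[4]} := 'X_(@Ordinal 4 1 isT).
Definition u3 (K : fieldType) : {mpoly K[4]} := 'X_(@Ordinal 4 2 isT).
Definition u4 (K : fieldType) : {mpoly K[4]} := 'X_(@Ordinal 4 3 isT).

(* Z_j at r5 = sqrt 5; the conjugate Z_j^* is the same polynomial at - r5
   (h_2 does not involve sqrt 5, so k_2 = h_2 and Z_2^* = Z_2). *)
Definition Z2 (K : fieldType) : {mpoly K[4]} :=
  Z2_form (h2 (u1 K) (u2 K) (u3 K)) (u4 K).

Definition Z12 (K : fieldType) (r5 : K) : {mpoly K[4]} :=
  Z12_form (h2 (u1 K) (u2 K) (u3 K)) (h6 r5 (u1 K) (u2 K) (u3 K))
    (h10 r5 (u1 K) (u2 K) (u3 K)) (u4 K).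

Definition Z20 (K : fieldType) (r5 : K) : {mpoly K[4]} :=
  Z20_form (h2 (u1 K) (u2 K) (u3 K)) (h6 r5 (u1 K) (u2 K) (u3 K))
    (h10 r5 (u1 K) (u2 K) (u3 K)) (u4 K).

Definition Z30 (K : fieldType) (r5 : K) : {mpoly K[4]} :=
  Z30_form (h2 (u1 K) (u2 K) (u3 K)) (h6 r5 (u1 K) (u2 K) (u3 K))
    (h10 r5 (u1 K) (u2 K) (u3 K)) (u4 K).

Definition f (K : fieldType) (A : comAlgType K) (r5 : K) (u1 u2 u3 u4 : A) : A :=
  168^-1 *: (u4 * (- (21 ** h6 r5 u1 u2 u3)
                   + 14 ** h2 u1 u2 u3 ^+ 2 * u4 ^+ 2
                   - 14 ** h2 u1 u2 u3 * u4 ^+ 4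
                   + 2 ** u4 ^+ 6)).

Definition P1 (K : fieldType) (r5 : K) : {mpoly K[4]} :=
  f r5 (u4 K) (u3 K) (u2 K) (u1 K).
Definition P2 (K : fieldType) (r5 : K) : {mpoly K[4]} :=
  f r5 (u3 K) (u4 K) (u1 K) (u2 K).
Definition P3 (K : fieldType) (r5 : K) : {mpoly K[4]} :=
  f r5 (u2 K) (u1 K) (u4 K) (u3 K).
Definition P4 (K : fieldType) (r5 : K) : {mpoly K[4]} :=
  f r5 (u1 K) (u2 K) (u3 K) (u4 K).

(* The right-hand sides: Yj_form Z2 Z12 Z20 Z30 is the claimed value of Y_j. *)
Definition Y2_form (K : fieldType) (A : comAlgType K)
    (Z2 Z12 Z20 Z30 : A) : A :=
  (int_of_Z (2^5*3^2*7^2))%:~R^-1 *: (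
       3*7 ** Z12 * Z2
     + 2 ** Z2 ^+ 7).

Definition Y12_form (K : fieldType) (A : comAlgType K)
    (Z2 Z12 Z20 Z30 : A) : A :=
  (int_of_Z (2^32*3^14*5^2*7^12))%:~R^-1 *: (
       2^3*3^12*5^4*7 ** Z12 ^+ 2 * Z30 ^+ 2
     + 2^3*3^12*5^4*7 ** Z20 * Z2 ^+ 2 * Z30 ^+ 2
     + 3^14*5^5*7 ** Z20 ^+ 2 * Z12 * Z2 * Z30
     + 2*3^10*5^7*7 ** Z20 ^+ 3 * Z12 ^+ 2
     + 2*3^10*5^7*7 ** Z20 ^+ 4 * Z2 ^+ 2
     - 2^8*3^8*5^5 ** Z12 ^+ 7
     - 2^4*3^9*5^3*7*103 ** Z12 ^+ 4 * Z2 ^+ 3 * Z30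
     - 2^2*3^8*5^4*7*113 ** Z20 * Z12 ^+ 5 * Z2 ^+ 2
     + 2^6*3^11*5^3*7 ** Z12 * Z2 ^+ 6 * Z30 ^+ 2
     + 2^3*3^9*5^2*7*41*43 ** Z20 * Z12 ^+ 2 * Z2 ^+ 5 * Z30
     + 2^3*3^8*5^4*7*17 ** Z20 ^+ 2 * Z12 ^+ 3 * Z2 ^+ 4
     - 2*3^9*5^2*7*17*29 ** Z20 ^+ 2 * Z2 ^+ 7 * Z30
     + 2^2*3^9*5^3*7^2*137 ** Z20 ^+ 3 * Z12 * Z2 ^+ 6
     - 2^4*3^6*5^2*7*1861 ** Z12 ^+ 6 * Z2 ^+ 6
     - 2^5*3^7*5^2*7*11*17 ** Z12 ^+ 3 * Z2 ^+ 9 * Z30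
     - 2^3*3^7*5*7*11*41*53 ** Z20 * Z12 ^+ 4 * Z2 ^+ 8
     + 2^5*3^9*5^3*7 ** Z2 ^+ 12 * Z30 ^+ 2
     + 2^3*3^8*5*7*307 ** Z20 * Z12 * Z2 ^+ 11 * Z30
     + 2^3*3^8*7*11*6089 ** Z20 ^+ 2 * Z12 ^+ 2 * Z2 ^+ 10
     + 2^5*3^6*7*97*307 ** Z20 ^+ 3 * Z2 ^+ 12
     - 2^4*3^5*7^3*13*277 ** Z12 ^+ 5 * Z2 ^+ 12
     - 2^5*3^6*5*7*17*23 ** Z12 ^+ 2 * Z2 ^+ 15 * Z30
     + 2^5*3^5*5^2*7*13*139 ** Z20 * Z12 ^+ 3 * Z2 ^+ 14
     - 2^4*3^6*5*7*17*19 ** Z20 * Z2 ^+ 17 * Z30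
     + 2^4*3^7*5*7*3011 ** Z20 ^+ 2 * Z12 * Z2 ^+ 16
     - 2^5*3^2*5^2*7^2*37*71 ** Z12 ^+ 4 * Z2 ^+ 18
     - 2^4*3^5*5*7*13*17 ** Z12 * Z2 ^+ 21 * Z30
     + 2^5*3^2*5*7^2*23*541 ** Z20 * Z12 ^+ 2 * Z2 ^+ 20
     + 2^6*3^2*5*7*47*137 ** Z20 ^+ 2 * Z2 ^+ 22
     - 2^8*5^2*7*11*127 ** Z12 ^+ 3 * Z2 ^+ 24
     - 2^5*3*5*7*13*17 ** Z2 ^+ 27 * Z30
     + 2^7*3*5*7*4793 ** Z20 * Z12 * Z2 ^+ 26
     - 2^7*3^2*5^2*7^2 ** Z12 ^+ 2 * Z2 ^+ 30
     + 2^7*3^2*5^2*7^2 ** Z20 * Z2 ^+ 32).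

Definition Y20_form (K : fieldType) (A : comAlgType K)
    (Z2 Z12 Z20 Z30 : A) : A :=
  (int_of_Z (2^54*3^22*5^4*7^20))%:~R^-1 *: (
     - 2^5*3^20*5^8*7 ** Z20 * Z30 ^+ 4
     + 3^18*5^11*7*11 ** Z20 ^+ 4 * Z30 ^+ 2
     - 2^4*3^16*5^13 ** Z20 ^+ 7
     - 2^6*3^17*5^7*7*13 ** Z12 ^+ 4 * Z2 * Z30 ^+ 3
     + 2^8*3^16*5^9*7 ** Z20 * Z12 ^+ 5 * Z30 ^+ 2
     - 2^7*3^18*5^8*7 ** Z12 * Z2 ^+ 4 * Z30 ^+ 4
     + 2^7*3^17*5^7*7*107 ** Z20 * Z12 ^+ 2 * Z2 ^+ 3 * Z30 ^+ 3
     + 2^9*3^16*5^10*7 ** Z20 ^+ 2 * Z12 ^+ 3 * Z2 ^+ 2 * Z30 ^+ 2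
     + 2^3*3^15*5^10*7*271 ** Z20 ^+ 3 * Z12 ^+ 4 * Z2 * Z30
     + 2^3*3^14*5^11*7*13 ** Z20 ^+ 4 * Z12 ^+ 5
     + 2^6*3^17*5^6*7*467 ** Z20 ^+ 2 * Z2 ^+ 5 * Z30 ^+ 3
     + 2^4*3^16*5^10*7*71 ** Z20 ^+ 3 * Z12 * Z2 ^+ 4 * Z30 ^+ 2
     + 2^5*3^15*5^10*7*53 ** Z20 ^+ 4 * Z12 ^+ 2 * Z2 ^+ 3 * Z30
     + 2^4*3^14*5^12*7*13 ** Z20 ^+ 5 * Z12 ^+ 3 * Z2 ^+ 2
     - 2^3*3^15*5^9*7*389 ** Z20 ^+ 5 * Z2 ^+ 5 * Z30
     + 2^11*3^13*5^8*7*11 ** Z12 ^+ 9 * Z2 * Z30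
     - 2^3*3^17*5^12*7 ** Z20 ^+ 6 * Z12 * Z2 ^+ 4
     + 2^13*3^12*5^9*7 ** Z20 * Z12 ^+ 10
     + 2^12*3^14*5^7*7^2 ** Z12 ^+ 6 * Z2 ^+ 4 * Z30 ^+ 2
     + 2^4*3^14*5^7*7*859 ** Z20 * Z12 ^+ 7 * Z2 ^+ 3 * Z30
     + 2^5*3^13*5^10*7*103 ** Z20 ^+ 2 * Z12 ^+ 8 * Z2 ^+ 2
     + 2^7*3^15*5^8*7*83 ** Z12 ^+ 3 * Z2 ^+ 7 * Z30 ^+ 3
     + 2^6*3^16*5^5*7^3*59 ** Z20 * Z12 ^+ 4 * Z2 ^+ 6 * Z30 ^+ 2
     + 2^4*3^14*5^10*7^3 ** Z20 ^+ 2 * Z12 ^+ 5 * Z2 ^+ 5 * Z30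
     - 2^5*3^12*5^8*7^2*2917 ** Z20 ^+ 3 * Z12 ^+ 6 * Z2 ^+ 4
     - 2^7*3^17*5^7*7 ** Z2 ^+ 10 * Z30 ^+ 4
     + 2^6*3^15*5^6*7*41*101 ** Z20 * Z12 * Z2 ^+ 9 * Z30 ^+ 3
     + 2^6*3^15*5^5*7*241*421 ** Z20 ^+ 2 * Z12 ^+ 2 * Z2 ^+ 8 * Z30 ^+ 2
     + 2^6*3^13*5^7*7*23*1031 ** Z20 ^+ 3 * Z12 ^+ 3 * Z2 ^+ 7 * Z30
     + 2^5*3^14*5^8*7^2*479 ** Z20 ^+ 4 * Z12 ^+ 4 * Z2 ^+ 6
     + 2^4*3^14*5^4*7*77983 ** Z20 ^+ 3 * Z2 ^+ 10 * Z30 ^+ 2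
     - 2^5*3^15*5^8*7*11*89 ** Z20 ^+ 4 * Z12 * Z2 ^+ 9 * Z30
     - 2^5*3^14*5^8*7*3917 ** Z20 ^+ 5 * Z12 ^+ 2 * Z2 ^+ 8
     - 2^5*3^12*5^7*7^2*11^2 ** Z12 ^+ 11 * Z2 ^+ 4
     + 2^6*3^13*5^5*7*23*2953 ** Z12 ^+ 8 * Z2 ^+ 7 * Z30
     + 2^6*3^13*5^7*7^2*79 ** Z20 ^+ 6 * Z2 ^+ 10
     + 2^10*3^11*5^6*7^2*23*89 ** Z20 * Z12 ^+ 9 * Z2 ^+ 6
     - 2^7*3^16*5^5*7^3*41 ** Z12 ^+ 5 * Z2 ^+ 10 * Z30 ^+ 2
     - 2^5*3^13*5^5*7^3*37*109 ** Z20 * Z12 ^+ 6 * Z2 ^+ 9 * Z30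
     - 2^5*3^12*5^5*7*901679 ** Z20 ^+ 2 * Z12 ^+ 7 * Z2 ^+ 8
     + 2^9*3^15*5^6*7^2*23 ** Z12 ^+ 2 * Z2 ^+ 13 * Z30 ^+ 3
     + 2^8*3^14*5^5*7^2*13*127 ** Z20 * Z12 ^+ 3 * Z2 ^+ 12 * Z30 ^+ 2
     + 2^6*3^13*5^3*7^2*171827 ** Z20 ^+ 2 * Z12 ^+ 4 * Z2 ^+ 11 * Z30
     + 2^6*3^16*5^5*7^2*277 ** Z20 ^+ 3 * Z12 ^+ 5 * Z2 ^+ 10
     + 2^7*3^14*5^5*7^2*241 ** Z20 * Z2 ^+ 15 * Z30 ^+ 3
     + 2^6*3^18*5^4*7^2*103 ** Z20 ^+ 2 * Z12 * Z2 ^+ 14 * Z30 ^+ 2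
     - 2^6*3^14*5^3*7^2*11*13*29*101 ** Z20 ^+ 3 * Z12 ^+ 2 * Z2 ^+ 13 * Z30
     - 2^7*3^12*5^5*7^2*137*599 ** Z20 ^+ 4 * Z12 ^+ 3 * Z2 ^+ 12
     - 2^5*3^13*5^2*7^3*111491 ** Z20 ^+ 4 * Z2 ^+ 15 * Z30
     + 2^7*3^13*5^6*7^2*523 ** Z20 ^+ 5 * Z12 * Z2 ^+ 14
     + 2^6*3^13*5^4*7*42589 ** Z12 ^+ 10 * Z2 ^+ 10
     + 2^6*3^10*5^3*7*17*2056963 ** Z12 ^+ 7 * Z2 ^+ 13 * Z30
     + 2^11*3^9*5^3*7*11*295909 ** Z20 * Z12 ^+ 8 * Z2 ^+ 12
     - 2^8*3^11*5^4*7^2*13*19*211 ** Z12 ^+ 4 * Z2 ^+ 16 * Z30 ^+ 2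
     - 2^6*3^10*5^3*7^2*11*318431 ** Z20 * Z12 ^+ 5 * Z2 ^+ 15 * Z30
     - 2^6*3^9*5^3*7^2*191*38569 ** Z20 ^+ 2 * Z12 ^+ 6 * Z2 ^+ 14
     + 2^8*3^11*5^5*7^2*1621 ** Z12 * Z2 ^+ 19 * Z30 ^+ 3
     + 2^9*3^10*5^5*7^2*11*233 ** Z20 * Z12 ^+ 2 * Z2 ^+ 18 * Z30 ^+ 2
     - 2^7*3^10*5^3*7^2*5484503 ** Z20 ^+ 2 * Z12 ^+ 3 * Z2 ^+ 17 * Z30
     - 2^11*3^10*5*7^2*11448077 ** Z20 ^+ 3 * Z12 ^+ 4 * Z2 ^+ 16
     - 2^5*3^10*5^3*7^2*163*1367 ** Z20 ^+ 2 * Z2 ^+ 20 * Z30 ^+ 2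
     - 2^8*3^9*5^2*7^2*12136211 ** Z20 ^+ 3 * Z12 * Z2 ^+ 19 * Z30
     + 2^7*3^8*5*7^2*409*701*811 ** Z20 ^+ 4 * Z12 ^+ 2 * Z2 ^+ 18
     + 2^7*3^8*7^2*283*759631 ** Z20 ^+ 5 * Z2 ^+ 20
     + 2^7*3^10*5^2*7^2*1480541 ** Z12 ^+ 9 * Z2 ^+ 16
     + 2^7*3^7*5^2*7^3*14996291 ** Z12 ^+ 6 * Z2 ^+ 19 * Z30
     + 2^8*3^6*5*7^2*798329969 ** Z20 * Z12 ^+ 7 * Z2 ^+ 18
     - 2^14*3^8*5^4*7^2*3461 ** Z12 ^+ 3 * Z2 ^+ 22 * Z30 ^+ 2
     - 2^8*3^7*5^2*7^2*661*93463 ** Z20 * Z12 ^+ 4 * Z2 ^+ 21 * Z30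
     - 2^7*3^8*5*7^3*751*81553 ** Z20 ^+ 2 * Z12 ^+ 5 * Z2 ^+ 20
     + 2^9*3^10*5^3*7^2*1621 ** Z2 ^+ 25 * Z30 ^+ 3
     - 2^8*3^8*5^3*7^2*13*13597 ** Z20 * Z12 * Z2 ^+ 24 * Z30 ^+ 2
     - 2^12*3^9*5^2*7^2*601^2 ** Z20 ^+ 2 * Z12 ^+ 2 * Z2 ^+ 23 * Z30
     - 2^13*3^6*5*7^2*701*3121 ** Z20 ^+ 3 * Z12 ^+ 3 * Z2 ^+ 22
     - 2^7*3^7*5^2*7^2*17*241877 ** Z20 ^+ 3 * Z2 ^+ 25 * Z30
     + 2^8*3^7*5*7^2*95436673 ** Z20 ^+ 4 * Z12 * Z2 ^+ 24
     + 2^8*3^6*5^2*7^3*4115879 ** Z12 ^+ 8 * Z2 ^+ 22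
     + 2^10*3^7*5*7^2*8375963 ** Z12 ^+ 5 * Z2 ^+ 25 * Z30
     - 2^13*3^5*5*7^2*131*233*331 ** Z20 * Z12 ^+ 6 * Z2 ^+ 24
     - 2^10*3^9*5^3*7^2*11*743 ** Z12 ^+ 2 * Z2 ^+ 28 * Z30 ^+ 2
     - 2^8*3^6*5^2*7^2*28005389 ** Z20 * Z12 ^+ 3 * Z2 ^+ 27 * Z30
     - 2^8*3^7*5^3*7^3*402503 ** Z20 ^+ 2 * Z12 ^+ 4 * Z2 ^+ 26
     - 2^8*3^7*5^3*7^2*11*29*79 ** Z20 * Z2 ^+ 30 * Z30 ^+ 2
     - 2^8*3^7*5^2*7^2*199*10889 ** Z20 ^+ 2 * Z12 * Z2 ^+ 29 * Z30
     + 2^9*3^6*5^3*7^2*421*5749 ** Z20 ^+ 3 * Z12 ^+ 2 * Z2 ^+ 28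
     + 2^10*3^5*5^2*7^2*11*123191 ** Z20 ^+ 4 * Z2 ^+ 30
     + 2^9*3^6*5^2*7^3*17*139*157 ** Z12 ^+ 7 * Z2 ^+ 28
     + 2^9*3^4*5^3*7^2*41*25867 ** Z12 ^+ 4 * Z2 ^+ 31 * Z30
     - 2^12*3^3*5^2*7^3*13*162263 ** Z20 * Z12 ^+ 5 * Z2 ^+ 30
     - 2^10*3^5*5^3*7^2*71*409 ** Z12 * Z2 ^+ 34 * Z30 ^+ 2
     - 2^9*3^4*5^2*7^2*19*127*3109 ** Z20 * Z12 ^+ 2 * Z2 ^+ 33 * Z30
     + 2^9*3^3*5^2*7^2*607*32801 ** Z20 ^+ 2 * Z12 ^+ 3 * Z2 ^+ 32
     - 2^12*3^4*5^2*7^2*173*241 ** Z20 ^+ 2 * Z2 ^+ 35 * Z30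
     + 2^10*3^5*5^2*7^2*11*118493 ** Z20 ^+ 3 * Z12 * Z2 ^+ 34
     + 2^10*3^5*5^4*7^2*17*751 ** Z12 ^+ 6 * Z2 ^+ 34
     + 2^10*3*5^4*7^2*13^2*439 ** Z12 ^+ 3 * Z2 ^+ 37 * Z30
     - 2^11*5^3*7^2*17*901141 ** Z20 * Z12 ^+ 4 * Z2 ^+ 36
     - 2^8*3^4*5^2*7^2*71*409 ** Z2 ^+ 40 * Z30 ^+ 2
     - 2^10*3*5^2*7^2*11*218947 ** Z20 * Z12 * Z2 ^+ 39 * Z30
     + 2^10*3*5^2*7^2*53*430499 ** Z20 ^+ 2 * Z12 ^+ 2 * Z2 ^+ 38
     + 2^12*5^3*7^3*11*4021 ** Z20 ^+ 3 * Z2 ^+ 40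
     + 2^12*5^5*7^3*853 ** Z12 ^+ 5 * Z2 ^+ 40
     + 2^11*3*5^3*7^3*13*17 ** Z12 ^+ 2 * Z2 ^+ 43 * Z30
     - 2^14*5^3*7^3*10867 ** Z20 * Z12 ^+ 3 * Z2 ^+ 42
     - 2^11*3*5^3*7^3*13*17 ** Z20 * Z2 ^+ 45 * Z30
     + 2^12*3*5^3*7^3*11^2*61 ** Z20 ^+ 2 * Z12 * Z2 ^+ 44
     + 2^12*3^2*5^4*7^4 ** Z12 ^+ 4 * Z2 ^+ 46
     - 2^13*3^2*5^4*7^4 ** Z20 * Z12 ^+ 2 * Z2 ^+ 48
     + 2^12*3^2*5^4*7^4 ** Z20 ^+ 2 * Z2 ^+ 50).

Definition Y30_form (K : fieldType) (A : comAlgType K)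
    (Z2 Z12 Z20 Z30 : A) : A :=
  (int_of_Z (2^79*3^34*5^6*7^30))%:~R^-1 *: (
     - 2^7*3^31*5^12 ** Z30 ^+ 7
     + 2^4*3^30*5^12*7*107 ** Z20 ^+ 3 * Z30 ^+ 5
     - 3^28*5^16*7*71 ** Z20 ^+ 6 * Z30 ^+ 3
     + 2^9*3^28*5^10*7*23 ** Z12 ^+ 5 * Z30 ^+ 5
     + 2^4*3^25*5^19*7 ** Z20 ^+ 9 * Z30
     + 2^10*3^29*5^12*7 ** Z12 ^+ 2 * Z2 ^+ 3 * Z30 ^+ 6
     + 2^10*3^28*5^11*7*23 ** Z20 * Z12 ^+ 3 * Z2 ^+ 2 * Z30 ^+ 5
     + 2^5*3^27*5^12*7*1129 ** Z20 ^+ 2 * Z12 ^+ 4 * Z2 * Z30 ^+ 4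
     - 2^6*3^26*5^14*7*41 ** Z20 ^+ 3 * Z12 ^+ 5 * Z30 ^+ 3
     + 2^11*3^29*5^11*7 ** Z20 * Z2 ^+ 5 * Z30 ^+ 6
     + 2^6*3^28*5^11*7*1789 ** Z20 ^+ 2 * Z12 * Z2 ^+ 4 * Z30 ^+ 5
     - 2^6*3^27*5^12*7*2081 ** Z20 ^+ 3 * Z12 ^+ 2 * Z2 ^+ 3 * Z30 ^+ 4
     - 2^7*3^26*5^15*7*41 ** Z20 ^+ 4 * Z12 ^+ 3 * Z2 ^+ 2 * Z30 ^+ 3
     - 2^2*3^25*5^15*7*5393 ** Z20 ^+ 5 * Z12 ^+ 4 * Z2 * Z30 ^+ 2
     - 2^2*3^24*5^18*7*11 ** Z20 ^+ 6 * Z12 ^+ 5 * Z30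
     - 2^5*3^27*5^11*7^3*239 ** Z20 ^+ 4 * Z2 ^+ 5 * Z30 ^+ 4
     - 2^3*3^26*5^15*7^2*199 ** Z20 ^+ 5 * Z12 * Z2 ^+ 4 * Z30 ^+ 3
     - 2^15*3^24*5^12*7 ** Z12 ^+ 10 * Z30 ^+ 3
     - 2^4*3^25*5^15*7^2*157 ** Z20 ^+ 6 * Z12 ^+ 2 * Z2 ^+ 3 * Z30 ^+ 2
     - 2^3*3^24*5^19*7*11 ** Z20 ^+ 7 * Z12 ^+ 3 * Z2 ^+ 2 * Z30
     + 2^4*3^23*5^18*7*23 ** Z20 ^+ 8 * Z12 ^+ 4 * Z2
     + 2^7*3^25*5^10*7*1039 ** Z12 ^+ 7 * Z2 ^+ 3 * Z30 ^+ 4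
     + 2^7*3^25*5^11*7*71*127 ** Z20 * Z12 ^+ 8 * Z2 ^+ 2 * Z30 ^+ 3
     + 2^2*3^25*5^14*7*83*89 ** Z20 ^+ 7 * Z2 ^+ 5 * Z30 ^+ 2
     + 2^9*3^23*5^13*7*13*73 ** Z20 ^+ 2 * Z12 ^+ 9 * Z2 * Z30 ^+ 2
     + 2^2*3^24*5^19*7*37 ** Z20 ^+ 8 * Z12 * Z2 ^+ 4 * Z30
     + 2^11*3^22*5^15*7*23 ** Z20 ^+ 3 * Z12 ^+ 10 * Z30
     + 2^5*3^24*5^18*7 ** Z20 ^+ 9 * Z12 ^+ 2 * Z2 ^+ 3
     - 2^9*3^26*5^10*7^2*373 ** Z12 ^+ 4 * Z2 ^+ 6 * Z30 ^+ 5
     - 2^7*3^26*5^9*7^2*59*163 ** Z20 * Z12 ^+ 5 * Z2 ^+ 5 * Z30 ^+ 4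
     - 2^7*3^26*5^11*7^2*1123 ** Z20 ^+ 2 * Z12 ^+ 6 * Z2 ^+ 4 * Z30 ^+ 3
     + 2^3*3^23*5^12*7*11*263*349 ** Z20 ^+ 3 * Z12 ^+ 7 * Z2 ^+ 3 * Z30 ^+ 2
     + 2^3*3^23*5^14*7*22811 ** Z20 ^+ 4 * Z12 ^+ 8 * Z2 ^+ 2 * Z30
     - 2^4*3^24*5^17*7*19 ** Z20 ^+ 10 * Z2 ^+ 5
     + 2^6*3^21*5^16*7*17*37 ** Z20 ^+ 5 * Z12 ^+ 9 * Z2
     + 2^9*3^28*5^11*7^2 ** Z12 * Z2 ^+ 9 * Z30 ^+ 6
     + 2^10*3^27*5^10*7^2*59 ** Z20 * Z12 ^+ 2 * Z2 ^+ 8 * Z30 ^+ 5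
     - 2^6*3^26*5^10*7^2*36697 ** Z20 ^+ 2 * Z12 ^+ 3 * Z2 ^+ 7 * Z30 ^+ 4
     - 2^5*3^24*5^10*7^2*491*1493 ** Z20 ^+ 3 * Z12 ^+ 4 * Z2 ^+ 6 * Z30 ^+ 3
     - 2^3*3^24*5^12*7^2*24977 ** Z20 ^+ 4 * Z12 ^+ 5 * Z2 ^+ 5 * Z30 ^+ 2
     + 2^4*3^24*5^13*7^2*11*17*107 ** Z20 ^+ 5 * Z12 ^+ 6 * Z2 ^+ 4 * Z30
     + 2^19*3^19*5^13*7 ** Z12 ^+ 15 * Z30
     + 2^4*3^21*5^15*7^2*2053 ** Z20 ^+ 6 * Z12 ^+ 7 * Z2 ^+ 3
     + 2^6*3^26*5^9*7^2*23*31 ** Z20 ^+ 2 * Z2 ^+ 10 * Z30 ^+ 5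
     - 2^5*3^25*5^12*7^2*19*307 ** Z20 ^+ 3 * Z12 * Z2 ^+ 9 * Z30 ^+ 4
     - 2^6*3^25*5^10*7^2*59*4219 ** Z20 ^+ 4 * Z12 ^+ 2 * Z2 ^+ 8 * Z30 ^+ 3
     - 2^5*3^24*5^12*7^4*373 ** Z20 ^+ 5 * Z12 ^+ 3 * Z2 ^+ 7 * Z30 ^+ 2
     + 2^10*3^20*5^11*7^2*7517 ** Z12 ^+ 12 * Z2 ^+ 3 * Z30 ^+ 2
     + 2^10*3^22*5^13*7^2*197 ** Z20 ^+ 6 * Z12 ^+ 4 * Z2 ^+ 6 * Z30
     + 2^12*3^20*5^12*7^2*677 ** Z20 * Z12 ^+ 13 * Z2 ^+ 2 * Z30
     + 2^4*3^24*5^13*7^2*19087 ** Z20 ^+ 7 * Z12 ^+ 5 * Z2 ^+ 5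
     + 2^14*3^19*5^14*7*107 ** Z20 ^+ 2 * Z12 ^+ 14 * Z2
     + 2^3*3^24*5^9*7^2*805289 ** Z20 ^+ 5 * Z2 ^+ 10 * Z30 ^+ 3
     - 2^8*3^22*5^9*7^2*1559 ** Z12 ^+ 9 * Z2 ^+ 6 * Z30 ^+ 3
     + 2^4*3^23*5^13*7^2*46549 ** Z20 ^+ 6 * Z12 * Z2 ^+ 9 * Z30 ^+ 2
     - 2^9*3^22*5^10*7^2*31*1049 ** Z20 * Z12 ^+ 10 * Z2 ^+ 5 * Z30 ^+ 2
     + 2^4*3^24*5^13*7*290527 ** Z20 ^+ 7 * Z12 ^+ 2 * Z2 ^+ 8 * Z30
     - 2^4*3^20*5^11*7^2*17*29^2*31 ** Z20 ^+ 2 * Z12 ^+ 11 * Z2 ^+ 4 * Z30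
     + 2^4*3^23*5^15*7*12569 ** Z20 ^+ 8 * Z12 ^+ 3 * Z2 ^+ 7
     - 2^13*3^18*5^13*7^2*683 ** Z20 ^+ 3 * Z12 ^+ 12 * Z2 ^+ 3
     + 2^8*3^22*5^9*7^5*977 ** Z12 ^+ 6 * Z2 ^+ 9 * Z30 ^+ 4
     + 2^8*3^23*5^8*7^2*139*8543 ** Z20 * Z12 ^+ 7 * Z2 ^+ 8 * Z30 ^+ 3
     + 2^5*3^22*5^9*7^2*509*32057 ** Z20 ^+ 2 * Z12 ^+ 8 * Z2 ^+ 7 * Z30 ^+ 2
     + 2^3*3^24*5^12*7*31*3581 ** Z20 ^+ 8 * Z2 ^+ 10 * Z30
     + 2^5*3^19*5^11*7^2*521*4133 ** Z20 ^+ 3 * Z12 ^+ 9 * Z2 ^+ 6 * Z30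
     - 2^4*3^22*5^16*7*1453 ** Z20 ^+ 9 * Z12 * Z2 ^+ 9
     + 2^5*3^19*5^11*7^2*31*193*983 ** Z20 ^+ 4 * Z12 ^+ 10 * Z2 ^+ 5
     - 2^11*3^23*5^11*7^3*17 ** Z12 ^+ 3 * Z2 ^+ 12 * Z30 ^+ 5
     - 2^9*3^23*5^8*7^4*11*13^3 ** Z20 * Z12 ^+ 4 * Z2 ^+ 11 * Z30 ^+ 4
     + 2^6*3^22*5^7*7^3*9993337 ** Z20 ^+ 2 * Z12 ^+ 5 * Z2 ^+ 10 * Z30 ^+ 3
     + 2^4*3^21*5^9*7^3*44112559 ** Z20 ^+ 3 * Z12 ^+ 6 * Z2 ^+ 9 * Z30 ^+ 2
     + 2^4*3^21*5^10*7^2*7079*11617 ** Z20 ^+ 4 * Z12 ^+ 7 * Z2 ^+ 8 * Z30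
     - 2^5*3^22*5^12*7^2*41851 ** Z20 ^+ 5 * Z12 ^+ 8 * Z2 ^+ 7
     - 2^15*3^18*5^12*7*73 ** Z12 ^+ 17 * Z2 ^+ 3
     + 2^10*3^26*5^10*7^2 ** Z2 ^+ 15 * Z30 ^+ 6
     + 2^9*3^29*5^9*7^2 ** Z20 * Z12 * Z2 ^+ 14 * Z30 ^+ 5
     - 2^10*3^23*5^8*7^3*31*3469 ** Z20 ^+ 2 * Z12 ^+ 2 * Z2 ^+ 13 * Z30 ^+ 4
     - 2^7*3^21*5^8*7^3*173*71471 ** Z20 ^+ 3 * Z12 ^+ 3 * Z2 ^+ 12 * Z30 ^+ 3
     + 2^12*3^22*5^8*7^3*23*9043 ** Z20 ^+ 4 * Z12 ^+ 4 * Z2 ^+ 11 * Z30 ^+ 2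
     + 2^5*3^22*5^10*7^4*271771 ** Z20 ^+ 5 * Z12 ^+ 5 * Z2 ^+ 10 * Z30
     + 2^5*3^19*5^10*7*8052413 ** Z12 ^+ 14 * Z2 ^+ 6 * Z30
     + 2^6*3^20*5^11*7^3*11*31*4391 ** Z20 ^+ 6 * Z12 ^+ 6 * Z2 ^+ 9
     + 2^8*3^18*5^11*7*19*193*211 ** Z20 * Z12 ^+ 15 * Z2 ^+ 5
     - 2^6*3^22*5^7*7^2*11*1070429 ** Z20 ^+ 3 * Z2 ^+ 15 * Z30 ^+ 4
     + 2^5*3^22*5^8*7^2*17*83*10627 ** Z20 ^+ 4 * Z12 * Z2 ^+ 14 * Z30 ^+ 3
     + 2^5*3^23*5^8*7^3*15042373 ** Z20 ^+ 5 * Z12 ^+ 2 * Z2 ^+ 13 * Z30 ^+ 2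
     + 2^8*3^21*5^8*7^2*11*149*457 ** Z12 ^+ 11 * Z2 ^+ 9 * Z30 ^+ 2
     + 2^11*3^21*5^10*7^4*11*2539 ** Z20 ^+ 6 * Z12 ^+ 3 * Z2 ^+ 12 * Z30
     + 2^6*3^24*5^9*7^2*67*2027 ** Z20 * Z12 ^+ 12 * Z2 ^+ 8 * Z30
     + 2^7*3^22*5^11*7^2*43*19681 ** Z20 ^+ 7 * Z12 ^+ 4 * Z2 ^+ 11
     + 2^6*3^18*5^10*7^2*6673981 ** Z20 ^+ 2 * Z12 ^+ 13 * Z2 ^+ 7
     - 2^8*3^21*5^7*7^2*13*17*113*389 ** Z12 ^+ 8 * Z2 ^+ 12 * Z30 ^+ 3
     + 2^4*3^22*5^7*7^2*383*208697 ** Z20 ^+ 6 * Z2 ^+ 15 * Z30 ^+ 2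
     - 2^12*3^20*5^7*7^2*53*197*421 ** Z20 * Z12 ^+ 9 * Z2 ^+ 11 * Z30 ^+ 2
     + 2^5*3^23*5^11*7*89*13921 ** Z20 ^+ 7 * Z12 * Z2 ^+ 14 * Z30
     - 2^8*3^19*5^9*7^2*11*1327889 ** Z20 ^+ 2 * Z12 ^+ 10 * Z2 ^+ 10 * Z30
     - 2^5*3^22*5^11*7^2*13*43*47 ** Z20 ^+ 8 * Z12 ^+ 2 * Z2 ^+ 13
     + 2^6*3^20*5^9*7^2*61*151*1609 ** Z20 ^+ 3 * Z12 ^+ 11 * Z2 ^+ 9
     - 2^16*3^24*5^8*7^2*43 ** Z12 ^+ 5 * Z2 ^+ 15 * Z30 ^+ 4
     + 2^8*3^25*5^7*7^2*1150987 ** Z20 * Z12 ^+ 6 * Z2 ^+ 14 * Z30 ^+ 3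
     + 2^5*3^20*5^6*7^2*523*56985457 ** Z20 ^+ 2 * Z12 ^+ 7 * Z2 ^+ 13
         * Z30 ^+ 2
     + 2^6*3^19*5^7*7^2*13*427218427 ** Z20 ^+ 3 * Z12 ^+ 8 * Z2 ^+ 12 * Z30
     - 2^5*3^22*5^10*7*257*5003 ** Z20 ^+ 9 * Z2 ^+ 15
     - 2^6*3^19*5^9*7^2*127*1214933 ** Z20 ^+ 4 * Z12 ^+ 9 * Z2 ^+ 11
     - 2^9*3^22*5^9*7^2*19*241 ** Z12 ^+ 2 * Z2 ^+ 18 * Z30 ^+ 5
     - 2^9*3^22*5^8*7^2*1432103 ** Z20 * Z12 ^+ 3 * Z2 ^+ 17 * Z30 ^+ 4
     + 2^7*3^21*5^6*7^2*37*47*272369 ** Z20 ^+ 2 * Z12 ^+ 4 * Z2 ^+ 16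
         * Z30 ^+ 3
     + 2^5*3^20*5^5*7^2*229*28477*38953 ** Z20 ^+ 3 * Z12 ^+ 5 * Z2 ^+ 15
         * Z30 ^+ 2
     + 2^5*3^19*5^7*7^2*281*109191547 ** Z20 ^+ 4 * Z12 ^+ 6 * Z2 ^+ 14 * Z30
     + 2^6*3^18*5^8*7^2*11*269192369 ** Z20 ^+ 5 * Z12 ^+ 7 * Z2 ^+ 13
     - 2^7*3^18*5^10*7^2*29989 ** Z12 ^+ 16 * Z2 ^+ 9
     - 2^8*3^22*5^8*7^2*3361 ** Z20 * Z2 ^+ 20 * Z30 ^+ 5
     - 2^7*3^21*5^7*7^2*24413693 ** Z20 ^+ 2 * Z12 * Z2 ^+ 19 * Z30 ^+ 4
     + 2^11*3^20*5^6*7^2*257*257903 ** Z20 ^+ 3 * Z12 ^+ 2 * Z2 ^+ 18 * Z30 ^+ 3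
     + 2^6*3^20*5^7*7^2*101*1129*50101 ** Z20 ^+ 4 * Z12 ^+ 3 * Z2 ^+ 17
         * Z30 ^+ 2
     + 2^6*3^19*5^6*7^2*389*631*747853 ** Z20 ^+ 5 * Z12 ^+ 4 * Z2 ^+ 16 * Z30
     + 2^7*3^17*5^8*7^3*11*2122963 ** Z12 ^+ 13 * Z2 ^+ 12 * Z30
     + 2^8*3^19*5^8*7^2*223*1931*2789 ** Z20 ^+ 6 * Z12 ^+ 5 * Z2 ^+ 15
     + 2^7*3^18*5^8*7^2*239*130099 ** Z20 * Z12 ^+ 14 * Z2 ^+ 11
     + 2^4*3^20*5^5*7^2*12569*345689 ** Z20 ^+ 4 * Z2 ^+ 20 * Z30 ^+ 3
     + 2^8*3^19*5^6*7^2*11177*205211 ** Z20 ^+ 5 * Z12 * Z2 ^+ 19 * Z30 ^+ 2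
     + 2^11*3^19*5^6*7^2*19*181213 ** Z12 ^+ 10 * Z2 ^+ 15 * Z30 ^+ 2
     + 2^6*3^18*5^6*7^2*191*567548017 ** Z20 ^+ 6 * Z12 ^+ 2 * Z2 ^+ 18 * Z30
     + 2^7*3^19*5^6*7^2*18859*65519 ** Z20 * Z12 ^+ 11 * Z2 ^+ 14 * Z30
     + 2^7*3^19*5^8*7*263*347*30803 ** Z20 ^+ 7 * Z12 ^+ 3 * Z2 ^+ 17
     + 2^8*3^16*5^9*7^3*32820167 ** Z20 ^+ 2 * Z12 ^+ 12 * Z2 ^+ 13
     + 2^11*3^18*5^6*7^2*130881071 ** Z12 ^+ 7 * Z2 ^+ 18 * Z30 ^+ 3
     + 2^8*3^19*5^5*7^2*1229*1304753 ** Z20 * Z12 ^+ 8 * Z2 ^+ 17 * Z30 ^+ 2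
     + 2^6*3^18*5^5*7*13159*5789947 ** Z20 ^+ 7 * Z2 ^+ 20 * Z30
     - 2^6*3^17*5^5*7^2*213751052731 ** Z20 ^+ 2 * Z12 ^+ 9 * Z2 ^+ 16 * Z30
     - 2^10*3^17*5^10*7*11*1529413 ** Z20 ^+ 8 * Z12 * Z2 ^+ 19
     - 2^9*3^16*5^6*7^2*173*127972109 ** Z20 ^+ 3 * Z12 ^+ 10 * Z2 ^+ 15
     - 2^9*3^19*5^7*7^2*37*97*4337 ** Z12 ^+ 4 * Z2 ^+ 21 * Z30 ^+ 4
     + 2^9*3^20*5^6*7^5*1018301 ** Z20 * Z12 ^+ 5 * Z2 ^+ 20 * Z30 ^+ 3
     + 2^6*3^17*5^7*7^4*157*6334547 ** Z20 ^+ 2 * Z12 ^+ 6 * Z2 ^+ 19 * Z30 ^+ 2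
     + 2^8*3^16*5^4*7^2*19*2417*2551*12037 ** Z20 ^+ 3 * Z12 ^+ 7 * Z2 ^+ 18
         * Z30
     - 2^7*3^17*5^5*7^2*89*191*17853503 ** Z20 ^+ 4 * Z12 ^+ 8 * Z2 ^+ 17
     - 2^10*3^21*5^8*7^2*2137 ** Z12 * Z2 ^+ 24 * Z30 ^+ 5
     - 2^10*3^21*5^7*7^2*17*227*347 ** Z20 * Z12 ^+ 2 * Z2 ^+ 23 * Z30 ^+ 4
     + 2^10*3^18*5^6*7^2*23*45166171 ** Z20 ^+ 2 * Z12 ^+ 3 * Z2 ^+ 22
         * Z30 ^+ 3
     + 2^6*3^20*5^4*7^2*29*37*324827941 ** Z20 ^+ 3 * Z12 ^+ 4 * Z2 ^+ 21
         * Z30 ^+ 2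
     + 2^7*3^18*5^3*7^3*11*131*29027*48571 ** Z20 ^+ 4 * Z12 ^+ 5 * Z2 ^+ 20
         * Z30
     + 2^7*3^15*5^5*7^3*31*23099*1885459 ** Z20 ^+ 5 * Z12 ^+ 6 * Z2 ^+ 19
     - 2^10*3^17*5^5*7^3*827*14221 ** Z12 ^+ 15 * Z2 ^+ 15
     - 2^8*3^19*5^6*7^2*13928549 ** Z20 ^+ 2 * Z2 ^+ 25 * Z30 ^+ 4
     + 2^8*3^18*5^5*7^2*11*103*421*8707 ** Z20 ^+ 3 * Z12 * Z2 ^+ 24 * Z30 ^+ 3
     + 2^12*3^19*5^4*7^3*13*47560897 ** Z20 ^+ 4 * Z12 ^+ 2 * Z2 ^+ 23
         * Z30 ^+ 2
     + 2^7*3^16*5^4*7^2*13*719*1783*669241 ** Z20 ^+ 5 * Z12 ^+ 3 * Z2 ^+ 22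
         * Z30
     + 2^7*3^14*5^5*7^2*548100080477 ** Z12 ^+ 12 * Z2 ^+ 18 * Z30
     + 2^8*3^15*5^4*7^3*1780283701487 ** Z20 ^+ 6 * Z12 ^+ 4 * Z2 ^+ 21
     + 2^10*3^16*5^7*7^2*13*101*265459 ** Z20 * Z12 ^+ 13 * Z2 ^+ 17
     + 2^7*3^17*5^2*7^2*709*7477*86131 ** Z20 ^+ 5 * Z2 ^+ 25 * Z30 ^+ 2
     - 2^16*3^16*5^6*7^2*13832521 ** Z12 ^+ 9 * Z2 ^+ 21 * Z30 ^+ 2
     + 2^6*3^16*5^4*7^2*13*23*4262123611 ** Z20 ^+ 6 * Z12 * Z2 ^+ 24 * Z30
     + 2^9*3^15*5^4*7^2*1033*1979*13001 ** Z20 * Z12 ^+ 10 * Z2 ^+ 20 * Z30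
     - 2^10*3^18*5^4*7^2*32051*182159 ** Z20 ^+ 7 * Z12 ^+ 2 * Z2 ^+ 23
     + 2^8*3^14*5^4*7^3*11*19641133387 ** Z20 ^+ 2 * Z12 ^+ 11 * Z2 ^+ 19
     + 2^10*3^17*5^5*7^2*17*189716399 ** Z12 ^+ 6 * Z2 ^+ 24 * Z30 ^+ 3
     + 2^7*3^16*5^4*7^2*101*5777699071 ** Z20 * Z12 ^+ 7 * Z2 ^+ 23 * Z30 ^+ 2
     - 2^8*3^16*5^3*7^2*4824842354177 ** Z20 ^+ 2 * Z12 ^+ 8 * Z2 ^+ 22 * Z30
     - 2^9*3^16*5^2*7^2*13*21990109487 ** Z20 ^+ 8 * Z2 ^+ 25
     - 2^8*3^13*5^3*7^2*23*5623*1411172599 ** Z20 ^+ 3 * Z12 ^+ 9 * Z2 ^+ 21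
     - 2^10*3^17*5^7*7^2*31*439667 ** Z12 ^+ 3 * Z2 ^+ 27 * Z30 ^+ 4
     + 2^9*3^17*5^5*7^3*13*19^2*173*2281 ** Z20 * Z12 ^+ 4 * Z2 ^+ 26 * Z30 ^+ 3
     + 2^7*3^20*5^5*7^2*9184353733 ** Z20 ^+ 2 * Z12 ^+ 5 * Z2 ^+ 25 * Z30 ^+ 2
     + 2^12*3^15*5^3*7^2*2093780213323 ** Z20 ^+ 3 * Z12 ^+ 6 * Z2 ^+ 24 * Z30
     + 2^9*3^14*5^2*7^2*29*101*33115141459 ** Z20 ^+ 4 * Z12 ^+ 7 * Z2 ^+ 23
     - 2^10*3^19*5^7*7^2*2137 ** Z2 ^+ 30 * Z30 ^+ 5
     - 2^9*3^19*5^6*7^2*19*321821 ** Z20 * Z12 * Z2 ^+ 29 * Z30 ^+ 4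
     + 2^11*3^17*5^6*7^2*17*13839599 ** Z20 ^+ 2 * Z12 ^+ 2 * Z2 ^+ 28
         * Z30 ^+ 3
     + 2^7*3^16*5^6*7^2*47*79^2*302009 ** Z20 ^+ 3 * Z12 ^+ 3 * Z2 ^+ 27
         * Z30 ^+ 2
     + 2^7*3^15*5^2*7^3*29*101*367*3593*15277 ** Z20 ^+ 4 * Z12 ^+ 4 * Z2 ^+ 26
         * Z30
     + 2^9*3^15*7^2*11*5903837*31733797 ** Z20 ^+ 5 * Z12 ^+ 5 * Z2 ^+ 25
     + 2^9*3^13*5^5*7^3*569*977*1553 ** Z12 ^+ 14 * Z2 ^+ 21
     + 2^8*3^16*5^4*7^2*11*554789143 ** Z20 ^+ 3 * Z2 ^+ 30 * Z30 ^+ 3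
     + 2^7*3^16*5^3*7^2*3307*5749*40763 ** Z20 ^+ 4 * Z12 * Z2 ^+ 29 * Z30 ^+ 2
     + 2^10*3^18*5^2*7^2*13*283*613*122117 ** Z20 ^+ 5 * Z12 ^+ 2 * Z2 ^+ 28
         * Z30
     + 2^8*3^13*5^3*7^2*97*120517321303 ** Z12 ^+ 11 * Z2 ^+ 24 * Z30
     + 2^8*3^15*5*7^2*2351*59753*315527 ** Z20 ^+ 6 * Z12 ^+ 3 * Z2 ^+ 27
     + 2^9*3^13*5^3*7^3*1019375392639 ** Z20 * Z12 ^+ 12 * Z2 ^+ 23
     - 2^9*3^15*5^4*7^2*229*382783829 ** Z12 ^+ 8 * Z2 ^+ 27 * Z30 ^+ 2
     + 2^8*3^15*5^2*7^4*53*257*695689 ** Z20 ^+ 6 * Z2 ^+ 30 * Z30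
     - 2^14*3^13*5^6*7^2*79*761*46691 ** Z20 * Z12 ^+ 9 * Z2 ^+ 26 * Z30
     - 2^8*3^15*5*7^3*353*5954683957 ** Z20 ^+ 7 * Z12 * Z2 ^+ 29
     - 2^10*3^12*5^2*7^2*29*59*149*157*1856221 ** Z20 ^+ 2 * Z12 ^+ 10
         * Z2 ^+ 25
     + 2^10*3^18*5^3*7^3*359*3061027 ** Z12 ^+ 5 * Z2 ^+ 30 * Z30 ^+ 3
     + 2^8*3^15*5^3*7^3*340604380033 ** Z20 * Z12 ^+ 6 * Z2 ^+ 29 * Z30 ^+ 2
     - 2^13*3^14*5^2*7^2*139*39383*152777 ** Z20 ^+ 2 * Z12 ^+ 7 * Z2 ^+ 28
         * Z30
     - 2^12*3^13*5*7^2*63378965258321 ** Z20 ^+ 3 * Z12 ^+ 8 * Z2 ^+ 27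
     - 2^12*3^16*5^6*7^4*19*4483 ** Z12 ^+ 2 * Z2 ^+ 33 * Z30 ^+ 4
     + 2^11*3^16*5^5*7^4*41*563*1201 ** Z20 * Z12 ^+ 3 * Z2 ^+ 32 * Z30 ^+ 3
     + 2^8*3^15*5^3*7^3*31*22664066651 ** Z20 ^+ 2 * Z12 ^+ 4 * Z2 ^+ 31
         * Z30 ^+ 2
     + 2^10*3^14*5^2*7^3*541*569*16524979 ** Z20 ^+ 3 * Z12 ^+ 5 * Z2 ^+ 30
         * Z30
     + 2^9*3^13*5*7^3*41*3048495311723 ** Z20 ^+ 4 * Z12 ^+ 6 * Z2 ^+ 29
     - 2^10*3^16*5^5*7^3*19*56501 ** Z20 * Z2 ^+ 35 * Z30 ^+ 4
     + 2^11*3^15*5^4*7^3*11*13*3002269 ** Z20 ^+ 2 * Z12 * Z2 ^+ 34 * Z30 ^+ 3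
     + 2^8*3^18*5^3*7^4*812189933 ** Z20 ^+ 3 * Z12 ^+ 2 * Z2 ^+ 33 * Z30 ^+ 2
     + 2^8*3^14*5^2*7^3*19*235679*1825937 ** Z20 ^+ 4 * Z12 ^+ 3 * Z2 ^+ 32
         * Z30
     + 2^9*3^14*5^2*7^3*149*18380304779 ** Z20 ^+ 5 * Z12 ^+ 4 * Z2 ^+ 31
     + 2^10*3^12*5^2*7^2*13*911*164646281 ** Z12 ^+ 13 * Z2 ^+ 27
     + 2^8*3^16*5^3*7^3*15919*40127 ** Z20 ^+ 4 * Z2 ^+ 35 * Z30 ^+ 2
     + 2^15*3^16*5^2*7^3*365440423 ** Z20 ^+ 5 * Z12 * Z2 ^+ 34 * Z30
     + 2^9*3^11*5*7^2*11*1399*23867817047 ** Z12 ^+ 10 * Z2 ^+ 30 * Z30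
     - 2^10*3^14*5*7^3*12653*77512949 ** Z20 ^+ 6 * Z12 ^+ 2 * Z2 ^+ 33
     + 2^10*3^12*5*7^2*6073*7561*1419713 ** Z20 * Z12 ^+ 11 * Z2 ^+ 29
     - 2^9*3^12*5^3*7^2*41*673*101739863 ** Z12 ^+ 7 * Z2 ^+ 33 * Z30 ^+ 2
     - 2^12*3^12*5^2*7^2*177823*45043877 ** Z20 * Z12 ^+ 8 * Z2 ^+ 32 * Z30
     - 2^12*3^17*5*7^3*29^2*37*101*139 ** Z20 ^+ 7 * Z2 ^+ 35
     - 2^11*3^10*5^3*7^2*43*139*5977447793 ** Z20 ^+ 2 * Z12 ^+ 9 * Z2 ^+ 31
     + 2^11*3^12*5^4*7^3*13^2*70718519 ** Z12 ^+ 4 * Z2 ^+ 36 * Z30 ^+ 3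
     + 2^9*3^16*5^3*7^3*9043*1393387 ** Z20 * Z12 ^+ 5 * Z2 ^+ 35 * Z30 ^+ 2
     + 2^10*3^12*5^2*7^3*67763*24003367 ** Z20 ^+ 2 * Z12 ^+ 6 * Z2 ^+ 34 * Z30
     + 2^12*3^10*5^3*7^3*223*2486599937 ** Z20 ^+ 3 * Z12 ^+ 7 * Z2 ^+ 33
     - 2^11*3^15*5^5*7^3*684121 ** Z12 * Z2 ^+ 39 * Z30 ^+ 4
     + 2^12*3^13*5^4*7^3*73*353*36683 ** Z20 * Z12 ^+ 2 * Z2 ^+ 38 * Z30 ^+ 3
     + 2^9*3^11*5^3*7^4*349021690219 ** Z20 ^+ 2 * Z12 ^+ 3 * Z2 ^+ 37
         * Z30 ^+ 2
     + 2^11*3^10*5^2*7^3*11*587*3853542631 ** Z20 ^+ 3 * Z12 ^+ 4 * Z2 ^+ 36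
         * Z30
     + 2^10*3^11*5^2*7^4*11*198879218137 ** Z20 ^+ 4 * Z12 ^+ 5 * Z2 ^+ 35
     + 2^8*3^12*5^4*7^4*41*419*15139 ** Z20 ^+ 2 * Z2 ^+ 40 * Z30 ^+ 3
     + 2^9*3^11*5^3*7^3*170173386991 ** Z20 ^+ 3 * Z12 * Z2 ^+ 39 * Z30 ^+ 2
     + 2^9*3^11*5^2*7^3*47*8731*12540581 ** Z20 ^+ 4 * Z12 ^+ 2 * Z2 ^+ 38 * Z30
     - 2^10*3^9*5^2*7^3*631*16453*714151 ** Z20 ^+ 5 * Z12 ^+ 3 * Z2 ^+ 37
     + 2^11*3^12*5^2*7^3*19*3630744617 ** Z12 ^+ 12 * Z2 ^+ 33
     + 2^11*3^10*5*7^4*11*3717589009 ** Z20 ^+ 5 * Z2 ^+ 40 * Z30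
     + 2^10*3^8*5^4*7^3*17*643*719*109903 ** Z12 ^+ 9 * Z2 ^+ 36 * Z30
     - 2^11*3^9*5*7^3*4133*7243*304907 ** Z20 ^+ 6 * Z12 * Z2 ^+ 39
     + 2^11*3^10*5^2*7^3*11*12131767093 ** Z20 * Z12 ^+ 10 * Z2 ^+ 35
     - 2^10*3^9*5^3*7^3*83*29297*268283 ** Z12 ^+ 6 * Z2 ^+ 39 * Z30 ^+ 2
     - 2^14*3^11*5^2*7^3*139491370861 ** Z20 * Z12 ^+ 7 * Z2 ^+ 38 * Z30
     - 2^12*3^9*5^2*7^3*17^2*19861272577 ** Z20 ^+ 2 * Z12 ^+ 8 * Z2 ^+ 37
     + 2^18*3^10*5^4*7^3*1619*44357 ** Z12 ^+ 3 * Z2 ^+ 42 * Z30 ^+ 3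
     + 2^12*3^11*5^3*7^3*151*282910193 ** Z20 * Z12 ^+ 4 * Z2 ^+ 41 * Z30 ^+ 2
     + 2^10*3^10*5^2*7^3*173*9311*2585293 ** Z20 ^+ 2 * Z12 ^+ 5 * Z2 ^+ 40
         * Z30
     + 2^12*3^7*5^2*7^3*45834651100351 ** Z20 ^+ 3 * Z12 ^+ 6 * Z2 ^+ 39
     - 2^12*3^12*5^4*7^3*684121 ** Z2 ^+ 45 * Z30 ^+ 4
     + 2^11*3^12*5^4*7^3*71*83*179*193 ** Z20 * Z12 * Z2 ^+ 44 * Z30 ^+ 3
     + 2^10*3^11*5^3*7^4*31*37*1019*6521 ** Z20 ^+ 2 * Z12 ^+ 2 * Z2 ^+ 43
         * Z30 ^+ 2
     + 2^11*3^8*5^2*7^3*139*101441196979 ** Z20 ^+ 3 * Z12 ^+ 3 * Z2 ^+ 42 * Z30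
     + 2^11*3^9*5^2*7^3*351151*6647521 ** Z20 ^+ 4 * Z12 ^+ 4 * Z2 ^+ 41
     + 2^14*3^9*5^3*7^3*1327*309251 ** Z20 ^+ 3 * Z2 ^+ 45 * Z30 ^+ 2
     + 2^12*3^10*5^2*7^3*17*41*4937*13249 ** Z20 ^+ 4 * Z12 * Z2 ^+ 44 * Z30
     - 2^11*3^10*5^2*7^4*50776597931 ** Z20 ^+ 5 * Z12 ^+ 2 * Z2 ^+ 43
     + 2^12*3^7*5^4*7^4*29*43*281*31153 ** Z12 ^+ 11 * Z2 ^+ 39
     + 2^13*3^7*5^3*7^3*109*181*7354283 ** Z12 ^+ 8 * Z2 ^+ 42 * Z30
     - 2^12*3^8*5^2*7^3*607*90804557 ** Z20 ^+ 6 * Z2 ^+ 45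
     - 2^12*3^7*5^3*7^3*227*10651*279967 ** Z20 * Z12 ^+ 9 * Z2 ^+ 41
     - 2^15*3^8*5^2*7^3*53^2*7401907 ** Z12 ^+ 5 * Z2 ^+ 45 * Z30 ^+ 2
     - 2^12*3^7*5^2*7^3*17*235269698801 ** Z20 * Z12 ^+ 6 * Z2 ^+ 44 * Z30
     - 2^12*3^6*5^2*7^3*33851*133712119 ** Z20 ^+ 2 * Z12 ^+ 7 * Z2 ^+ 43
     + 2^15*3^9*5^4*7^3*163*179*2917 ** Z12 ^+ 2 * Z2 ^+ 48 * Z30 ^+ 3
     + 2^11*3^8*5^3*7^3*12577*11233711 ** Z20 * Z12 ^+ 3 * Z2 ^+ 47 * Z30 ^+ 2
     + 2^12*3^7*5^3*7^3*13*29^2*59*850691 ** Z20 ^+ 2 * Z12 ^+ 4 * Z2 ^+ 46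
         * Z30
     + 2^12*3^7*5^3*7^3*11*82987837567 ** Z20 ^+ 3 * Z12 ^+ 5 * Z2 ^+ 45
     + 2^11*3^9*5^4*7^3*41*1902613 ** Z20 * Z2 ^+ 50 * Z30 ^+ 3
     + 2^11*3^8*5^3*7^3*311*3449*13781 ** Z20 ^+ 2 * Z12 * Z2 ^+ 49 * Z30 ^+ 2
     + 2^12*3^7*5^4*7^4*35851*115807 ** Z20 ^+ 3 * Z12 ^+ 2 * Z2 ^+ 48 * Z30
     - 2^13*3^8*5^3*7^3*31084535837 ** Z20 ^+ 4 * Z12 ^+ 3 * Z2 ^+ 47
     + 2^12*3^7*5^3*7^3*367*6651413 ** Z20 ^+ 4 * Z2 ^+ 50 * Z30
     - 2^13*3^6*5^4*7^3*11*1196570233 ** Z20 ^+ 5 * Z12 * Z2 ^+ 49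
     + 2^16*3^6*5^4*7^4*254505289 ** Z12 ^+ 10 * Z2 ^+ 45
     + 2^12*3^5*5^3*7^3*8971*15690341 ** Z12 ^+ 7 * Z2 ^+ 48 * Z30
     - 2^14*3^6*5^3*7^5*2411*769799 ** Z20 * Z12 ^+ 8 * Z2 ^+ 47
     - 2^12*3^6*5^4*7^3*53*1019*43013 ** Z12 ^+ 4 * Z2 ^+ 51 * Z30 ^+ 2
     - 2^13*3^6*5^3*7^3*153073*402817 ** Z20 * Z12 ^+ 5 * Z2 ^+ 50 * Z30
     + 2^16*3^4*5^3*7^3*2017*60384263 ** Z20 ^+ 2 * Z12 ^+ 6 * Z2 ^+ 49
     + 2^13*3^8*5^4*7^3*27165209 ** Z12 * Z2 ^+ 54 * Z30 ^+ 3
     + 2^12*3^7*5^3*7^3*18637*381001 ** Z20 * Z12 ^+ 2 * Z2 ^+ 53 * Z30 ^+ 2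
     + 2^12*3^5*5^3*7^3*113*2195698811 ** Z20 ^+ 2 * Z12 ^+ 3 * Z2 ^+ 52 * Z30
     + 2^14*3^4*5^3*7^3*199*1061*743221 ** Z20 ^+ 3 * Z12 ^+ 4 * Z2 ^+ 51
     + 2^13*3^6*5^3*7^3*227639521 ** Z20 ^+ 2 * Z2 ^+ 55 * Z30 ^+ 2
     + 2^14*3^5*5^3*7^3*11*17*31217027 ** Z20 ^+ 3 * Z12 * Z2 ^+ 54 * Z30
     - 2^15*3^7*5^3*7^3*11689*201767 ** Z20 ^+ 4 * Z12 ^+ 2 * Z2 ^+ 53
     - 2^19*3^5*5^4*7^4*659*1979 ** Z20 ^+ 5 * Z2 ^+ 55
     + 2^14*3^5*5^4*7^3*11*4933*28661 ** Z12 ^+ 9 * Z2 ^+ 51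
     + 2^16*3*5^6*7^3*179854793 ** Z12 ^+ 6 * Z2 ^+ 54 * Z30
     - 2^14*3^4*5^4*7^3*13463475413 ** Z20 * Z12 ^+ 7 * Z2 ^+ 53
     - 2^13*3^2*5^6*7^3*11*31*226669 ** Z12 ^+ 3 * Z2 ^+ 57 * Z30 ^+ 2
     - 2^16*3^2*5^4*7^3*41*2311*38767 ** Z20 * Z12 ^+ 4 * Z2 ^+ 56 * Z30
     + 2^14*3*5^4*7^3*37*41*397*533879 ** Z20 ^+ 2 * Z12 ^+ 5 * Z2 ^+ 55
     + 2^12*3^6*5^3*7^3*27165209 ** Z2 ^+ 60 * Z30 ^+ 3
     + 2^13*3^7*5^3*7^3*167*350503 ** Z20 * Z12 * Z2 ^+ 59 * Z30 ^+ 2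
     + 2^15*3^2*5^3*7^3*1619*2861*4909 ** Z20 ^+ 2 * Z12 ^+ 2 * Z2 ^+ 58 * Z30
     - 2^14*5^3*7^3*29*283*110896741 ** Z20 ^+ 3 * Z12 ^+ 3 * Z2 ^+ 57
     + 2^15*3*5^4*7^4*1289*39023 ** Z20 ^+ 3 * Z2 ^+ 60 * Z30
     - 2^15*3*5^4*7^4*11*13*11210723 ** Z20 ^+ 4 * Z12 * Z2 ^+ 59
     + 2^16*5^6*7^4*23055827 ** Z12 ^+ 8 * Z2 ^+ 57
     + 2^18*3*5^6*7^4*13*8233 ** Z12 ^+ 5 * Z2 ^+ 60 * Z30
     - 2^16*5^5*7^6*59*120233 ** Z20 * Z12 ^+ 6 * Z2 ^+ 59
     - 2^14*3^2*5^4*7^4*1151659 ** Z12 ^+ 2 * Z2 ^+ 63 * Z30 ^+ 2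
     - 2^17*3*5^4*7^4*17^2*47*883 ** Z20 * Z12 ^+ 3 * Z2 ^+ 62 * Z30
     + 2^16*3*5^4*7^4*29*19709777 ** Z20 ^+ 2 * Z12 ^+ 4 * Z2 ^+ 61
     + 2^14*3^2*5^4*7^4*1151659 ** Z20 * Z2 ^+ 65 * Z30 ^+ 2
     + 2^17*3^2*5^4*7^4*11*31*43*151 ** Z20 ^+ 2 * Z12 * Z2 ^+ 64 * Z30
     - 2^16*3^3*5^4*7^4*19456027 ** Z20 ^+ 3 * Z12 ^+ 2 * Z2 ^+ 63
     - 2^17*3^2*5^5*7^5*11*4021 ** Z20 ^+ 4 * Z2 ^+ 65
     + 2^17*3^2*5^7*7^5*853 ** Z12 ^+ 7 * Z2 ^+ 63
     + 2^16*3^3*5^5*7^5*13*17 ** Z12 ^+ 4 * Z2 ^+ 66 * Z30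
     - 2^17*3^2*5^5*7^5*64793 ** Z20 * Z12 ^+ 5 * Z2 ^+ 65
     - 2^17*3^3*5^5*7^5*13*17 ** Z20 * Z12 ^+ 2 * Z2 ^+ 68 * Z30
     + 2^17*3^2*5^5*7^7*13*103 ** Z20 ^+ 2 * Z12 ^+ 3 * Z2 ^+ 67
     + 2^16*3^3*5^5*7^5*13*17 ** Z20 ^+ 2 * Z2 ^+ 70 * Z30
     - 2^17*3^3*5^5*7^5*11^2*61 ** Z20 ^+ 3 * Z12 * Z2 ^+ 69
     + 2^18*3^3*5^6*7^6 ** Z12 ^+ 6 * Z2 ^+ 69
     - 2^18*3^4*5^6*7^6 ** Z20 * Z12 ^+ 4 * Z2 ^+ 71
     + 2^18*3^4*5^6*7^6 ** Z20 ^+ 2 * Z12 ^+ 2 * Z2 ^+ 73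
     - 2^18*3^3*5^6*7^6 ** Z20 ^+ 3 * Z2 ^+ 75).

(* Main.v *)
(* Let s be sqrt 5 -> - sqrt 5. The map P satisfies P (g u) = g^s (P u) for the
   generators g of the reflection group H4 (cyclic and double transpositions of
   the coordinates and one reflection with irrational entries), and the Z_j are
   invariant, so the difference D of the two sides of each identity is invariant.
   With w = u_4 ^ 2, modulo w ^ 2 the values k_2(P), k_6(P), k_10(P) and P_4 ^ 2
   are polynomials in h_2, h_6, h_10, w, which turns D = 0 mod w ^ 2 into a finite
   computation. Hence u_4 ^ 4 divides D, and by invariance so does the fourth
   power of each of the 60 linear forms defining the mirrors. These are pairwise
   non-proportional, so D is zero or of degree at least 240, while its degree is
   at most 7 * 30 = 210. The computations are done with polynomials over
   (Z[sqrt 5])[w] / (w ^ 2) in the sparse Horner form of Ring_polynom. *)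
From Stdlib Require Import BinInt BinList Ring_polynom.
Require Import Defs.
From mathcomp Require Import all_boot all_order all_algebra ssrZ mpoly ring zify.

Set Implicit Arguments.
Unset Strict Implicit.
Unset Printing Implicit Defensive.

Import GRing.Theory Num.Theory.

Local Open Scope ring_scope.

(** * Congruences *)

(** The order of vanishing is dictated by the degrees. [Y_2], [Y_12], [Y_20], [Y_30] have degrees
    14, 84, 140, 210, and the sides are even in $u_4$; a computation modulo $w$ would give order 2
    on each of the 60 mirrors, a product of degree 120 only, whereas modulo $w^2$ the product has
    degree 240. Polynomials in $h_2,h_6,h_{10},w$ suffice on the mirror because the subgroup of type
    H3 acting on $u_1,u_2,u_3$ fixes $u_4$: the values $k_j(P_1,P_2,P_3)$ are invariant under it,
    and the invariants of H3 are the polynomials in $h_2,h_6,h_{10}$. In these coordinates sqrt 5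
    disappears from the final identities. The double transpositions move $u_4$, so invariance under
    them cannot be read off from the $h_j$ and is checked by expanding each $Z_j$. All denominators
    (168 in [f], 4 in the reflection, 15 and 2 in the $Z_j$, 5 and 25 in the expressions for
    $k_6,k_{10}$) are cleared beforehand, so that every check is an identity with coefficients in
    Z[sqrt 5]. *)

Definition congr (A : comPzRingType) (m x y : A) : Prop :=
  exists z, x = y + m * z.

Section Congruence.
Context (A : comPzRingType) (m : A).
Implicit Types x y z : A.

Lemma congr_refl x : congr m x x.
Proof. by exists 0; rewrite mulr0 addr0. Qed.

Lemma congr_eq x y : x = y -> congr m x y.
Proof. by move->; apply: congr_refl. Qed.

Lemma congr_sym x y : congr m x y -> congr m y x.
Proof. by case=> z ->; exists (- z); ring. Qed.

Lemma congr_trans y x z : congr m x y -> congr m y z -> congr m x z.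
Proof. by case=> a -> [b ->]; exists (a + b); ring. Qed.

Lemma congrD x x' y y' :
  congr m x x' -> congr m y y' -> congr m (x + y) (x' + y').
Proof. by case=> a -> [b ->]; exists (a + b); ring. Qed.

Lemma congrN x x' : congr m x x' -> congr m (- x) (- x').
Proof. by case=> a ->; exists (- a); ring. Qed.

Lemma congrM x x' y y' :
  congr m x x' -> congr m y y' -> congr m (x * y) (x' * y').
Proof.
by case=> a -> [b ->]; exists (a * y' + x' * b + m * (a * b)); ring.
Qed.

Lemma congrX x x' n : congr m x x' -> congr m (x ^+ n) (x' ^+ n).
Proof.
move=> xx'; elim: n => [|n IHn]; first exact: congr_refl.
by rewrite !exprS; apply: congrM.
Qed.

Lemma congr_equiv : RelationClasses.Equivalence (congr m).
Proof.
split; [exact: congr_refl | exact: congr_sym | move=> x y z; exact: congr_trans].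
Qed.

(** Together with [congr_equiv] and [congr_ring], this makes congruence modulo [m] an admissible
    equality for the correctness theorems of [Ring_polynom], which accept any setoid; no quotient
    ring has to be built. *)
Lemma congr_ext : ring_eq_ext +%R *%R -%R (congr m).
Proof.
split=> [x x' xx' y y' yy'|x x' xx' y y' yy'|x x' xx'];
  [exact: congrD | exact: congrM | exact: congrN].
Qed.

Lemma congr_ring :
  almost_ring_theory 0 1 +%R *%R (fun x y => x - y) -%R (congr m).
Proof.
split=> *; apply: congr_eq.
- exact: add0r.
- exact: addrC.
- exact: addrA.
- exact: mul1r.
- exact: mul0r.
- exact: mulrC.
- exact: mulrA.
- exact: mulrDl.
- by rewrite mulNr.
- exact: opprD.
- by [].
Qed.

End Congruence.

(** Exact identities are obtained from the same evaluation lemmas by setting [w] to 0: the modulus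
    [0 ^+ 2] is then 0. *)
Lemma congr0 (A : comPzRingType) (x y : A) : congr 0 x y -> x = y.
Proof. by case=> z ->; rewrite mul0r addr0. Qed.

(** * Polynomials over (Z[sqrt 5])[w] / (w ^ 2) *)

(* The pair (a, b) of integers stands for a + b sqrt 5. *)
Definition zr5 := (Z * Z)%type.

Definition zr5_add (x y : zr5) : zr5 := (Z.add x.1 y.1, Z.add x.2 y.2).
Definition zr5_sub (x y : zr5) : zr5 := (Z.sub x.1 y.1, Z.sub x.2 y.2).
Definition zr5_opp (x : zr5) : zr5 := (Z.opp x.1, Z.opp x.2).
Definition zr5_mul (x y : zr5) : zr5 :=
  (Z.add (Z.mul x.1 y.1) (Z.mul 5 (Z.mul x.2 y.2)),
   Z.add (Z.mul x.1 y.2) (Z.mul x.2 y.1)).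
Definition zr5_eqb (x y : zr5) : bool := Z.eqb x.1 y.1 && Z.eqb x.2 y.2.

(* The pair (x, y) stands for x + y w modulo w ^ 2. *)
Definition coef := (zr5 * zr5)%type.

Definition zcoef (c : Z) : coef := ((c, Z0), (Z0, Z0)).
Definition coef_add (x y : coef) : coef := (zr5_add x.1 y.1, zr5_add x.2 y.2).
Definition coef_sub (x y : coef) : coef := (zr5_sub x.1 y.1, zr5_sub x.2 y.2).
Definition coef_opp (x : coef) : coef := (zr5_opp x.1, zr5_opp x.2).
Definition coef_mul (x y : coef) : coef :=
  (zr5_mul x.1 y.1, zr5_add (zr5_mul x.1 y.2) (zr5_mul x.2 y.1)).
Definition coef_eqb (x y : coef) : bool := zr5_eqb x.1 y.1 && zr5_eqb x.2 y.2.

Notation pol := (Pol coef).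
Notation Cp := (@Pc coef).
Notation padd := (Padd (zcoef 0) coef_add coef_eqb).
Notation popp := (Popp coef_opp).
Notation pmul := (Pmul (zcoef 0) (zcoef 1) coef_add coef_mul coef_eqb).
Notation pmulc := (PmulC (zcoef 0) (zcoef 1) coef_mul coef_eqb).
Notation peqb := (Peq coef_eqb).
Notation Xp := (mk_X (zcoef 0) (zcoef 1)).

Definition pexp (p : pol) (n : nat) : pol :=
  if n is 0 then Cp (zcoef 1) else pow_pos pmul p (Pos.of_nat n).

Fixpoint psubst (s : seq pol) (p : pol) : pol :=
  match p with
  | Pc c => Pc c
  | Pinj j q => psubst (jump j s) q
  | PX p i q =>
      padd (pmul (psubst s p) (pow_pos pmul (List.hd (Cp (zcoef 0)) s) i))
           (psubst (List.tl s) q)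
  end.

Section Evaluation.
Context (A : comPzRingType) (s5 w : A).
Context (s5E : s5 ^+ 2 = 5%:R).

Local Notation "x == y" := (congr (w ^+ 2) x y).

Definition zr5_val (x : zr5) : A :=
  (int_of_Z x.1)%:~R + (int_of_Z x.2)%:~R * s5.

Definition coef_val (x : coef) : A := zr5_val x.1 + zr5_val x.2 * w.

Lemma intZD a b : (int_of_Z (Z.add a b))%:~R = (int_of_Z a)%:~R + (int_of_Z b)%:~R :> A.
Proof. by rewrite -intrD -raddfD. Qed.

Lemma intZN a : (int_of_Z (Z.opp a))%:~R = - (int_of_Z a)%:~R :> A.
Proof. by rewrite -mulrNz -raddfN. Qed.

Lemma intZM a b : (int_of_Z (Z.mul a b))%:~R = (int_of_Z a)%:~R * (int_of_Z b)%:~R :> A.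
Proof. by rewrite -intrM -rmorphM. Qed.

Lemma zr5_valD x y : zr5_val (zr5_add x y) = zr5_val x + zr5_val y.
Proof. rewrite /zr5_val !intZD; ring. Qed.

Lemma zr5_valN x : zr5_val (zr5_opp x) = - zr5_val x.
Proof. rewrite /zr5_val !intZN; ring. Qed.

Lemma zr5_valM x y : zr5_val (zr5_mul x y) = zr5_val x * zr5_val y.
Proof.
have s5s5 : s5 * s5 = 5%:R by rewrite -s5E expr2.
rewrite /zr5_val !intZD !intZM (_ : (int_of_Z 5)%:~R = s5 * s5); last first.
  by rewrite s5s5.
by rewrite /=; ring.
Qed.

Lemma zr5_eqP x y : zr5_eqb x y -> x = y.
Proof.
by case: x y => [a b] [c d] /andP[/Z.eqb_eq /= -> /Z.eqb_eq /= ->].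
Qed.

Lemma zr5_subE x y : zr5_sub x y = zr5_add x (zr5_opp y).
Proof. by []. Qed.

Lemma coef_val_zcoef c : coef_val (zcoef c) = (int_of_Z c)%:~R.
Proof. by rewrite /coef_val /zr5_val /= mulr0z; ring. Qed.

Lemma coef_morph :
  ring_morph 0 1 +%R *%R (fun x y => x - y) -%R (congr (w ^+ 2))
    (zcoef 0) (zcoef 1) coef_add coef_mul coef_sub coef_opp coef_eqb coef_val.
Proof.
split=> [||x y|x y|x y|x|x y].
- by rewrite coef_val_zcoef; apply: congr_refl.
- by rewrite coef_val_zcoef; apply: congr_refl.
- by apply: congr_eq; rewrite /coef_val /= !zr5_valD; ring.
- by apply: congr_eq; rewrite /coef_val /= !zr5_subE !zr5_valD !zr5_valN; ring.
(* [coef_mul] drops the product of the two coefficients of [w]; multiplication is the only operation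
   respected merely modulo [w ^ 2]. *)
- exists (- (zr5_val x.2 * zr5_val y.2)).
  by rewrite /coef_val /= !zr5_valD !zr5_valM; ring.
- by apply: congr_eq; rewrite /coef_val /= !zr5_valN; ring.
- move=> /andP[/zr5_eqP E1 /zr5_eqP E2].
  by apply: congr_eq; rewrite /coef_val E1 E2.
Qed.

Definition peval (l : seq A) (p : pol) : A := Pphi 0 +%R *%R coef_val l p.

Local Notation Rsth := (congr_equiv (w ^+ 2)).
Local Notation Reqe := (congr_ext (w ^+ 2)).
Local Notation ARth := (congr_ring (w ^+ 2)).

Lemma pevalD l p q : peval l (padd p q) == peval l p + peval l q.
Proof. exact: (Padd_ok Rsth Reqe ARth coef_morph). Qed.

Lemma pevalN l p : peval l (popp p) == - peval l p.
Proof. exact: (Popp_ok Rsth Reqe ARth coef_morph). Qed.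

Lemma pevalM l p q : peval l (pmul p q) == peval l p * peval l q.
Proof. exact: (Pmul_ok Rsth Reqe ARth coef_morph). Qed.

Lemma pevalMc l p c : peval l (pmulc p c) == peval l p * coef_val c.
Proof. exact: (PmulC_ok Rsth Reqe ARth coef_morph). Qed.

Lemma peval_eq l p q : peqb p q -> peval l p == peval l q.
Proof. by move=> pq; exact: (Peq_ok Rsth Reqe coef_morph p q pq l). Qed.

Lemma peval_X l i : peval l (Xp i) == BinList.nth 0 i l.
Proof. exact: congr_sym (mkX_ok Rsth Reqe ARth coef_morph i l). Qed.

Lemma peval_C l c : peval l (Cp c) = coef_val c.
Proof. by []. Qed.

Lemma pow_posE (B : pzRingType) (x : B) i : pow_pos *%R x i = x ^+ Pos.to_nat i.
Proof.
elim: i => [i IH|i IH|] /=; rewrite ?Pos2Nat.inj_xI ?Pos2Nat.inj_xO ?IH //.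
  by rewrite -exprD -exprS; congr (_ ^+ _); rewrite /= plusE addn0.
by rewrite -exprD; congr (_ ^+ _); rewrite /= plusE addn0.
Qed.

Lemma peval_pow_pos l p i : peval l (pow_pos pmul p i) == peval l p ^+ Pos.to_nat i.
Proof.
rewrite -pow_posE; elim: i => [i IH|i IH|] /=; last exact: congr_refl.
  apply: congr_trans (pevalM _ _ _) _; apply: congrM; first exact: congr_refl.
  by apply: congr_trans (pevalM _ _ _) _; apply: congrM.
by apply: congr_trans (pevalM _ _ _) _; apply: congrM.
Qed.

Lemma pevalX l p n : peval l (pexp p n) == peval l p ^+ n.
Proof.
case: n => [|n]; first by apply: congr_eq; rewrite /peval /= coef_val_zcoef.
by apply: congr_trans (peval_pow_pos _ _ _) _; rewrite Nat2Pos.id //; apply: congr_refl.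
Qed.

Lemma jump_map (S T : Type) (g : S -> T) j s : jump j (map g s) = map g (jump j s).
Proof.
have tlE t : List.tl (map g t) = map g (List.tl t) by case: t.
by elim: j s => [j IH|j IH|] s /=; rewrite ?tlE ?IH.
Qed.

Lemma peval_congr l l' p :
  List.Forall2 (congr (w ^+ 2)) l l' -> peval l p == peval l' p.
Proof.
have Ftl t t' : List.Forall2 (congr (w ^+ 2)) t t' ->
    List.Forall2 (congr (w ^+ 2)) (List.tl t) (List.tl t').
  by case=> //= *; constructor.
have Fjump j t t' : List.Forall2 (congr (w ^+ 2)) t t' ->
    List.Forall2 (congr (w ^+ 2)) (jump j t) (jump j t').
  by elim: j t t' => [j IH|j IH|] t t' tt' /=; auto.
elim: p l l' => [c|j p IH|p IHp i q IHq] l l' ll'; first exact: congr_refl.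
  exact/IH/Fjump.
apply: congrD; last exact/IHq/Ftl.
apply: congrM; first exact: IHp.
by rewrite !pow_posE; apply: congrX; case: ll' => //=; apply: congr_refl.
Qed.

Lemma peval_subst l s p : peval l (psubst s p) == peval (map (peval l) s) p.
Proof.
elim: p s => [c|j p IH|p IHp i q IHq] s /=; first exact: congr_refl.
  by rewrite jump_map; apply: IH.
apply: congr_trans (pevalD _ _ _) _; apply: congrD; last first.
  by apply: congr_trans (IHq _) _; case: s => [|x s]; apply: congr_refl.
apply: congr_trans (pevalM _ _ _) _; apply: congrM; first exact: IHp.
apply: congr_trans (peval_pow_pos _ _ _) _.
rewrite pow_posE; apply: congrX; case: s => [|x s] /=; last exact: congr_refl.
by rewrite /peval /= coef_val_zcoef; apply: congr_refl.
Qed.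

End Evaluation.

(** * Reification *)

Inductive expr :=
| EVar of nat
| EMulz of Z & expr
| EFrac of nat & nat & expr
| ERoot of nat & expr
| EAdd of expr & expr
| EOpp of expr
| EMul of expr & expr
| EExp of expr & nat.

Fixpoint interp (K : fieldType) (A : comAlgType K) (r : K) (env : seq A)
    (e : expr) : A :=
  match e with
  | EVar i => nth 0 env i
  | EMulz c e => interp r env e *~ int_of_Z c
  | EFrac m n e => (m%:R / n%:R) *: interp r env e
  | ERoot n e => (n%:R * r) *: interp r env e
  | EAdd e1 e2 => interp r env e1 + interp r env e2
  | EOpp e => - interp r env e
  | EMul e1 e2 => interp r env e1 * interp r env e2
  | EExp e n => interp r env e ^+ n
  end.

(* [compile root vars d e] represents d times [e]: the factor d clears the
   denominators of [e]. *)
Fixpoint compile (root : coef) (vars : seq pol) (d : Z) (e : expr) : pol :=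
  match e with
  | EVar i => pmulc (nth (Cp (zcoef 0)) vars i) (zcoef d)
  | EMulz c e => compile root vars (Z.mul d c) e
  | EFrac m n e => compile root vars (Z.div (Z.mul d (Z.of_nat m)) (Z.of_nat n)) e
  | ERoot n e => pmulc (compile root vars (Z.mul d (Z.of_nat n)) e) root
  | EAdd e1 e2 => padd (compile root vars d e1) (compile root vars d e2)
  | EOpp e => popp (compile root vars d e)
  | EMul e1 e2 => pmul (compile root vars d e1) (compile root vars (Zpos xH) e2)
  | EExp e n => pmulc (pexp (compile root vars (Zpos xH) e) n) (zcoef d)
  end.

(** Certifies that the divisions made by [compile] are exact. A product hands [d] to its left factor
    only and a power hands 1 to its base, so a fraction is accepted only where [d] really reaches
    it. *)
Fixpoint clears (d : Z) (e : expr) : bool :=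
  match e with
  | EVar _ => true
  | EMulz c e => clears (Z.mul d c) e
  | EFrac m n e =>
      [&& n != 0%N,
        Z.eqb (Z.modulo (Z.mul d (Z.of_nat m)) (Z.of_nat n)) Z0
        & clears (Z.div (Z.mul d (Z.of_nat m)) (Z.of_nat n)) e]
  | ERoot n e => clears (Z.mul d (Z.of_nat n)) e
  | EAdd e1 e2 => clears d e1 && clears d e2
  | EOpp e => clears d e
  | EMul e1 e2 => clears d e1 && clears (Zpos xH) e2
  | EExp e _ => clears (Zpos xH) e
  end.

Section Compilation.
Context (K : numFieldType) (A : comAlgType K) (s5 w : A).
Context (s5E : s5 ^+ 2 = 5%:R).

Lemma mulrz_algE (x : A) d : x *~ d = (d%:~R : K) *: x.
Proof. by rewrite scaler_int. Qed.

Lemma int_of_Z_nat (n : nat) : (int_of_Z (Z.of_nat n))%:~R = n%:R :> K.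
Proof. by rewrite (Z_of_intK n%:Z). Qed.

Lemma peval_nth l env vars i :
  List.Forall2 (congr (w ^+ 2)) env (map (peval s5 w l) vars) ->
  congr (w ^+ 2) env`_i (peval s5 w l (nth (Cp (zcoef 0)) vars i)).
Proof.
elim: vars env i => [|p vars IH] env i /= envE; inversion envE; subst.
  by rewrite !nth_nil /peval /= coef_val_zcoef; apply: congr_refl.
by case: i => //= i; apply: IH.
Qed.

Lemma peval_compile (r : K) root l env vars d e :
  congr (w ^+ 2) r%:A (coef_val s5 w root) ->
  List.Forall2 (congr (w ^+ 2)) env (map (peval s5 w l) vars) ->
  clears d e ->
  congr (w ^+ 2) (interp r env e *~ int_of_Z d)
    (peval s5 w l (compile root vars d e)).
Proof.
move=> rE envE; elim: e d => [i|c e IH|m n e IH|n e IH|e1 IH1 e2 IH2|e IH|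
  e1 IH1 e2 IH2|e IH n] d /= de.
- apply: congr_trans (congr_sym (pevalMc _ s5E _ _ _)).
  rewrite coef_val_zcoef -mulrzr; apply: congrM (congr_refl _ _).
  exact: peval_nth.
- by rewrite -mulrzA -rmorphM mulrC; apply: IH.
- case/and3P: de => n0 /Z.eqb_eq dm de.
  suff -> : (m%:R / n%:R) *: interp r env e *~ int_of_Z d =
     interp r env e *~ int_of_Z (Z.div (Z.mul d (Z.of_nat m)) (Z.of_nat n)).
    exact: IH.
  have nK : (n%:R : K) != 0 by rewrite pnatr_eq0.
  rewrite !mulrz_algE scalerA; congr (_ *: _); apply: (mulIf nK).
  rewrite mulrA divfK // -!int_of_Z_nat -!intrM -!rmorphM; congr (int_of_Z _)%:~R.
  by rewrite [RHS]Z.mul_comm; apply/Z.div_exact => //; lia.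
- apply: congr_trans (congr_sym (pevalMc _ s5E _ _ _)).
  rewrite (_ : _ *~ _ = (interp r env e *~ int_of_Z (Z.mul d (Z.of_nat n))) * r%:A).
    by apply: congrM => //; apply: IH.
  rewrite !mulrz_algE -scalerAl -scalerAr mulr1 !scalerA -int_of_Z_nat.
  by rewrite mulrA -intrM -rmorphM.
- rewrite mulrzDl; apply: congr_trans (congr_sym (pevalD _ s5E _ _ _)).
  by case/andP: de => de1 de2; apply: congrD; [apply: IH1 | apply: IH2].
- rewrite mulNrz; apply: congr_trans (congr_sym (pevalN _ s5E _ _)).
  by apply: congrN; apply: IH.
- apply: congr_trans (congr_sym (pevalM _ s5E _ _ _)).
  case/andP: de => de1 de2; rewrite -mulrzAl; apply: congrM; first exact: IH1.
  by rewrite -[interp _ _ e2]mulr1z; apply: (IH2 (Zpos xH)).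
- apply: congr_trans (congr_sym (pevalMc _ s5E _ _ _)).
  rewrite coef_val_zcoef -mulrzr; apply: congrM (congr_refl _ _).
  apply: congr_trans (congr_sym (pevalX _ s5E _ _ _)).
  by apply: congrX; rewrite -[interp _ _ e]mulr1z; apply: (IH (Zpos xH)).
Qed.

End Compilation.

Ltac index_of x l i :=
  lazymatch l with
  | x :: _ => constr:(i)
  | _ :: ?l' => index_of x l' (S i)
  end.

(* Powers of [u] are read as powers of u ^ 2. *)
Ltac reify_even u l t :=
  match t with
  | _ => let i := index_of t l 0%N in constr:(EVar i)
  | u ^+ ?n =>
      let i := index_of (u ^+ 2) l 0%N in
      let k := eval compute in (n./2) in constr:(EExp (EVar i) k)
  | ?x + ?y =>
      let e := reify_even u l x in let e' := reify_even u l y in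
      constr:(EAdd e e')
  | - ?x => let e := reify_even u l x in constr:(EOpp e)
  | ?x * ?y =>
      let e := reify_even u l x in let e' := reify_even u l y in
      constr:(EMul e e')
  | ?x ^+ ?n => let e := reify_even u l x in constr:(EExp e n)
  | ?x *~ int_of_Z ?c => let e := reify_even u l x in constr:(EMulz c e)
  | (?m%:R / ?n%:R) *: ?x => let e := reify_even u l x in constr:(EFrac m n e)
  | (1 / ?n%:R) *: ?x => let e := reify_even u l x in constr:(EFrac 1 n e)
  | (?n%:R * _) *: ?x => let e := reify_even u l x in constr:(ERoot n e)
  | _ *: ?x => let e := reify_even u l x in constr:(ERoot 1 e)
  end.

Section Reification.
Context (K : fieldType) (A : comAlgType K) (r : K) (a b c u : A).

Definition h2_expr : expr := ltac:(
  let t := eval cbv delta [h2 eps1] beta in (h2 a b c) in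
  let e := reify_even u [:: a ^+ 2; b ^+ 2; c ^+ 2] t in exact e).

Definition h6_expr : expr := ltac:(
  let t := eval cbv delta [h6 eps1 eps2 eps3 delta] beta zeta in (h6 r a b c) in
  let e := reify_even u [:: a ^+ 2; b ^+ 2; c ^+ 2] t in exact e).

Definition h10_expr : expr := ltac:(
  let t := eval cbv delta [h10 eps1 eps2 eps3 delta] beta zeta in (h10 r a b c) in
  let e := reify_even u [:: a ^+ 2; b ^+ 2; c ^+ 2] t in exact e).

Definition Z2_expr : expr := ltac:(
  let t := eval cbv delta [Z2_form] beta in (Z2_form a u) in
  let e := reify_even u [:: a; b; c; u ^+ 2] t in exact e).

Definition Z12_expr : expr := ltac:(
  let t := eval cbv delta [Z12_form] beta in (Z12_form a b c u) in
  let e := reify_even u [:: a; b; c; u ^+ 2] t in exact e).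

Definition Z20_expr : expr := ltac:(
  let t := eval cbv delta [Z20_form] beta in (Z20_form a b c u) in
  let e := reify_even u [:: a; b; c; u ^+ 2] t in exact e).

Definition Z30_expr : expr := ltac:(
  let t := eval cbv delta [Z30_form] beta in (Z30_form a b c u) in
  let e := reify_even u [:: a; b; c; u ^+ 2] t in exact e).

(** The leading inverse is cut off here and in the three analogues below: [EFrac] stores its
    denominator as a unary [nat], while these denominators have to stay binary, in [Y2_den] and its
    companions. The argument [r] of [reify_even] is a dummy, as no power of it occurs. *)
Definition Y2_expr : expr := ltac:(
  let t := eval cbv delta [Y2_form] beta in (Y2_form a b c u) in
  lazymatch t with _ *: ?t' =>
    let e := reify_even r [:: a; b; c; u] t' in exact e end).

Definition Y12_expr : expr := ltac:(
  let t := eval cbv delta [Y12_form] beta in (Y12_form a b c u) in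
  lazymatch t with _ *: ?t' =>
    let e := reify_even r [:: a; b; c; u] t' in exact e end).

Definition Y20_expr : expr := ltac:(
  let t := eval cbv delta [Y20_form] beta in (Y20_form a b c u) in
  lazymatch t with _ *: ?t' =>
    let e := reify_even r [:: a; b; c; u] t' in exact e end).

Definition Y30_expr : expr := ltac:(
  let t := eval cbv delta [Y30_form] beta in (Y30_form a b c u) in
  lazymatch t with _ *: ?t' =>
    let e := reify_even r [:: a; b; c; u] t' in exact e end).

Definition Y2_den : Z := ltac:(
  let t := eval cbv delta [Y2_form] beta in (Y2_form a b c u) in
  lazymatch t with (int_of_Z ?d)%:~R^-1 *: _ => exact d end).
Definition Y12_den : Z := ltac:(
  let t := eval cbv delta [Y12_form] beta in (Y12_form a b c u) in
  lazymatch t with (int_of_Z ?d)%:~R^-1 *: _ => exact d end).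
Definition Y20_den : Z := ltac:(
  let t := eval cbv delta [Y20_form] beta in (Y20_form a b c u) in
  lazymatch t with (int_of_Z ?d)%:~R^-1 *: _ => exact d end).
Definition Y30_den : Z := ltac:(
  let t := eval cbv delta [Y30_form] beta in (Y30_form a b c u) in
  lazymatch t with (int_of_Z ?d)%:~R^-1 *: _ => exact d end).

Lemma h2E : h2 a b c = interp r [:: a ^+ 2; b ^+ 2; c ^+ 2] h2_expr.
Proof. by []. Qed.

Lemma h6E : h6 r a b c = interp r [:: a ^+ 2; b ^+ 2; c ^+ 2] h6_expr.
Proof. by rewrite /= mul1r. Qed.

Lemma h10E : h10 r a b c = interp r [:: a ^+ 2; b ^+ 2; c ^+ 2] h10_expr.
Proof. by []. Qed.

Lemma expr_even (x : A) n : (x ^+ 2) ^+ n = x ^+ (2 * n).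
Proof. by rewrite exprM. Qed.

Lemma Z2E : Z2_form a u = interp r [:: a; b; c; u ^+ 2] Z2_expr.
Proof. by []. Qed.

Lemma Z12E : Z12_form a b c u = interp r [:: a; b; c; u ^+ 2] Z12_expr.
Proof. by rewrite /= !expr_even. Qed.

Lemma Z20E : Z20_form a b c u = interp r [:: a; b; c; u ^+ 2] Z20_expr.
Proof. by rewrite /= !expr_even. Qed.

Lemma Z30E : Z30_form a b c u = interp r [:: a; b; c; u ^+ 2] Z30_expr.
Proof. by rewrite /= !expr_even. Qed.

Lemma Y2E :
  Y2_form a b c u = (int_of_Z Y2_den)%:~R^-1 *: interp r [:: a; b; c; u] Y2_expr.
Proof. by []. Qed.

Lemma Y12E :
  Y12_form a b c u = (int_of_Z Y12_den)%:~R^-1 *: interp r [:: a; b; c; u] Y12_expr.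
Proof. by []. Qed.

Lemma Y20E :
  Y20_form a b c u = (int_of_Z Y20_den)%:~R^-1 *: interp r [:: a; b; c; u] Y20_expr.
Proof. by []. Qed.

Lemma Y30E :
  Y30_form a b c u = (int_of_Z Y30_den)%:~R^-1 *: interp r [:: a; b; c; u] Y30_expr.
Proof. by []. Qed.

End Reification.

Section FReification.
Context (K : fieldType) (A : comAlgType K) (r : K) (a b c u : A).

Definition F_expr : expr := ltac:(
  let t := eval cbv delta [f] beta in (f r a b c u) in
  lazymatch t with _ *: (_ * ?t') =>
    let e := reify_even u [:: h2 a b c; h6 r a b c; u ^+ 2] t' in exact e end).

Lemma fE :
  f r a b c u = 168^-1 *: (u * interp r [:: h2 a b c; h6 r a b c; u ^+ 2] F_expr).
Proof. by rewrite /= !expr_even. Qed.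

Definition f_expr : expr := ltac:(
  let t := eval cbv delta [f h2 h6 eps1 eps2 eps3 delta] beta zeta in (f r a b c u) in
  lazymatch t with _ *: ?t' =>
    let e := reify_even (@GRing.zero A) [:: a; b; c; u] t' in exact e end).

Lemma f_exprE : f r a b c u = 168^-1 *: interp r [:: a; b; c; u] f_expr.
Proof. by rewrite /= mul1r. Qed.

End FReification.

(** * Invariance under the reflection group *)

Definition X1 := Xp 1.
Definition X2 := Xp 2.
Definition X3 := Xp 3.
Definition X4 := Xp 4.

Definition zr5_coef (a b : Z) : coef := ((a, b), (Z0, Z0)).

(* The Boolean parameter selects - sqrt 5 instead of sqrt 5. *)
Definition sgn_sqrt5 (s : bool) : coef := zr5_coef 0 (if s then Zneg 1 else Zpos 1).

(** The entries of [ps] stand for the squares of the arguments: [h2], [h6] and [h10] are even in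
    each of them, and working with squares halves all degrees. *)
Definition hpols (s : bool) (ps : seq pol) : seq pol :=
  [seq psubst ps (compile (sgn_sqrt5 s) [:: X1; X2; X3] (Zpos 1) e)
  | e <- [:: h2_expr; h6_expr; h10_expr]].

Definition lin3 (a b c : coef) : pol :=
  padd (pmulc X1 a) (padd (pmulc X2 b) (pmulc X3 c)).

(** Four times the first three coordinates of the reflection [reflp] below, which keeps the
    coefficients in Z[sqrt 5]. *)
Definition refl_pols (s : bool) : seq pol :=
  let t := if s then Zneg 1 else Zpos 1 in
  [:: lin3 (zr5_coef 2 0) (zr5_coef (-1) (- t)) (zr5_coef 1 (- t));
      lin3 (zr5_coef (-1) (- t)) (zr5_coef 1 (- t)) (zr5_coef (-2) 0);
      lin3 (zr5_coef 1 (- t)) (zr5_coef (-2) 0) (zr5_coef 1 t)].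

Definition p4 (p : pol) : pol := pmulc p (zcoef 4).

(** The factor 1/168 of [f] is left out, so this computes 168 times its value. *)
Definition fpol (s : bool) (ps : seq pol) : pol :=
  psubst ps (compile (sgn_sqrt5 s) [:: X1; X2; X3; X4] (Zpos xH) f_expr).

Definition Ppols (s : bool) (ps : seq pol) : seq pol :=
  if ps is [:: a; b; c; d] then
    [:: fpol s [:: d; c; b; a]; fpol s [:: c; d; a; b]; fpol s [:: b; a; d; c];
        fpol s [:: a; b; c; d]]
  else [::].

Section Identities.
Context (K : numFieldType) (A : comAlgType K) (r : K).
Context (r5E : r ^+ 2 = 5%:R).
Implicit Types (a b c w : A) (s : bool) (l env : seq A) (ps : seq pol).

Local Notation s5 := (r%:A : A).
Local Notation peval w := (peval s5 w).

Definition sgn5 s : K := if s then - r else r.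

Lemma s5E : s5 ^+ 2 = 5%:R.
Proof. by rewrite -[LHS]scalerAl mul1r scalerA -expr2 r5E scaler_nat. Qed.
Hint Resolve s5E : core.

Lemma sgn_sqrt5E w s : (sgn5 s)%:A = coef_val s5 w (sgn_sqrt5 s).
Proof.
by case: s; rewrite /coef_val /zr5_val /= -?[Pos.to_nat 1]/1%N !mulr0z ?mulr1z
  ?mulrN1z ?scaleNr; ring.
Qed.

Lemma peval_X1 w x l : congr (w ^+ 2) x (peval w (x :: l) X1).
Proof. exact: congr_sym (peval_X w s5E (x :: l) 1). Qed.
Lemma peval_X2 w x1 x l : congr (w ^+ 2) x (peval w [:: x1, x & l] X2).
Proof. exact: congr_sym (peval_X w s5E [:: x1, x & l] 2). Qed.
Lemma peval_X3 w x1 x2 x l : congr (w ^+ 2) x (peval w [:: x1, x2, x & l] X3).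
Proof. exact: congr_sym (peval_X w s5E [:: x1, x2, x & l] 3). Qed.
Lemma peval_X4 w x1 x2 x3 x l : congr (w ^+ 2) x (peval w [:: x1, x2, x3, x & l] X4).
Proof. exact: congr_sym (peval_X w s5E [:: x1, x2, x3, x & l] 4). Qed.

Lemma peval_exact l p q : peqb p q -> peval 0 l p = peval 0 l q.
Proof. by move=> /(peval_eq 0 s5E l); rewrite expr0n; apply: congr0. Qed.

Lemma interp_psubst w s l ps vars env d e :
  List.Forall2 (congr (w ^+ 2)) env (map (peval w (map (peval w l) ps)) vars) ->
  clears d e ->
  congr (w ^+ 2) (interp (sgn5 s) env e *~ int_of_Z d)
    (peval w l (psubst ps (compile (sgn_sqrt5 s) vars d e))).
Proof.
move=> envE de; apply: congr_trans (congr_sym (peval_subst w s5E l ps _)).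
by apply: peval_compile => //; apply: congr_eq; apply: sgn_sqrt5E.
Qed.

Lemma interp_psubst1 w s l ps vars env e :
  List.Forall2 (congr (w ^+ 2)) env (map (peval w (map (peval w l) ps)) vars) ->
  clears (Zpos xH) e ->
  congr (w ^+ 2) (interp (sgn5 s) env e)
    (peval w l (psubst ps (compile (sgn_sqrt5 s) vars (Zpos xH) e))).
Proof.
by move=> envE de; rewrite -[interp _ _ _]mulr1z; apply: interp_psubst envE de.
Qed.

Lemma hpolsE w s l a b c ps :
  List.Forall2 (congr (w ^+ 2)) [:: a ^+ 2; b ^+ 2; c ^+ 2] (map (peval w l) ps) ->
  List.Forall2 (congr (w ^+ 2))
    [:: h2 a b c; h6 (sgn5 s) a b c; h10 (sgn5 s) a b c]
    (map (peval w l) (hpols s ps)).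
Proof.
move=> psE.
have envE : List.Forall2 (congr (w ^+ 2)) [:: a ^+ 2; b ^+ 2; c ^+ 2]
    (map (peval w (map (peval w l) ps)) [:: X1; X2; X3]).
  case: ps psE => [|p1 [|p2 [|p3 [|? ?]]]] psE;
    do ?[inversion psE as [|? ? ? ? ? psE']; subst; clear psE; rename psE' into psE].
  repeat constructor.
  - by apply: congr_trans (peval_X1 _ _ _); eassumption.
  - by apply: congr_trans (peval_X2 _ _ _ _); eassumption.
  - by apply: congr_trans (peval_X3 _ _ _ _ _); eassumption.
rewrite h6E h10E (h2E (sgn5 s)); repeat constructor.
- exact: interp_psubst1.
- exact: interp_psubst1.
- exact: interp_psubst1.
Qed.

Definition point (B : Type) := (B * B * B * B)%type.

Definition Zval (e : expr) s (x : point A) : A :=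
  let: (a, b, c, d) := x in
  interp (sgn5 s) [:: h2 a b c; h6 (sgn5 s) a b c; h10 (sgn5 s) a b c; d ^+ 2] e.

Definition Pval s (x : point A) : point A :=
  let: (a, b, c, d) := x in
  (f (sgn5 s) d c b a, f (sgn5 s) c d a b, f (sgn5 s) b a d c, f (sgn5 s) a b c d).

Definition rotp (x : point A) : point A := let: (a, b, c, d) := x in (b, c, a, d).
Definition swapp (x : point A) : point A := let: (a, b, c, d) := x in (b, a, d, c).

(* The reflection in the root (1, tau, 1 / tau, 0) / 2, where tau = (1 + sqrt 5) / 2. *)
Definition reflp s (x : point A) : point A :=
  let: (a, b, c, d) := x in
  let t := (sgn5 s)%:A in let q := (4^-1)%:A in
  (q * (2%:R * a - (1 + t) * b + (1 - t) * c),
   q * (- (1 + t) * a + (1 - t) * b - 2%:R * c),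
   q * ((1 - t) * a - 2%:R * b + (1 + t) * c), d).

(** A cyclic permutation of three letters is even, so it fixes the alternating polynomial [delta] as
    well as the symmetric ones. *)
Lemma h_rot s a b c :
  [/\ h2 b c a = h2 a b c, h6 (sgn5 s) b c a = h6 (sgn5 s) a b c
    & h10 (sgn5 s) b c a = h10 (sgn5 s) a b c].
Proof.
have E1 : eps1 b c a = eps1 a b c by rewrite /eps1; ring.
have E2 : eps2 b c a = eps2 a b c by rewrite /eps2; ring.
have E3 : eps3 b c a = eps3 a b c by rewrite /eps3; ring.
have E4 : delta b c a = delta a b c by rewrite /delta; ring.
by rewrite /h2 /h6 /h10 E1 E2 E3 E4.
Qed.

(** With R the reflection, this compares the values of [h2], [h6], [h10] at 4Rx and at 4x. *)
Lemma h_refl_check s :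
  all2 peqb (hpols s [seq pmul p p | p <- refl_pols s])
            (hpols s [seq pmul p p | p <- [:: p4 X1; p4 X2; p4 X3]]).
Proof. by case: s; vm_cast_no_check (erefl true). Qed.

Lemma Zval_rot e s x : Zval e s (rotp x) = Zval e s x.
Proof.
by case: x => [[[a b] c] d] /=; case: (h_rot s a b c) => -> -> ->.
Qed.

Lemma exact_Forall2 env env' : List.Forall2 (congr (0 ^+ 2)) env env' -> env = env'.
Proof. by rewrite expr0n; elim=> // x y t t' /congr0 -> _ ->. Qed.

Definition refl_points s a b c : seq A :=
  let t := (sgn5 s)%:A in
  [:: 2%:R * a - (1 + t) * b + (1 - t) * c;
      - (1 + t) * a + (1 - t) * b - 2%:R * c;
      (1 - t) * a - 2%:R * b + (1 + t) * c].

Lemma refl_polsE s a b c l :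
  map (peval 0 [:: a, b, c & l]) (refl_pols s) = refl_points s a b c.
Proof.
have linE x y z : peval 0 [:: a, b, c & l] (lin3 x y z) =
    a * coef_val s5 0 x + (b * coef_val s5 0 y + c * coef_val s5 0 z).
  apply: congr0; rewrite -[X in congr X _ _](expr0n A 2).
  rewrite /lin3; do ![apply: congr_trans (pevalD _ s5E _ _ _) _; apply: congrD];
    apply: congr_trans (pevalMc _ s5E _ _ _) _; apply: congrM (congr_refl _ _).
  - exact: congr_sym (peval_X1 _ _ _).
  - exact: congr_sym (peval_X2 _ _ _ _).
  - exact: congr_sym (peval_X3 _ _ _ _ _).
rewrite /refl_pols [map _ _]/= !linE /refl_points.
by case: s; rewrite /coef_val /zr5_val /= -?[Pos.to_nat 1]/1%N -?[Pos.to_nat 2]/2%N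
  !mulr0z !mulr1z !mulrN1z ?scaleNr; congr [:: _; _; _]; ring.
Qed.

Lemma peval_p4 w l p : congr (w ^+ 2) (4%:R * peval w l p) (peval w l (p4 p)).
Proof.
apply: congr_trans (congr_sym (pevalMc w s5E l p _)).
by rewrite coef_val_zcoef mulrC; apply: congr_refl.
Qed.

Lemma quarterK x : 4%:R * ((4^-1)%:A * x) = x :> A.
Proof.
rewrite mulr_natl -[(4^-1)%:A * x]scalerAl mul1r -scaler_nat scalerA.
by rewrite divff ?scale1r // pnatr_eq0.
Qed.

Lemma peval_sq w l ps :
  List.Forall2 (congr (w ^+ 2)) [seq x ^+ 2 | x <- map (peval w l) ps]
    (map (peval w l) [seq pmul p p | p <- ps]).
Proof.
elim: ps => [|p ps IH] /=; constructor => //.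
by rewrite expr2; apply/congr_sym/(pevalM w s5E).
Qed.

Lemma congr_exact (x y : A) : congr (0 ^+ 2) x y -> x = y.
Proof. by rewrite expr0n; apply: congr0. Qed.

Lemma peval_p4_exact l p : peval 0 l (p4 p) = 4%:R * peval 0 l p.
Proof. exact/esym/congr_exact/peval_p4. Qed.

Lemma peval_X1_exact x l : peval 0 (x :: l) X1 = x.
Proof. exact/esym/congr_exact/peval_X1. Qed.
Lemma peval_X2_exact x1 x l : peval 0 [:: x1, x & l] X2 = x.
Proof. exact/esym/congr_exact/peval_X2. Qed.
Lemma peval_X3_exact x1 x2 x l : peval 0 [:: x1, x2, x & l] X3 = x.
Proof. exact/esym/congr_exact/peval_X3. Qed.
Lemma peval_X4_exact x1 x2 x3 x l : peval 0 [:: x1, x2, x3, x & l] X4 = x.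
Proof. exact/esym/congr_exact/peval_X4. Qed.
Definition peval_X_exact :=
  (peval_X1_exact, peval_X2_exact, peval_X3_exact, peval_X4_exact).

Lemma all2_peqb l ps qs : all2 peqb ps qs -> map (peval 0 l) ps = map (peval 0 l) qs.
Proof.
elim: ps qs => [|p ps IH] [|q qs] //= /andP[pq pqs].
by rewrite (peval_exact l pq) (IH _ pqs).
Qed.

Lemma h_refl s a b c (t := refl_points s ((4^-1)%:A * a) ((4^-1)%:A * b) ((4^-1)%:A * c)) :
  [/\ h2 t`_0 t`_1 t`_2 = h2 a b c, h6 (sgn5 s) t`_0 t`_1 t`_2 = h6 (sgn5 s) a b c
    & h10 (sgn5 s) t`_0 t`_1 t`_2 = h10 (sgn5 s) a b c].
Proof.
(* Evaluation at x/4 turns the points 4Rx and 4x of the integral check into Rx and x. *)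
set l := [:: (4^-1)%:A * a; (4^-1)%:A * b; (4^-1)%:A * c].
have := peval_sq 0 l (refl_pols s).
rewrite refl_polsE -/t => /(hpolsE s)/exact_Forall2 E1.
have := peval_sq 0 l [:: p4 X1; p4 X2; p4 X3].
have -> : map (peval 0 l) [:: p4 X1; p4 X2; p4 X3] = [:: a; b; c].
  rewrite -[LHS]/[:: peval 0 l (p4 X1); peval 0 l (p4 X2); peval 0 l (p4 X3)].
  by rewrite !peval_p4_exact !peval_X_exact !quarterK.
move=> /(hpolsE s)/exact_Forall2 E2.
by have := all2_peqb l (h_refl_check s); rewrite -E1 -E2 => -[-> -> ->].
Qed.

Lemma reflE s a b c d :
  let t := refl_points s ((4^-1)%:A * a) ((4^-1)%:A * b) ((4^-1)%:A * c) in
  reflp s (a, b, c, d) = (t`_0, t`_1, t`_2, d).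
Proof. by rewrite /reflp /refl_points /=; congr (_, _, _, _); ring. Qed.

Lemma Zval_refl e s x : Zval e s (reflp s x) = Zval e s x.
Proof.
case: x => [[[a b] c] d]; rewrite reflE /Zval.
by case: (h_refl s a b c) => -> -> ->.
Qed.

Lemma Pval_rot s x : Pval s (rotp x) = rotp (Pval s x).
Proof.
case: x => [[[a b] c] d] /=; congr (_, _, _, _); rewrite /f.
- by case: (h_rot s c d a) => -> ->.
- by case: (h_rot s b a d) => -> ->.
- by case: (h_rot s d c b) => -> ->.
- by case: (h_rot s a b c) => -> ->.
Qed.

(** The four components are [f] composed with the four elements of the Klein group of double
    transpositions, so a swap of the arguments merely permutes them. *)
Lemma Pval_swap s x : Pval s (swapp x) = swapp (Pval s x).
Proof. by case: x => [[[a b] c] d]. Qed.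

Lemma mem_map4 (g : pol -> A) p1 p2 p3 p4 :
  map g [:: p1; p2; p3; p4] = [:: g p1; g p2; g p3; g p4].
Proof. by []. Qed.

Lemma natr168_scaleK (x : A) : 168%:R * (168^-1 *: x) = x.
Proof.
by rewrite mulr_natl -scaler_nat scalerA divff ?scale1r // pnatr_eq0.
Qed.

Lemma fpolE s l p1 p2 p3 p4 :
  peval 0 l (fpol s [:: p1; p2; p3; p4]) = 168%:R *
  f (sgn5 s) (peval 0 l p1) (peval 0 l p2) (peval 0 l p3) (peval 0 l p4).
Proof.
rewrite f_exprE natr168_scaleK; apply/esym/congr_exact.
apply: interp_psubst1 => //; rewrite mem_map4.
repeat constructor.
- exact: peval_X1.
- exact: peval_X2.
- exact: peval_X3.
- exact: peval_X4.
Qed.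

(** The twisted equivariance P(Rx) = R'P(x), where R' is the conjugate reflection, multiplied by 4 *
    168 and taken at 4x in place of x. The conjugation is the change from [s] to [~~ s]. *)
Lemma P_refl_check s :
  let xs := [:: p4 X1; p4 X2; p4 X3; p4 X4] in
  let ys := rcons (refl_pols s) (p4 X4) in
  all2 peqb (map p4 (Ppols s ys))
    (rcons (map (psubst (Ppols s xs)) (refl_pols (~~ s))) (p4 (last X1 (Ppols s xs)))).
Proof. by case: s; vm_cast_no_check (erefl true). Qed.

Lemma peval_subst_exact l ps p :
  peval 0 l (psubst ps p) = peval 0 (map (peval 0 l) ps) p.
Proof. exact/congr_exact/peval_subst. Qed.

Lemma natr_mulI n : n != 0%N -> injective (fun x : A => n%:R * x).
Proof.
move=> n0 x y /=; rewrite !mulr_natl -!scaler_nat => /(congr1 ( *:%R n%:R^-1)).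
by rewrite !scalerA mulVf ?pnatr_eq0 // !scale1r.
Qed.

Lemma map_Ppols s l p1 p2 p3 p4 a b c d :
  peval 0 l p1 = a -> peval 0 l p2 = b -> peval 0 l p3 = c -> peval 0 l p4 = d ->
  map (peval 0 l) (Ppols s [:: p1; p2; p3; p4]) =
  [:: 168%:R * f (sgn5 s) d c b a; 168%:R * f (sgn5 s) c d a b;
      168%:R * f (sgn5 s) b a d c; 168%:R * f (sgn5 s) a b c d].
Proof. by move=> <- <- <- <-; rewrite mem_map4 !fpolE. Qed.

Lemma map_p4 l ps : map (peval 0 l) (map p4 ps) = [seq 4%:R * x | x <- map (peval 0 l) ps].
Proof. by rewrite -!map_comp; apply: eq_map => p /=; apply: peval_p4_exact. Qed.

Lemma Pval_refl s x : Pval s (reflp s x) = reflp (~~ s) (Pval s x).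
Proof.
case: x => [[[a b] c] d]; rewrite reflE.
set q : A := (4^-1)%:A.
set l := [:: q * a; q * b; q * c; q * d].
set t := refl_points s _ _ _.
have tE : map (peval 0 l) (refl_pols s) = t by apply: refl_polsE.
have p4E p x : peval 0 l p = q * x -> peval 0 l (p4 p) = x.
  by rewrite peval_p4_exact => ->; rewrite quarterK.
have aE : peval 0 l (p4 X1) = a by rewrite (p4E _ a) ?peval_X_exact.
have bE : peval 0 l (p4 X2) = b by rewrite (p4E _ b) ?peval_X_exact.
have cE : peval 0 l (p4 X3) = c by rewrite (p4E _ c) ?peval_X_exact.
have dE : peval 0 l (p4 X4) = d by rewrite (p4E _ d) ?peval_X_exact.
have PE := map_Ppols s aE bE cE dE.
have [y1 [y2 [y3 yE]]] : exists y1 y2 y3, refl_pols s = [:: y1; y2; y3] by do 3!eexists.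
have y1E : peval 0 l y1 = t`_0 by rewrite -tE yE.
have y2E : peval 0 l y2 = t`_1 by rewrite -tE yE.
have y3E : peval 0 l y3 = t`_2 by rewrite -tE yE.
have PyE := map_Ppols s y1E y2E y3E dE.
have := all2_peqb l (P_refl_check s).
rewrite yE map_p4 PyE map_rcons peval_p4_exact -(last_map (peval 0 l)) PE.
have -> : map (peval 0 l) (map (psubst (Ppols s [:: p4 X1; p4 X2; p4 X3; p4 X4]))
      (refl_pols (~~ s))) =
    refl_points (~~ s) (168%:R * f (sgn5 s) d c b a) (168%:R * f (sgn5 s) c d a b)
      (168%:R * f (sgn5 s) b a d c).
  rewrite -(refl_polsE _ _ _ _ [:: 168%:R * f (sgn5 s) a b c d]) -map_comp.
  by apply: eq_map => p; rewrite /comp peval_subst_exact PE.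
move: (t`_0) (t`_1) (t`_2) => t0 t1 t2 /= [E1 E2 E3 E4].
have E168 (x y : A) : 4%:R * (168%:R * x) = 168%:R * y -> x = q * y.
  move=> E; apply: (natr_mulI (n := 168)) => //; apply: (natr_mulI (n := 4)) => //.
  by rewrite E -{1}(quarterK y) -/q; ring.
congr (_, _, _, _).
- by apply: E168; rewrite E1; ring.
- by apply: E168; rewrite E2; ring.
- by apply: E168; rewrite E3; ring.
- by apply: (natr_mulI (n := 168)) => //; apply: (natr_mulI (n := 4)).
Qed.

End Identities.

(** * Invariance of the $Z_j$ under a double transposition *)

Definition Zpol (s : bool) (d : Z) (e : expr) (ps : seq pol) : pol :=
  if ps is [:: p1; p2; p3; p4] then
    psubst (p4 :: rev (hpols s [:: p1; p2; p3]))
      (compile (sgn_sqrt5 s) [:: X4; X3; X2; X1] d e)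
  else Cp (zcoef 0).

(** Expands $Z_j$ in the squares of the coordinates, with [X1], [X2], [X3], [X4] standing for
    $d^2,a^2,b^2,c^2$: the two lists are the squares at (a, b, c, d) and at (b, a, d, c). Both signs
    of sqrt 5 are tested because the conjugate $Z_j^*$ is applied to the swapped P. *)
Definition swap_check (d : Z) (e : expr) : bool :=
  [&& clears d e,
    peqb (Zpol false d e [:: X2; X3; X4; X1]) (Zpol false d e [:: X3; X2; X1; X4])
    & peqb (Zpol true d e [:: X2; X3; X4; X1]) (Zpol true d e [:: X3; X2; X1; X4])].

Lemma Z2_swap : swap_check 1 Z2_expr.
Proof. by vm_cast_no_check (erefl true). Qed.
Lemma Z12_swap : swap_check 2 Z12_expr.
Proof. by vm_cast_no_check (erefl true). Qed.
Lemma Z20_swap : swap_check 2 Z20_expr.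
Proof. by vm_cast_no_check (erefl true). Qed.
Lemma Z30_swap : swap_check 15 Z30_expr.
Proof. by vm_cast_no_check (erefl true). Qed.

Section Swap.
Context (K : numFieldType) (A : comAlgType K) (r : K).
Context (r5E : r ^+ 2 = 5%:R).
Local Notation s5 := (r%:A : A).
Local Notation peval w := (peval s5 w).
Local Notation F2 w := (List.Forall2 (congr (w ^+ 2))).
Local Notation s5E := (s5E A r5E).

Lemma intZ_mulI m : m <> Z0 -> injective (fun x : A => x *~ int_of_Z m).
Proof.
move=> m0 x y /=; rewrite -!scaler_int => /(congr1 ( *:%R (int_of_Z m)%:~R^-1)).
rewrite !scalerA mulVf ?scale1r // intr_eq0; apply/eqP => /(congr1 Z_of_int).
by rewrite int_of_ZK.
Qed.

Lemma peval_Xs w x1 x2 x3 x4 l : F2 w [:: x1; x2; x3; x4] l ->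
  [/\ congr (w ^+ 2) x1 (peval w l X1), congr (w ^+ 2) x2 (peval w l X2),
    congr (w ^+ 2) x3 (peval w l X3) & congr (w ^+ 2) x4 (peval w l X4)].
Proof.
case: l => [|y1 [|y2 [|y3 [|y4 [|? ?]]]]] H;
  do ?[inversion H as [|? ? ? ? ? H']; subst; clear H; rename H' into H].
split.
- by apply: congr_trans (peval_X1 r5E _ _ _); eassumption.
- by apply: congr_trans (peval_X2 r5E _ _ _ _); eassumption.
- by apply: congr_trans (peval_X3 r5E _ _ _ _ _); eassumption.
- by apply: congr_trans (peval_X4 r5E _ _ _ _ _ _); eassumption.
Qed.

Lemma ZpolE w s l a b c d p1 p2 p3 p4 m e :
  F2 w [:: a ^+ 2; b ^+ 2; c ^+ 2; d ^+ 2] (map (peval w l) [:: p1; p2; p3; p4]) ->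
  clears m e ->
  congr (w ^+ 2) (Zval r e s (a, b, c, d) *~ int_of_Z m)
    (peval w l (Zpol s m e [:: p1; p2; p3; p4])).
Proof.
move=> psE me.
have hE : F2 w [:: a ^+ 2; b ^+ 2; c ^+ 2] (map (peval w l) [:: p1; p2; p3]).
  by inversion psE; subst; inversion H4; subst; inversion H6; subst; repeat constructor.
have := hpolsE r5E s hE.
have dE : congr (w ^+ 2) (d ^+ 2) (peval w l p4).
  by inversion psE; subst; inversion H4; subst; inversion H6; subst; inversion H8.
rewrite /Zpol; case: (hpols _ _) => [|q1 [|q2 [|q3 [|? ?]]]] qE;
  do ?[inversion qE as [|? ? ? ? ? qE']; subst; clear qE; rename qE' into qE].
apply: interp_psubst => //.
have /peval_Xs [? ? ? ?] : F2 w [:: d ^+ 2; h10 (sgn5 r s) a b c;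
    h6 (sgn5 r s) a b c; h2 a b c] (map (peval w l) [:: p4; q3; q2; q1]).
  by repeat constructor.
by repeat constructor.
Qed.

Lemma Zval_swap s x m e : m <> Z0 -> swap_check m e ->
  Zval r e s (swapp x) = Zval r e s x :> A.
Proof.
case: x => [[[a b] c] d] m0 /and3P[me chkF chkT].
have E : Zval r e s (swapp (a, b, c, d)) *~ int_of_Z m =
         Zval r e s (a, b, c, d) *~ int_of_Z m.
  set l := [:: d ^+ 2; a ^+ 2; b ^+ 2; c ^+ 2].
  have [x1 x2 x3 x4] : [/\ congr (0 ^+ 2) (d ^+ 2) (peval 0 l X1),
      congr (0 ^+ 2) (a ^+ 2) (peval 0 l X2), congr (0 ^+ 2) (b ^+ 2) (peval 0 l X3)
      & congr (0 ^+ 2) (c ^+ 2) (peval 0 l X4)].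
    by apply: peval_Xs; do 4?[constructor; first exact: congr_refl].
  apply: (@congr_exact _ A); apply: congr_trans (ZpolE s (l := l)
    (p1 := X3) (p2 := X2) (p3 := X1) (p4 := X4) _ me) _.
    by repeat constructor.
  apply: congr_sym; apply: congr_trans (ZpolE s (l := l)
    (p1 := X2) (p2 := X3) (p3 := X4) (p4 := X1) _ me) _.
    by repeat constructor.
  by apply: (peval_eq _ s5E); case: s.
by apply: intZ_mulI E.
Qed.

End Swap.

(** * Restriction to a mirror *)

Definition w_pol : pol := Cp ((Z0, Z0), (Zpos xH, Z0)).

(* (168 P_i) ^ 2 from the squares of the arguments of f. *)
Definition fsq_pol (p1 p2 p3 p4 : pol) : pol :=
  if hpols false [:: p1; p2; p3] is [:: q2; q6; _] then
    let p := psubst [:: q2; q6; p4] (compile (sgn_sqrt5 false) [:: X1; X2; X3] 1 F_expr) in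
    pmul p4 (pmul p p)
  else Cp (zcoef 0).

Definition fsq_pols : seq pol :=
  [:: fsq_pol w_pol X3 X2 X1; fsq_pol X3 w_pol X1 X2; fsq_pol X2 X1 w_pol X3].

(* [(z, i, j, e)] is the term z h6^i h10^j w^e h2^(n - 3 i - 5 j - e). *)
Definition graded_pol (n : nat) (l : seq (Z * nat * nat * nat)) : pol :=
  foldr (fun '(z, i, j, e) p =>
    padd (pmulc (pmul (pmul (pexp X1 j) (pexp X2 i))
                      (pmul (pexp X3 (n - 3 * i - 5 * j - e)) (pexp w_pol e)))
                (zcoef z)) p)
    (Cp (zcoef 0)) l.

(* Found by linear algebra: 168 ^ 2 k_2(P), 5 * 168 ^ 6 k_6(P) and
   25 * 168 ^ 10 k_10(P) modulo w ^ 2. *)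
Definition G2_data : seq (Z * nat * nat * nat) := [::
(Zpos 4, 0, 0, 0)%nat;
(Zpos 63, 2, 0, 0)%nat;
(Zneg 42, 0, 1, 0)%nat;
(Zneg 56, 0, 0, 1)%nat;
(Zneg 378, 2, 0, 1)%nat;
(Zpos 420, 0, 1, 1)%nat].

Definition G6_data : seq (Z * nat * nat * nat) := [::
(Zneg 7840, 3, 0, 0)%nat;
(Zneg 3528, 4, 0, 0)%nat;
(Zneg 196560, 5, 0, 0)%nat;
(Zpos 527310, 6, 0, 0)%nat;
(Zpos 233280, 7, 0, 0)%nat;
(Zpos 11760, 2, 1, 0)%nat;
(Zpos 127008, 3, 1, 0)%nat;
(Zpos 351540, 4, 1, 0)%nat;
(Zneg 1020600, 5, 1, 0)%nat;
(Zneg 190512, 2, 2, 0)%nat;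
(Zneg 340200, 3, 2, 0)%nat;
(Zpos 510300, 2, 3, 0)%nat;
(Zpos 122304, 3, 0, 1)%nat;
(Zpos 95760, 4, 0, 1)%nat;
(Zpos 3810240, 5, 0, 1)%nat;
(Zneg 3231900, 6, 0, 1)%nat;
(Zpos 47040, 1, 1, 1)%nat;
(Zneg 94080, 2, 1, 1)%nat;
(Zneg 604800, 3, 1, 1)%nat;
(Zneg 8731800, 4, 1, 1)%nat;
(Zneg 408240, 5, 1, 1)%nat;
(Zneg 94080, 0, 2, 1)%nat;
(Zneg 762048, 1, 2, 1)%nat;
(Zneg 1270080, 2, 2, 1)%nat;
(Zpos 11566800, 3, 2, 1)%nat;
(Zpos 1524096, 0, 3, 1)%nat;
(Zpos 2041200, 1, 3, 1)%nat;
(Zneg 4082400, 0, 4, 1)%nat].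

Definition G10_data : seq (Z * nat * nat * nat) := [::
(Zpos 940800, 3, 0, 0)%nat;
(Zpos 1411200, 4, 0, 0)%nat;
(Zpos 50194368, 5, 0, 0)%nat;
(Zneg 35108640, 6, 0, 0)%nat;
(Zpos 583238880, 7, 0, 0)%nat;
(Zneg 1890967680, 8, 0, 0)%nat;
(Zpos 1635001200, 9, 0, 0)%nat;
(Zpos 2562726600, 10, 0, 0)%nat;
(Zpos 7440174000, 11, 0, 0)%nat;
(Zneg 1881600, 2, 1, 0)%nat;
(Zneg 34056960, 3, 1, 0)%nat;
(Zneg 143304000, 4, 1, 0)%nat;
(Zneg 845873280, 5, 1, 0)%nat;
(Zneg 499005360, 6, 1, 0)%nat;
(Zpos 2520473760, 7, 1, 0)%nat;
(Zneg 918540000, 8, 1, 0)%nat;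
(Zneg 19592458200, 9, 1, 0)%nat;
(Zneg 5290790400, 10, 1, 0)%nat;
(Zpos 62469120, 2, 2, 0)%nat;
(Zpos 440899200, 3, 2, 0)%nat;
(Zpos 2246136480, 4, 2, 0)%nat;
(Zpos 2804608800, 5, 2, 0)%nat;
(Zneg 890983800, 6, 2, 0)%nat;
(Zpos 6034807800, 7, 2, 0)%nat;
(Zpos 9093546000, 8, 2, 0)%nat;
(Zpos 1254400, 0, 3, 0)%nat;
(Zneg 637943040, 2, 3, 0)%nat;
(Zneg 2645395200, 3, 3, 0)%nat;
(Zneg 8268084720, 4, 3, 0)%nat;
(Zneg 7340971680, 5, 3, 0)%nat;
(Zpos 2411167500, 6, 3, 0)%nat;
(Zneg 40642560, 0, 4, 0)%nat;
(Zpos 2005274880, 2, 4, 0)%nat;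
(Zpos 8762871600, 3, 4, 0)%nat;
(Zpos 10746918000, 4, 4, 0)%nat;
(Zpos 2686729500, 5, 4, 0)%nat;
(Zpos 438068736, 0, 5, 0)%nat;
(Zneg 1653372000, 2, 5, 0)%nat;
(Zneg 12400290000, 3, 5, 0)%nat;
(Zneg 1763596800, 0, 6, 0)%nat;
(Zpos 2361960000, 0, 7, 0)%nat;
(Zpos 3763200, 2, 0, 1)%nat;
(Zneg 62469120, 3, 0, 1)%nat;
(Zpos 129185280, 4, 0, 1)%nat;
(Zneg 3931576320, 5, 0, 1)%nat;
(Zpos 6852081600, 6, 0, 1)%nat;
(Zneg 57649475520, 7, 0, 1)%nat;
(Zpos 185094383040, 8, 0, 1)%nat;
(Zneg 190321488000, 9, 0, 1)%nat;
(Zpos 73575054000, 10, 0, 1)%nat;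
(Zneg 68118926400, 11, 0, 1)%nat;
(Zneg 12418560, 2, 1, 1)%nat;
(Zpos 2078818560, 3, 1, 1)%nat;
(Zpos 4392178560, 4, 1, 1)%nat;
(Zpos 56360525760, 5, 1, 1)%nat;
(Zneg 4415523840, 6, 1, 1)%nat;
(Zneg 256397581440, 7, 1, 1)%nat;
(Zpos 187492384800, 8, 1, 1)%nat;
(Zneg 54065264400, 9, 1, 1)%nat;
(Zneg 7526400, 0, 2, 1)%nat;
(Zneg 2495055360, 2, 2, 1)%nat;
(Zneg 21313393920, 3, 2, 1)%nat;
(Zneg 101751370560, 4, 2, 1)%nat;
(Zpos 3238159680, 5, 2, 1)%nat;
(Zpos 204580902960, 6, 2, 1)%nat;
(Zpos 159550398000, 7, 2, 1)%nat;
(Zpos 157070340000, 8, 2, 1)%nat;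
(Zpos 199700480, 0, 3, 1)%nat;
(Zpos 32151893760, 2, 3, 1)%nat;
(Zpos 67741712640, 3, 3, 1)%nat;
(Zpos 183877011360, 4, 3, 1)%nat;
(Zneg 346381434000, 5, 3, 1)%nat;
(Zneg 302291514000, 6, 3, 1)%nat;
(Zneg 1332495360, 0, 4, 1)%nat;
(Zneg 76708296000, 2, 4, 1)%nat;
(Zneg 59521392000, 3, 4, 1)%nat;
(Zpos 199231326000, 4, 4, 1)%nat;
(Zneg 740275200, 0, 5, 1)%nat;
(Zneg 8266860000, 2, 5, 1)%nat;
(Zpos 20667150000, 3, 5, 1)%nat;
(Zpos 11022480000, 0, 6, 1)%nat].

Definition G_pols : seq pol :=
  [:: graded_pol 7 G2_data; graded_pol 21 G6_data; graded_pol 35 G10_data].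

Definition pmulcs (ps : seq pol) (cs : seq Z) : seq pol :=
  [seq pmulc pc.1 (zcoef pc.2) | pc <- zip ps cs].

(** Both sides are expanded in $u_1^2,u_2^2,u_3^2$ modulo $w^2$. This certifies the tables, however
    they were found. *)
Lemma G_check :
  all2 peqb (pmulcs (hpols true fsq_pols) [:: Zpos 1; Zpos 5; Zpos 25])
    [seq psubst (rev (hpols false [:: X1; X2; X3])) p | p <- G_pols].
Proof. by vm_cast_no_check (erefl true). Qed.

Definition n168 : Z := Z.mul 168 168.

Lemma h_scale_check :
  all2 peqb (hpols true (pmulcs [:: X1; X2; X3] (nseq 3 n168)))
    (pmulcs (hpols true [:: X1; X2; X3]) [:: n168; Z.pow n168 3; Z.pow n168 5]).
Proof. by vm_cast_no_check (erefl true). Qed.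

(* h2, h6, h10 are replaced by Z2 - w, h6, h10. *)
Definition h2_pol : pol := padd X3 (popp w_pol).

(** Scaled values of $k_{10},k_6,k_2,P_4^2$ in terms of $h_{10},h_6,Z_2$. Taking $Z_2=h_2+w$ as a
    variable turns the high powers of $Z_2$ in the right-hand sides into monomials. The factors 125,
    25, 5, 5 complete the scales 25 * 168^10, 5 * 168^6, 168^2, 168^2 to the powers 5, 3, 1, 1 of
    the single number 5 * 168^2, so that the weighted homogeneity of $Z_j$ can extract it. *)
Definition K_pols : seq pol :=
  let gs := [seq psubst [:: X1; X2; h2_pol] p | p <- G_pols] in
  let q := psubst [:: h2_pol; X2; w_pol]
             (compile (sgn_sqrt5 false) [:: X1; X2; X3] 1 F_expr) in
  pmulcs (rcons (rev gs) (pmul w_pol (pmul q q))) [:: Zpos 125; Zpos 25; Zpos 5; Zpos 5].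

Definition Zform (s : bool) (d : Z) (e : expr) : pol :=
  compile (sgn_sqrt5 s) [:: X3; X2; X1; X4] d e.

Definition Z_pols : seq pol :=
  [seq psubst [:: X1; X2; h2_pol; w_pol] p
  | p <- [:: Zform false 15 Z30_expr; Zform false 2 Z20_expr;
           Zform false 2 Z12_expr; Zform false 1 Z2_expr]].

Definition Yform (e : expr) : pol :=
  compile (sgn_sqrt5 false) [:: X4; X3; X2; X1] 1 e.

(* Substitutes X_i / cs_i for X_i and divides by c; [Z.div] is exact only if the
   quotients are integers, which [Y_check] tests. *)
Fixpoint rescale (c : Z) (cs : seq Z) (p : pol) : pol :=
  match p with
  | Pc ((a, b), (a', b')) => Pc ((Z.div a c, Z.div b c), (Z.div a' c, Z.div b' c))
  | Pinj j q => Pinj j (rescale c (jump j cs) q)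
  | PX p i q =>
      PX (rescale (Z.mul c (Z.pow (List.hd (Zpos 1) cs) (Zpos i))) cs p) i
         (rescale c (List.tl cs) q)
  end.

Definition Z_dens : seq Z := [:: Zpos 15; Zpos 2; Zpos 2; Zpos 1].

(** [Z_pols] contains 15 $Z_{30}$, 2 $Z_{20}$, 2 $Z_{12}$ and $Z_2$. The polynomial here takes these
    multiples as arguments and yields 2^20 times the value of [Yform]; the power of 2 is a margin
    that keeps the coefficients integral after division by the powers of 15 and 2. *)
Definition Yform_int (e : expr) : pol :=
  rescale 1 Z_dens (pmulc (Yform e) (zcoef (Z.pow 2 20))).

Definition P_scale : Z := Z.mul 5 n168.

(* The weights of h10, h6, h2, w are 5, 3, 1, 1, and Z_j has weight n. *)
Definition Y_check (d den : Z) (n : nat) (Ze Ye : expr) : bool :=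
  let m := Z.pow P_scale (Z.of_nat n) in
  [&& clears d Ze, clears 1 Ye,
    peqb (psubst (pmulcs [:: X1; X2; X3; X4]
                   [:: Z.pow P_scale 5; Z.pow P_scale 3; P_scale; P_scale]) (Zform true d Ze))
         (pmulc (Zform true d Ze) (zcoef m)),
    peqb (psubst (pmulcs [:: X1; X2; X3; X4] Z_dens) (Yform_int Ye))
         (pmulc (Yform Ye) (zcoef (Z.pow 2 20)))
    & peqb (pmulc (psubst K_pols (Zform true d Ze)) (zcoef (Z.mul (Z.pow 2 20) den)))
           (pmulc (psubst Z_pols (Yform_int Ye)) (zcoef (Z.mul d m)))].

Lemma Y2_check : Y_check 1 Y2_den 1 Z2_expr Y2_expr.
Proof. by vm_cast_no_check (erefl true). Qed.
Lemma Y12_check : Y_check 2 Y12_den 6 Z12_expr Y12_expr.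
Proof. by vm_cast_no_check (erefl true). Qed.
Lemma Y20_check : Y_check 2 Y20_den 10 Z20_expr Y20_expr.
Proof. by vm_cast_no_check (erefl true). Qed.
Lemma Y30_check : Y_check 15 Y30_den 15 Z30_expr Y30_expr.
Proof. by vm_cast_no_check (erefl true). Qed.

Section Restriction.
Local Opaque int_of_Z.
Context (K : numFieldType) (A : comAlgType K) (r : K).
Context (r5E : r ^+ 2 = 5%:R).
Local Notation s5 := (r%:A : A).
Local Notation peval w := (peval s5 w).
Local Notation F2 w := (List.Forall2 (congr (w ^+ 2))).
Local Notation s5E := (s5E A r5E).

Lemma F2_refl w (l : seq A) : F2 w l l.
Proof. by elim: l => //= x l IH; constructor => //; apply: congr_refl. Qed.

Lemma F2_trans w (l2 l1 l3 : seq A) : F2 w l1 l2 -> F2 w l2 l3 -> F2 w l1 l3.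
Proof.
move=> l12; elim: l12 l3 => [|x y t t' xy _ IH] l3 H; inversion H; subst => //.
by constructor; [apply: congr_trans xy _ | apply: IH].
Qed.

Lemma F2_3 w (x1 x2 x3 y1 y2 y3 : A) : F2 w [:: x1; x2; x3] [:: y1; y2; y3] ->
  [/\ congr (w ^+ 2) x1 y1, congr (w ^+ 2) x2 y2 & congr (w ^+ 2) x3 y3].
Proof. by move=> H; inversion H; subst; inversion H5; subst; inversion H7. Qed.

Lemma congrMz w (x y : A) n : congr w x y -> congr w (x *~ n) (y *~ n).
Proof.
by rewrite -[x *~ n]mulrzr -[y *~ n]mulrzr => xy; apply: congrM xy (congr_refl _ _).
Qed.

Lemma mulz_intZM (x : A) m n :
  x *~ int_of_Z (Z.mul m n) = x *~ int_of_Z m *~ int_of_Z n.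
Proof. by rewrite -[LHS]mulrzr intZM mulrA !mulrzr. Qed.

Lemma mulz_eq3 (x : A) m1 m2 m3 n : Z.eqb n (Z.mul (Z.mul m1 m2) m3) ->
  x *~ int_of_Z n = x *~ int_of_Z m1 *~ int_of_Z m2 *~ int_of_Z m3.
Proof. by move=> /Z.eqb_eq ->; rewrite !mulz_intZM. Qed.

Lemma hpols3 s ps : exists q2 q6 q10, hpols s ps = [:: q2; q6; q10].
Proof. by do 3!eexists. Qed.

Lemma pevalMz w l p c : congr (w ^+ 2) (peval w l p *~ int_of_Z c)
  (peval w l (pmulc p (zcoef c))).
Proof.
apply/congr_sym/(congr_trans (pevalMc _ s5E _ _ _)).
by rewrite coef_val_zcoef mulrzr; apply: congr_refl.
Qed.

Lemma F2_checked w l ps qs : all2 peqb ps qs ->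
  F2 w (map (peval w l) ps) (map (peval w l) qs).
Proof.
elim: ps qs => [|p ps IH] [|q qs] //= /andP[pq pqs].
by constructor; [apply: (peval_eq _ s5E) | apply: IH].
Qed.

Lemma F2_psubst w l ps env qs : F2 w env (map (peval w l) ps) ->
  F2 w (map (peval w env) qs) (map (peval w l) (map (psubst ps) qs)).
Proof.
move=> envE; elim: qs => [|q qs IH] /=; constructor => //.
by apply: congr_trans (congr_sym (peval_subst w s5E _ _ _)); apply: peval_congr.
Qed.

Lemma int_of_Z_natA (B : pzRingType) (n : nat) :
  (int_of_Z (Z.of_nat n))%:~R = n%:R :> B.
Proof. by rewrite (Z_of_intK n%:Z). Qed.

Lemma congr_divz w (x y : A) n : n <> Z0 ->
  congr w (x *~ int_of_Z n) (y *~ int_of_Z n) -> congr w x y.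
Proof.
move=> n0 [z E]; exists ((int_of_Z n)%:~R^-1 *: z).
apply: (intZ_mulI n0); rewrite E mulrzDl; congr (_ + _).
rewrite -scaler_int -scalerAr scalerA mulfV ?scale1r //.
by rewrite intr_eq0; apply/eqP => /(congr1 Z_of_int); rewrite int_of_ZK.
Qed.

Section Point.
Context (a b c d : A).
Let w := d ^+ 2.
Let lv := [:: a ^+ 2; b ^+ 2; c ^+ 2].
Let P1 := f r d c b a.
Let P2 := f r c d a b.
Let P3 := f r b a d c.
Let P4 := f r a b c d.

Lemma w_polE l : peval w l w_pol = w.
Proof.
by rewrite peval_C /coef_val /zr5_val /= -?[Pos.to_nat 1]/1%N !mulr0z mulr1z; ring.
Qed.

Lemma fsqE (x1 x2 x3 x4 : A) :
  (168%:R * f r x1 x2 x3 x4) ^+ 2 = x4 ^+ 2 *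
    interp r [:: h2 x1 x2 x3; h6 r x1 x2 x3; x4 ^+ 2] F_expr ^+ 2.
Proof. by rewrite fE natr168_scaleK; ring. Qed.

Lemma fsq_polE l x1 x2 x3 x4 p1 p2 p3 p4 :
  F2 w [:: x1 ^+ 2; x2 ^+ 2; x3 ^+ 2] (map (peval w l) [:: p1; p2; p3]) ->
  congr (w ^+ 2) (x4 ^+ 2) (peval w l p4) ->
  congr (w ^+ 2) ((168%:R * f r x1 x2 x3 x4) ^+ 2) (peval w l (fsq_pol p1 p2 p3 p4)).
Proof.
move=> /(hpolsE r5E false); rewrite fsqE /fsq_pol -/(sgn5 r false).
case: (hpols _ _) => [|q1 [|q2 [|q3 [|? ?]]]] qE x4E;
  do ?[inversion qE as [|? ? ? ? ? qE']; subst; clear qE; rename qE' into qE].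
apply: congr_trans (congr_sym (pevalM _ s5E _ _ _)); apply: congrM => //.
rewrite expr2; apply: congr_trans (congr_sym (pevalM _ s5E _ _ _)).
by apply: congrM; apply: (interp_psubst1 r5E false) => //; repeat constructor => //;
  do ?[by apply: congr_trans (peval_X1 r5E _ _ _); eassumption
     | by apply: congr_trans (peval_X2 r5E _ _ _ _); eassumption
     | by apply: congr_trans (peval_X3 r5E _ _ _ _ _); eassumption].
Qed.

Lemma fsq_polsE :
  F2 w [:: (168%:R * P1) ^+ 2; (168%:R * P2) ^+ 2; (168%:R * P3) ^+ 2]
    (map (peval w lv) fsq_pols).
Proof.
have x1 : congr (w ^+ 2) (a ^+ 2) (peval w lv X1) by apply: peval_X1.
have x2 : congr (w ^+ 2) (b ^+ 2) (peval w lv X2) by apply: peval_X2.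
have x3 : congr (w ^+ 2) (c ^+ 2) (peval w lv X3) by apply: peval_X3.
have x4 : congr (w ^+ 2) (d ^+ 2) (peval w lv w_pol).
  by rewrite w_polE; apply: congr_refl.
by repeat constructor; apply: fsq_polE => //; repeat constructor.
Qed.

Lemma h_scale (x1 x2 x3 : A) :
  [/\ h2 (168%:R * x1) (168%:R * x2) (168%:R * x3) = h2 x1 x2 x3 *~ int_of_Z n168,
    h6 (- r) (168%:R * x1) (168%:R * x2) (168%:R * x3) =
      h6 (- r) x1 x2 x3 *~ int_of_Z (Z.pow n168 3)
  & h10 (- r) (168%:R * x1) (168%:R * x2) (168%:R * x3) =
      h10 (- r) x1 x2 x3 *~ int_of_Z (Z.pow n168 5)].
Proof.
set l := [:: x1 ^+ 2; x2 ^+ 2; x3 ^+ 2].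
have sqE p (x : A) : congr (0 ^+ 2) (x ^+ 2) (peval 0 l p) ->
    congr (0 ^+ 2) ((168%:R * x) ^+ 2) (peval 0 l (pmulc p (zcoef n168))).
  move=> xE.
  rewrite (_ : (168%:R * x) ^+ 2 = x ^+ 2 *~ int_of_Z n168).
    exact: congr_trans (congrMz _ xE) (pevalMz _ _ _ _).
  rewrite exprMn mulrC -mulrzr; congr (_ * _).
  have E : (int_of_Z 168)%:~R = 168%:R :> A by exact: (int_of_Z_natA A 168).
  by rewrite /n168 intZM E expr2.
have xsE : F2 0 [:: (168%:R * x1) ^+ 2; (168%:R * x2) ^+ 2; (168%:R * x3) ^+ 2]
    (map (peval 0 l) (pmulcs [:: X1; X2; X3] (nseq 3 n168))).
  repeat constructor; apply: sqE.
  - exact: peval_X1.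
  - exact: peval_X2.
  - exact: peval_X3.
have ysE : F2 0 [:: x1 ^+ 2; x2 ^+ 2; x3 ^+ 2] (map (peval 0 l) [:: X1; X2; X3]).
  repeat constructor.
  - exact: peval_X1.
  - exact: peval_X2.
  - exact: peval_X3.
have := F2_checked 0 l h_scale_check; move: (hpolsE r5E true xsE) (hpolsE r5E true ysE).
have [p2 [p6 [p10 ->]]] := hpols3 true (pmulcs [:: X1; X2; X3] (nseq 3 n168)).
have [q2 [q6 [q10 ->]]] := hpols3 true [:: X1; X2; X3].
move=> /F2_3[xE2 xE6 xE10] /F2_3[yE2 yE6 yE10] /F2_3[E2 E6 E10].
split; apply: (@congr_exact _ A).
- apply: congr_trans (congr_trans xE2 E2) (congr_sym _).
  exact: congr_trans (congrMz _ yE2) (pevalMz _ _ _ _).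
- apply: congr_trans (congr_trans xE6 E6) (congr_sym _).
  exact: congr_trans (congrMz _ yE6) (pevalMz _ _ _ _).
- apply: congr_trans (congr_trans xE10 E10) (congr_sym _).
  exact: congr_trans (congrMz _ yE10) (pevalMz _ _ _ _).
Qed.

Let L := [:: h10 r a b c; h6 r a b c; h2 a b c + w].
Let k2 := h2 P1 P2 P3.
Let k6 := h6 (- r) P1 P2 P3.
Let k10 := h10 (- r) P1 P2 P3.

Lemma h2_polE : congr (w ^+ 2) (h2 a b c) (peval w L h2_pol).
Proof.
apply: congr_sym; apply: congr_trans (pevalD _ s5E _ _ _) _.
rewrite -[X in congr _ _ X](addrK w); apply: congrD; first exact/congr_sym/peval_X3.
apply: congr_trans (pevalN _ s5E _ _) _.
by rewrite w_polE; apply: congr_refl.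
Qed.

Lemma h_L : F2 w [:: h10 r a b c; h6 r a b c; h2 a b c]
  (map (peval w L) [:: X1; X2; h2_pol]).
Proof.
repeat constructor; [exact: peval_X1 | exact: peval_X2 | exact: h2_polE].
Qed.

Lemma hpols_rev s : exists q2 q6 q10,
  hpols s [:: X1; X2; X3] = [:: q2; q6; q10] /\
  rev (hpols s [:: X1; X2; X3]) = [:: q10; q6; q2].
Proof. by do 3!eexists. Qed.

(** [fsq_pols] describes the squares of 168 $P_i$, hence the powers of [n168] next to the scales 1,
    5, 25 of [G_check]. *)
Lemma h_G : exists g2 g6 g10, G_pols = [:: g2; g6; g10] /\
  F2 w [:: k2 *~ int_of_Z n168; k6 *~ int_of_Z (Z.pow n168 3) *~ int_of_Z 5;
           k10 *~ int_of_Z (Z.pow n168 5) *~ int_of_Z 25]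
    (map (peval w [:: h10 r a b c; h6 r a b c; h2 a b c]) [:: g2; g6; g10]).
Proof.
have [g2 [g6 [g10 gE]]] : exists g2 g6 g10, G_pols = [:: g2; g6; g10].
  by do 3!eexists.
exists g2, g6, g10; split; first exact: gE.
have lvE : F2 w [:: a ^+ 2; b ^+ 2; c ^+ 2] (map (peval w lv) [:: X1; X2; X3]).
  repeat constructor; [exact: peval_X1 | exact: peval_X2 | exact: peval_X3].
have := F2_checked w lv G_check; rewrite gE.
move: (hpolsE r5E true fsq_polsE) (hpolsE r5E false lvE).
have [p2 [p6 [p10 ->]]] := hpols3 true fsq_pols.
have [q2 [q6 [q10 [-> ->]]]] := hpols_rev false.
case: (h_scale P1 P2 P3) => -> -> ->.
move=> /F2_3[pE2 pE6 pE10] /F2_3[qE2 qE6 qE10] /F2_3[E2 E6 E10].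
have qE : F2 w [:: h10 r a b c; h6 r a b c; h2 a b c] (map (peval w lv) [:: q10; q6; q2]).
  by repeat constructor.
have /F2_3[gE2 gE6 gE10] := F2_psubst [:: g2; g6; g10] qE.
repeat constructor.
- apply: congr_trans (congr_sym gE2); apply: congr_trans E2.
  by apply: congr_trans (pevalMz _ _ _ _); rewrite mulr1z.
- apply: congr_trans (congr_sym gE6); apply: congr_trans E6.
  by apply: congr_trans (pevalMz _ _ _ _); apply: congrMz.
- apply: congr_trans (congr_sym gE10); apply: congr_trans E10.
  by apply: congr_trans (pevalMz _ _ _ _); apply: congrMz.
Qed.

Lemma P4sqE : congr (w ^+ 2) (P4 ^+ 2 *~ int_of_Z P_scale)
  (peval w L (last (Cp (zcoef 0)) K_pols)).
Proof.
rewrite /K_pols; set p := psubst _ _.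
rewrite (_ : last _ _ = pmulc (pmul w_pol (pmul p p)) (zcoef 5)) //.
apply: congr_trans (pevalMz _ _ _ _).
rewrite /P_scale Z.mul_comm (_ : _ *~ _ = (168%:R * P4) ^+ 2 *~ int_of_Z 5); last first.
  have E : (int_of_Z 168)%:~R = 168%:R :> A by exact: (int_of_Z_natA A 168).
  rewrite mulz_intZM; congr (_ *~ _).
  by rewrite -[LHS]mulrzr /n168 intZM E; ring.
apply: congrMz; rewrite fsqE; apply: congr_trans (congr_sym (pevalM _ s5E _ _ _)).
apply: congrM; first by rewrite w_polE; apply: congr_refl.
rewrite expr2; apply: congr_trans (congr_sym (pevalM _ s5E _ _ _)).
have pE : congr (w ^+ 2) (interp r [:: h2 a b c; h6 r a b c; d ^+ 2] F_expr) (peval w L p).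
  apply: (interp_psubst1 r5E false) => //.
  have x1 := h2_polE.
  have x2 : congr (w ^+ 2) (h6 r a b c) (peval w L X2) by apply: peval_X2.
  have x3 : congr (w ^+ 2) w (peval w L w_pol) by rewrite w_polE; apply: congr_refl.
  repeat constructor.
  + by apply: congr_trans (peval_X1 r5E _ _ _).
  + by apply: congr_trans (peval_X2 r5E _ _ _ _).
  + by apply: congr_trans (peval_X3 r5E _ _ _ _ _).
exact: congrM.
Qed.

Lemma K_polsE :
  F2 w [:: k10 *~ int_of_Z (Z.pow P_scale 5); k6 *~ int_of_Z (Z.pow P_scale 3);
           k2 *~ int_of_Z P_scale; P4 ^+ 2 *~ int_of_Z P_scale]
    (map (peval w L) K_pols).
Proof.
have [g2 [g6 [g10 [gE /F2_3[gE2 gE6 gE10]]]]] := h_G.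
have := P4sqE; rewrite /K_pols gE; set p := pmul w_pol _ => pE.
have /F2_3[LE2 LE6 LE10] := F2_psubst [:: g2; g6; g10] h_L.
repeat constructor.
- rewrite (mulz_eq3 _ (erefl true :
    Z.eqb (Z.pow P_scale 5) (Z.mul (Z.mul (Z.pow n168 5) 25) 125))).
  exact: congr_trans (congrMz _ (congr_trans gE10 LE10)) (pevalMz _ _ _ _).
- rewrite (mulz_eq3 _ (erefl true :
    Z.eqb (Z.pow P_scale 3) (Z.mul (Z.mul (Z.pow n168 3) 5) 25))).
  exact: congr_trans (congrMz _ (congr_trans gE6 LE6)) (pevalMz _ _ _ _).
- rewrite (_ : P_scale = Z.mul n168 5); last by rewrite /P_scale Z.mul_comm.
  rewrite mulz_intZM.
  exact: congr_trans (congrMz _ (congr_trans gE2 LE2)) (pevalMz _ _ _ _).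
- exact: pE.
Qed.

Lemma Zvars l s m e (x1 x2 x3 x4 : A) ps : clears m e ->
  F2 w [:: x1; x2; x3; x4] (map (peval w l) ps) ->
  congr (w ^+ 2) (interp (sgn5 r s) [:: x3; x2; x1; x4] e *~ int_of_Z m)
    (peval w l (psubst ps (Zform s m e))).
Proof.
move=> me psE; apply: (interp_psubst r5E s) => //.
by have [? ? ? ?] := peval_Xs r5E psE; repeat constructor.
Qed.

Let Zx e := Zval r e false (a, b, c, d).

Lemma Z_polsE :
  F2 w [:: Zx Z30_expr *~ int_of_Z 15; Zx Z20_expr *~ int_of_Z 2;
           Zx Z12_expr *~ int_of_Z 2; Zx Z2_expr *~ int_of_Z 1]
    (map (peval w L) Z_pols).
Proof.
have psE : F2 w [:: h10 r a b c; h6 r a b c; h2 a b c; w]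
    (map (peval w L) [:: X1; X2; h2_pol; w_pol]).
  repeat constructor; [exact: peval_X1 | exact: peval_X2 | exact: h2_polE |].
  by rewrite w_polE; apply: congr_refl.
by repeat constructor; apply: (Zvars false _ psE).
Qed.

(** Write d for the denominator of $Z_j$ and m for [P_scale] to the power [n]. The left side times d
    m is the value of $Z_j$ at [K_pols], and the right side times [den] and 2^20 is the value of
    [Yform_int] at [Z_pols]. The last test in [Y_check] equates these two after cross
    multiplication, and the integer factors cancel because they are invertible in K. *)
Lemma Y_congr dn den n Ze Ye : dn <> Z0 -> den <> Z0 -> Y_check dn den n Ze Ye ->
  congr (w ^+ 2) (Zval r Ze true (Pval r false (a, b, c, d)))
    ((int_of_Z den)%:~R^-1 *:
     interp r [:: Zx Z2_expr; Zx Z12_expr; Zx Z20_expr; Zx Z30_expr] Ye).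
Proof.
move=> dn0 den0 /and5P[clZ clY chkZ chkY chk].
set T1 := Zval _ _ _ _; set T2 := interp _ _ _.
set m := Z.pow P_scale (Z.of_nat n) in chkZ chk.
have E1 : congr (w ^+ 2) (T1 *~ int_of_Z dn *~ int_of_Z m)
    (peval w L (psubst K_pols (Zform true dn Ze))).
  set l := [:: k10; k6; k2; P4 ^+ 2].
  have [x1 x2 x3 x4] := peval_Xs r5E (F2_refl w l).
  have TE : congr (w ^+ 2) (T1 *~ int_of_Z dn) (peval w l (Zform true dn Ze)).
    apply: (peval_compile s5E) => //; first by apply: congr_eq; apply: sgn_sqrt5E.
    by repeat constructor.
  apply: congr_trans (congrMz _ TE) _; apply: congr_trans (pevalMz _ _ _ _) _.
  (* Weighted homogeneity moves the factor m into the arguments, which then carry exactly the scales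
     of [K_polsE]. *)
  apply: congr_trans (congr_sym (peval_eq _ s5E l chkZ)) _.
  apply: congr_trans (peval_subst _ s5E _ _ _) _.
  apply: congr_trans (congr_sym (peval_subst _ s5E _ _ _)).
  apply: peval_congr; apply: F2_trans K_polsE.
  by repeat constructor; apply: congr_sym;
    apply: congr_trans (pevalMz _ _ _ _); apply: congrMz.
have E2 : congr (w ^+ 2) (T2 *~ int_of_Z (Z.pow 2 20))
    (peval w L (psubst Z_pols (Yform_int Ye))).
  set l := [:: Zx Z30_expr; Zx Z20_expr; Zx Z12_expr; Zx Z2_expr].
  have [x1 x2 x3 x4] := peval_Xs r5E (F2_refl w l).
  have TE : congr (w ^+ 2) T2 (peval w l (Yform Ye)).
    rewrite -[T2]mulr1z; apply: (peval_compile s5E (d := Zpos xH)) => //.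
      by apply: congr_eq; exact: (sgn_sqrt5E r w false).
    by repeat constructor.
  apply: congr_trans (congrMz _ TE) _; apply: congr_trans (pevalMz _ _ _ _) _.
  (* In the same way the factor 2^20 is traded for the multiples of the $Z_j$ held in [Z_pols]. *)
  apply: congr_trans (congr_sym (peval_eq _ s5E l chkY)) _.
  apply: congr_trans (peval_subst _ s5E _ _ _) _.
  apply: congr_trans (congr_sym (peval_subst _ s5E _ _ _)).
  apply: peval_congr; apply: F2_trans Z_polsE.
  by repeat constructor; apply: congr_sym;
    apply: congr_trans (pevalMz _ _ _ _); apply: congrMz.
have E3 := peval_eq w s5E L chk.
have E4 : congr (w ^+ 2)
    (T1 *~ int_of_Z dn *~ int_of_Z m *~ int_of_Z (Z.mul (Z.pow 2 20) den))
    (T2 *~ int_of_Z (Z.pow 2 20) *~ int_of_Z (Z.mul dn m)).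
  apply: congr_trans (congr_trans (congrMz _ E1) (pevalMz _ _ _ _)) _.
  apply: congr_trans E3 _; apply: congr_sym.
  exact: congr_trans (congrMz _ E2) (pevalMz _ _ _ _).
have n0 : Z.mul (Z.mul dn m) (Z.pow 2 20) <> Z0.
  have m0 : m <> Z0 by apply: Z.pow_nonzero; [vm_compute | lia].
  by case/Z.mul_eq_0 => [/Z.mul_eq_0[/dn0|/m0]|] //; discriminate.
apply: (congr_divz den0); apply: (congr_divz n0).
have -> : T1 *~ int_of_Z den *~ int_of_Z (Z.mul (Z.mul dn m) (Z.pow 2 20)) =
    T1 *~ int_of_Z dn *~ int_of_Z m *~ int_of_Z (Z.mul (Z.pow 2 20) den).
  by rewrite -!mulz_intZM; congr (_ *~ int_of_Z _); lia.
have -> : ((int_of_Z den)%:~R^-1 *: T2) *~ int_of_Z den = T2.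
  rewrite -scaler_int scalerA mulfV ?scale1r // intr_eq0.
  by apply/eqP => /(congr1 Z_of_int); rewrite int_of_ZK.
rewrite (_ : _ *~ int_of_Z (Z.mul (Z.mul dn m) (Z.pow 2 20)) =
  T2 *~ int_of_Z (Z.pow 2 20) *~ int_of_Z (Z.mul dn m)) //.
by rewrite -!mulz_intZM; congr (_ *~ int_of_Z _); lia.
Qed.

End Point.
End Restriction.

(** * The difference of the two sides: invariance and behaviour under substitution *)

Section Difference.
Context (K : numFieldType) (r : K).
Context (r5E : r ^+ 2 = 5%:R).

Definition Dval (A : comAlgType K) (k : K) (Ze Ye : expr) (x : point A) : A :=
  Zval r Ze true (Pval r false x) -
  k *: interp r [seq Zval r e false x | e <- [:: Z2_expr; Z12_expr; Z20_expr; Z30_expr]] Ye.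

Lemma Dval_rot A k Ze Ye x : Dval k Ze Ye (rotp x) = Dval (A := A) k Ze Ye x.
Proof. by rewrite /Dval Pval_rot /= !Zval_rot. Qed.

Lemma Dval_refl A k Ze Ye x : Dval k Ze Ye (reflp r false x) = Dval (A := A) k Ze Ye x.
Proof. by rewrite /Dval (Pval_refl r5E) /= !(Zval_refl r5E). Qed.

Lemma Dval_swap A k d Ze Ye x : d <> Z0 -> swap_check d Ze ->
  Dval k Ze Ye (swapp x) = Dval (A := A) k Ze Ye x.
Proof.
move=> d0 Zec; rewrite /Dval Pval_swap (Zval_swap r5E _ _ d0 Zec) /=.
by rewrite (Zval_swap r5E _ _ _ Z2_swap) // (Zval_swap r5E _ _ _ Z12_swap) //
  (Zval_swap r5E _ _ _ Z20_swap) // (Zval_swap r5E _ _ _ Z30_swap).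
Qed.

Definition point_map (A B : Type) (g : A -> B) (x : point A) : point B :=
  let: (a, b, c, d) := x in (g a, g b, g c, g d).

Section Morphism.
Context (A B : comAlgType K) (g : {lrmorphism A -> B}).

Lemma interp_morph s env e : g (interp s env e) = interp s (map g env) e.
Proof.
elim: e => [i|c e IH|m n e IH|n e IH|e1 IH1 e2 IH2|e IH|e1 IH1 e2 IH2|e IH n] /=.
- elim: env i => [|x env IHe] [|i] //=; rewrite ?raddf0 //.
- by rewrite raddfMz /= IH.
- by rewrite linearZ /= IH.
- by rewrite linearZ /= IH.
- by rewrite raddfD /= IH1 IH2.
- by rewrite raddfN /= IH.
- by rewrite rmorphM /= IH1 IH2.
- by rewrite rmorphXn /= IH.
Qed.

Lemma map_sq a b c :
  map g [:: a ^+ 2; b ^+ 2; c ^+ 2] = [:: g a ^+ 2; g b ^+ 2; g c ^+ 2].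
Proof. by rewrite /= !rmorphXn. Qed.

Lemma Zval_morph e s x : g (Zval r e s x) = Zval r e s (point_map g x).
Proof.
case: x => [[[a b] c] d]; rewrite /Zval interp_morph /point_map 4!map_cons rmorphXn.
by rewrite !h6E !h10E !(h2E r) !interp_morph !map_sq.
Qed.

Lemma f_morph s a b c d : g (f s a b c d) = f s (g a) (g b) (g c) (g d).
Proof. by rewrite !f_exprE linearZ; congr (_ *: _); apply: interp_morph. Qed.

Lemma Pval_morph s x : point_map g (Pval r s x) = Pval r s (point_map g x).
Proof. by case: x => [[[a b] c] d]; rewrite /Pval /point_map !f_morph. Qed.

(** For [g] a substitution of polynomials, this converts the pointwise invariance of [Dval] into
    invariance of the polynomial obtained at the variables. *)
Lemma Dval_morph k Ze Ye x : g (Dval k Ze Ye x) = Dval k Ze Ye (point_map g x).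
Proof.
rewrite /Dval rmorphB; congr (_ - _).
  by rewrite -Pval_morph; apply: Zval_morph.
apply: etrans (linearZ_LR _ _ _) _; congr (_ *: _).
apply: etrans (interp_morph _ _ _) _.
by rewrite -map_comp; congr interp; apply: eq_map => e; apply: Zval_morph.
Qed.

End Morphism.

End Difference.

(** * Divisibility by the mirrors *)

(* Mirrors are given by normal vectors over Z[sqrt 5] of squared norm 16. *)
Definition normal := point zr5.

Definition zi (n : Z) : zr5 := (n, Z0).
Definition dot (x y : normal) : zr5 :=
  let: (a, b, c, d) := x in let: (a', b', c', d') := y in
  zr5_add (zr5_add (zr5_mul a a') (zr5_mul b b'))
          (zr5_add (zr5_mul c c') (zr5_mul d d')).
Definition nscale (k : zr5) : normal -> normal := point_map (zr5_mul k).
Definition nsub (x y : normal) : normal :=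
  let: (a, b, c, d) := x in let: (a', b', c', d') := y in
  (zr5_sub a a', zr5_sub b b', zr5_sub c c', zr5_sub d d').
Definition neqb (x y : normal) : bool :=
  let: (a, b, c, d) := x in let: (a', b', c', d') := y in
  [&& zr5_eqb a a', zr5_eqb b b', zr5_eqb c c' & zr5_eqb d d'].

(** Tests the norm $a^2-5b^2$: it is the value of the product with the conjugate, so a nonzero norm
    forces a nonzero value in K. *)
Definition zr5_nz (x : zr5) : bool :=
  ~~ Z.eqb (Z.sub (Z.mul x.1 x.1) (Z.mul 5 (Z.mul x.2 x.2))) Z0.
Definition n_nz (x : normal) : bool :=
  let: (a, b, c, d) := x in [|| zr5_nz a, zr5_nz b, zr5_nz c | zr5_nz d].

(* As x has squared norm 16, this is 16 times the projection of y orthogonally to x. *)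
Definition independent (x y : normal) : bool :=
  n_nz (nsub (nscale (zi 16) y) (nscale (dot y x) x)).

Definition refl4 (x : normal) : normal :=
  let: (a, b, c, d) := x in
  let p := (Zpos 1, Zpos 1) in let m := (Zpos 1, Zneg 1) in
  let comb x1 x2 x3 :=
    zr5_add (zr5_mul x1 a) (zr5_add (zr5_mul x2 b) (zr5_mul x3 c)) in
  (comb (zi 2) (zr5_opp p) m, comb (zr5_opp p) m (zi (-2)), comb m (zi (-2)) p,
   zr5_mul (zi 4) d).

Definition quarter (x : normal) : normal :=
  point_map (fun z => (Z.div z.1 4, Z.div z.2 4)) x.

(** The normals that [rotp], [swapp] and the reflection produce from [x]. [Z.div] rounds, so the
    reflected normal is kept only if multiplying back by 4 returns [refl4 x]; a lost mirror would
    show in the count of [mirrors_check]. *)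
Definition images (x : normal) : seq normal :=
  let: (a, b, c, d) := x in
  let y := quarter (refl4 x) in
  [:: (c, a, b, d), (b, a, d, c) & if neqb (nscale (zi 4) y) (refl4 x) then [:: y] else [::]].

Definition add_normal (s : seq normal) (x : normal) : seq normal :=
  if has (fun y => neqb x y || neqb x (nscale (zi (-1)) y)) s then s else rcons s x.

Fixpoint explore (n : nat) (s : seq normal) : seq normal :=
  if n is m.+1 then explore m (foldl add_normal s (flatten (map images s))) else s.

(** The orbit up to sign of 4 times the unit normal of $u_4=0$. The length 4 makes all coordinates
    lie in Z[sqrt 5]: for instance the root (1, tau, 1/tau, 0)/2 becomes (2, 1 + sqrt 5, sqrt 5 - 1,
    0). That 9 rounds produce 60 mirrors is part of [mirrors_check]. *)
Definition mirrors : seq normal := explore 9 [:: (zi 0, zi 0, zi 0, zi 4)].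

Definition spread (s : seq normal) : bool :=
  pairwise independent s && all (fun x => zr5_eqb (dot x x) (zi 16) && n_nz x) s.

Lemma mirrors_check : (size mirrors == 60%N) && spread mirrors.
Proof. by vm_cast_no_check (erefl true). Qed.

Definition dvd (A : comPzRingType) (a b : A) : Prop := exists c, b = a * c.

Lemma proj_identity (B : comPzRingType) (p q s t p' q' s' t' k l x1 x2 x3 x4 : B) :
  p' * (x1 - k * l * p) + q' * (x2 - k * l * q) + s' * (x3 - k * l * s) +
    t' * (x4 - k * l * t) =
  p' * x1 + q' * x2 + s' * x3 + t' * x4 -
    k * ((p' * p + q' * q + (s' * s + t' * t)) * l).
Proof. ring. Qed.

Lemma refl_identity (B : comPzRingType) (p q s t h v x1 x2 x3 x4 : B) :
  4%:R * h = 1 ->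
  (2%:R * p + (- (1 + v) * q + (1 - v) * s)) * x1 +
    (- (1 + v) * p + ((1 - v) * q + - 2%:R * s)) * x2 +
    ((1 - v) * p + (- 2%:R * q + (1 + v) * s)) * x3 + 4%:R * t * x4 =
  4%:R * (p * (h * (2%:R * x1 - (1 + v) * x2 + (1 - v) * x3)) +
          q * (h * (- (1 + v) * x1 + (1 - v) * x2 - 2%:R * x3)) +
          s * (h * ((1 - v) * x1 - 2%:R * x2 + (1 + v) * x3)) + t * x4).
Proof.
move=> h4; set y1 := 2%:R * x1 - _ + _; set y2 := _ - 2%:R * x3; set y3 := (1 - v) * x1 - _ + _.
transitivity (4%:R * h * (p * y1 + q * y2 + s * y3) + 4%:R * t * x4); last by ring.
by rewrite h4 /y1 /y2 /y3; ring.
Qed.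

Section Divisibility.
Context (K : numFieldType) (r : K).
Context (r5E : r ^+ 2 = 5%:R).

Local Notation A := {mpoly K[4]}.
Local Notation s5 := (r%:A : A).
Local Notation s5E := (s5E {mpoly K[4]} r5E).
Local Notation val := (zr5_val s5).

Definition vars : point A := (u1 K, u2 K, u3 K, u4 K).

Definition lin (n : normal) (x : point A) : A :=
  let: (p, q, s, t) := n in let: (a, b, c, d) := x in
  val p * a + val q * b + val s * c + val t * d.

Definition tup (x : point A) : 4.-tuple A := let: (a, b, c, d) := x in [tuple a; b; c; d].

Local Notation subst x := (comp_mpoly (tup x)).

Lemma subst_vars x : point_map (subst x) vars = x.
Proof.
case: x => [[[a b] c] d]; rewrite /point_map /vars /u1 /u2 /u3 /u4.
by rewrite !comp_mpolyXU.
Qed.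

Lemma substK a : subst vars a = a.
Proof.
rewrite -[RHS]comp_mpoly_id; congr comp_mpoly; apply: eq_from_tnth => i.
rewrite tnth_mktuple (tnth_nth 0).
by case: i => -[|[|[|[|]]]] //= ?; congr ('X_ _); apply: val_inj.
Qed.

Lemma subst_val x z : subst x (val z) = val z.
Proof.
by rewrite /zr5_val rmorphD rmorphM !rmorph_int /= comp_mpolyZ comp_mpoly1.
Qed.

Lemma subst_lin n x y : subst x (lin n y) = lin n (point_map (subst x) y).
Proof.
case: n y => [[[p q] s] t] [[[a b] c] d].
by rewrite /lin !rmorphD !rmorphM /= !subst_val.
Qed.

Lemma comp_congr m x y a : congr m x.1.1.1 y.1.1.1 -> congr m x.1.1.2 y.1.1.2 ->
  congr m x.1.2 y.1.2 -> congr m x.2 y.2 -> congr m (subst x a) (subst y a).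
Proof.
case: x y => [[[x1 x2] x3] x4] [[[y1 y2] y3] y4] /= h1 h2 h3 h4.
rewrite !comp_mpolyEX; elim/big_ind2: _ => [|*|e _]; first exact: congr_refl.
  exact: congrD.
rewrite -!mul_mpolyC; apply: congrM; first exact: congr_refl.
rewrite !comp_mpolyX; elim/big_ind2: _ => [|*|i _]; first exact: congr_refl.
  exact: congrM.
apply: congrX; rewrite !(tnth_nth 0).
by case: i => -[|[|[|[|]]]].
Qed.

Lemma congr_subst m x a : congr m (u1 K) x.1.1.1 -> congr m (u2 K) x.1.1.2 ->
  congr m (u3 K) x.1.2 -> congr m (u4 K) x.2 -> congr m a (subst x a).
Proof.
by move=> *; rewrite -[X in congr _ X _](substK a); apply: comp_congr.
Qed.

Lemma zr5_nz_val z : zr5_nz z -> val z != 0.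
Proof.
move=> /negP nz; apply/eqP => z0; apply: nz; apply/Z.eqb_eq.
have E : val (zr5_mul z (z.1, Z.opp z.2)) = 0 by rewrite (zr5_valM s5E) z0 mul0r.
move: E; rewrite /zr5_val (_ : (zr5_mul _ _).2 = Z0); last first.
  by rewrite /zr5_mul; case: (z) => ? ?; cbn [fst snd]; lia.
rewrite mulr0z mul0r addr0 -(rmorph_int (@mpolyC 4 K)).
move=> /eqP; rewrite mpolyC_eq0 intr_eq0 => /eqP/(congr1 Z_of_int).
rewrite int_of_ZK -[Z_of_int 0]/Z0 /zr5_mul; case: (z) => x y; cbn [fst snd]; lia.
Qed.

Lemma lin_eq0 n : n_nz n -> lin n vars != 0.
Proof.
case: n => [[[p q] s] t] nz; apply/eqP => l0.
have := fun x => subst_lin (p, q, s, t) x vars.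
rewrite l0 => E; case/or4P: nz => /zr5_nz_val/eqP; apply.
- by have := E (1, 0, 0, 0); rewrite subst_vars /lin !mulr0 !addr0 mulr1 rmorph0.
- by have := E (0, 1, 0, 0); rewrite subst_vars /lin !mulr0 !addr0 add0r mulr1 rmorph0.
- by have := E (0, 0, 1, 0); rewrite subst_vars /lin !mulr0 !addr0 !add0r mulr1 rmorph0.
- by have := E (0, 0, 0, 1); rewrite subst_vars /lin !mulr0 !add0r mulr1 rmorph0.
Qed.

Lemma msize_lin n : n_nz n -> (1 < msize (lin n vars))%N.
Proof.
move=> /lin_eq0; rewrite ltnNge; apply: contra => /msize1_polyC E.
have := subst_lin n (0, 0, 0, 0) vars; rewrite subst_vars E /=.
rewrite comp_mpolyC => ->.
by case: n {E} => [[[p q] s] t]; rewrite /lin !mulr0 !addr0.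
Qed.

Lemma lin_nscale k n x : lin (nscale k n) x = val k * lin n x.
Proof.
case: n x => [[[p q] s] t] [[[a b] c] d].
by rewrite /lin /= !(zr5_valM s5E); ring.
Qed.

Lemma lin_nsub n n' x : lin (nsub n n') x = lin n x - lin n' x.
Proof.
case: n n' x => [[[p q] s] t] [[[p' q'] s'] t'] [[[a b] c] d].
by rewrite /lin /= !zr5_subE !zr5_valD !zr5_valN; ring.
Qed.

Lemma neqbP n n' : neqb n n' -> n = n'.
Proof.
case: n n' => [[[p q] s] t] [[[p' q'] s'] t'].
by case/and4P => /zr5_eqP -> /zr5_eqP -> /zr5_eqP -> /zr5_eqP ->.
Qed.

Definition proj (n : normal) : point A :=
  let: (p, q, s, t) := n in let k := (16^-1)%:A * lin n vars in
  (u1 K - k * val p, u2 K - k * val q, u3 K - k * val s, u4 K - k * val t).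

Lemma k16 : (16^-1)%:A * 16%:R = 1 :> A.
Proof.
by rewrite -scalerAl mul1r -[X in _ *: X]scaler_nat scalerA mulVf ?scale1r ?pnatr_eq0.
Qed.

Lemma val_zi n : val (zi n) = (int_of_Z n)%:~R.
Proof. by rewrite /zr5_val /= mulr0z mul0r addr0. Qed.

Lemma subst_proj n n' : subst (proj n) (lin n' vars) =
  lin n' vars - (16^-1)%:A * (val (dot n' n) * lin n vars).
Proof.
rewrite subst_lin subst_vars.
rewrite /proj; case: n n' => [[[p q] s] t] [[[p' q'] s'] t'].
by rewrite /dot !zr5_valD !(zr5_valM s5E); apply: proj_identity.
Qed.

Lemma congr_proj n a : congr (lin n vars) a (subst (proj n) a).
Proof.
have E (x k y : A) : congr (lin n vars) x (x - k * lin n vars * y).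
  by exists (k * y); rewrite mulrCA mulrA subrK.
by apply: congr_subst; case: n E => [[[p q] s] t] E; apply: E.
Qed.

(** The projection changes each variable by a multiple of [lin n vars], so it changes [a] by such a
    multiple too. Substituting it thus plays the part of reduction modulo the linear form. *)
Lemma dvd_lin n a : subst (proj n) a = 0 -> dvd (lin n vars) a.
Proof.
by move=> a0; have [z] := congr_proj n a; rewrite a0 add0r => ->; exists z.
Qed.

Lemma proj_self n : zr5_eqb (dot n n) (zi 16) -> subst (proj n) (lin n vars) = 0.
Proof.
move=> /zr5_eqP nn; rewrite subst_proj nn val_zi (_ : (int_of_Z 16)%:~R = 16%:R); last first.
  exact: (int_of_Z_natA A 16).
by rewrite mulrA k16 mul1r subrr.
Qed.

Lemma proj_independent n n' : independent n n' -> subst (proj n) (lin n' vars) != 0.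
Proof.
move=> /lin_eq0; apply: contra_neq => E.
rewrite lin_nsub !lin_nscale val_zi (_ : (int_of_Z 16)%:~R = 16%:R); last first.
  exact: (int_of_Z_natA A 16).
move: E; rewrite subst_proj => /subr0_eq ->.
by rewrite mulrA (mulrC 16%:R) k16 mul1r subrr.
Qed.

(** The linear form is prime: reduction modulo it, realized by [proj n], takes values in the
    integral domain of polynomials. If [m] survives the reduction, the factors of the power can be
    moved from [m * a] to [a] one at a time. *)
Lemma pow_dvd n k (m a b : A) : zr5_eqb (dot n n) (zi 16) -> n_nz n ->
  subst (proj n) m != 0 -> m * a = lin n vars ^+ k * b -> dvd (lin n vars ^+ k) a.
Proof.
move=> nn nz m0; elim: k a b => [|k IH] a b E; first by exists a; rewrite expr0 mul1r.
have [c cE] : dvd (lin n vars ^+ k) a by apply: (IH _ (lin n vars * b)); rewrite mulrA -exprSr.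
have l0 : lin n vars ^+ k != 0 by rewrite expf_neq0 // lin_eq0.
have E1 : m * c = lin n vars * b.
  by apply: (mulfI l0); rewrite mulrCA -cE E exprSr mulrA.
have /dvd_lin[d dE] : subst (proj n) c = 0.
  apply/eqP; move: (congr1 (subst (proj n)) E1) => /eqP.
  by rewrite !rmorphM /= proj_self // mul0r mulf_eq0 (negbTE m0).
by exists d; rewrite exprSr -mulrA -dE.
Qed.

Lemma prod_dvd (s : seq normal) k (a : A) : spread s ->
  List.Forall (fun n => dvd (lin n vars ^+ k) a) s ->
  dvd (\prod_(n <- s) lin n vars ^+ k) a.
Proof.
elim: s => [|n s IH]; first by exists a; rewrite big_nil mul1r.
rewrite /spread /= => /andP[/andP[ind pw] /andP[/andP[nn nz] ns]].
move=> /List.Forall_cons_iff[[b bE] ds].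
have [|c cE] := IH _ ds; first by rewrite /spread pw.
have [||d dE] := @pow_dvd n k (\prod_(n' <- s) lin n' vars ^+ k) c b nn nz.
(* None of the other mirror forms vanishes identically on the mirror of [n], hence neither does
   their product. *)
- rewrite rmorph_prod prodf_seq_neq0; apply: sub_all ind => n' /proj_independent /=.
  by rewrite rmorphXn; apply: expf_neq0.
- by rewrite -cE.
- by exists d; rewrite big_cons cE dE mulrA; congr (_ * _); rewrite mulrC.
Qed.

Lemma msize_prod_lin (s : seq normal) k : all n_nz s ->
  (size s * k < msize (\prod_(n <- s) lin n vars ^+ k))%N /\
  \prod_(n <- s) lin n vars ^+ k != 0.
Proof.
have msM (p q : A) : p != 0 -> q != 0 -> (msize p + msize q = (msize (p * q)).+1)%N.
  move=> p0 q0; rewrite msizeM //; case: (msize p) (msize_poly_eq0 p) => [|m _]; last by [].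
  by rewrite (negbTE p0).
have msX (p : A) : (1 < msize p)%N -> (k < msize (p ^+ k))%N /\ p ^+ k != 0.
  move=> p1; have p0 : p != 0 by rewrite -msize_poly_eq0; case: (msize p) p1.
  split; last exact: expf_neq0.
  elim: k => [|k IH]; first by rewrite expr0 msize1.
  by have := msM p (p ^+ k) p0 (expf_neq0 k p0); rewrite -exprS; lia.
elim: s => [|n s IH] /=; first by rewrite big_nil msize1 oner_neq0.
move=> /andP[/msize_lin/msX[l1 l0] /IH[s1 s0]]; rewrite big_cons mulf_neq0 //.
by split=> //; rewrite -ltnS -msM // mulSn -addSn -addnS leq_add.
Qed.

(** [msize] is the degree plus one, so the hypothesis allows degree at most 239, while a nonzero
    multiple of the product of 60 fourth powers has degree at least 240. *)
Lemma mirrors_dvd0 (a : A) :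
  List.Forall (fun n => dvd (lin n vars ^+ 4) a) mirrors -> (msize a <= 240)%N -> a = 0.
Proof.
(* From here on the list is an arbitrary one with the checked properties, so that no later step can
   start computing the orbit. *)
move: mirrors mirrors_check => s /andP[/eqP sz sp].
move=> /(prod_dvd sp)[b ->].
have nz : all n_nz s.
  by case/andP: sp => _; apply: sub_all => n /andP[].
have [] := msize_prod_lin 4 nz; rewrite sz; move: (\prod_(n <- _) _) => p p240 p0.
have [->|b0] := eqVneq b 0; first by rewrite mulr0.
have := msize_poly_eq0 b; rewrite (negbTE b0) msizeM // => /eqP.
move=> b1 pb; exfalso; move: p240 b1 pb.
by move: (msize p) (msize b) => i j; lia.
Qed.

Lemma explore_ind (Q : normal -> Prop) k s :
  (forall n, Q n -> List.Forall Q (images n)) ->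
  List.Forall Q s -> List.Forall Q (explore k s).
Proof.
move=> Qim; elim: k s => //= k IH s Qs; apply: IH.
have addQ t t' : List.Forall Q t -> List.Forall Q t' ->
    List.Forall Q (foldl add_normal t t').
  elim: t' t => //= n t' IHt t Qt /List.Forall_cons_iff[Qn Qt']; apply: IHt => //.
  rewrite /add_normal; case: ifP => // _; rewrite -cats1.
  by apply/List.Forall_app; split=> //; constructor.
apply: addQ => //; elim: s Qs => //= n s IHs /List.Forall_cons_iff[Qn Qs].
by apply/List.Forall_app; split; [apply: Qim | apply: IHs].
Qed.

Section Invariant.
Context (D : A).
Context (D_rot : subst (rotp vars) D = D).
Context (D_swap : subst (swapp vars) D = D).
Context (D_refl : subst (reflp r false vars) D = D).

Lemma dvd_subst x n k : subst x D = D -> dvd (lin n vars ^+ k) D ->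
  dvd (lin n x ^+ k) D.
Proof.
move=> xD [c cE]; exists (subst x c).
by rewrite -{1}xD {1}cE rmorphM rmorphXn /= subst_lin subst_vars.
Qed.

Lemma val4 : val (zi 4) = 4%:R.
Proof. by rewrite val_zi; exact: (int_of_Z_natA A 4). Qed.

(** The matrix of the reflection is symmetric, so reflecting the normal or the point gives the same
    pairing; the 4 is the denominator that [refl4] omits. *)
Lemma lin_refl n : lin (refl4 n) vars = 4%:R * lin n (reflp r false vars).
Proof.
case: n => [[[p q] s] t]; rewrite /refl4 /reflp /vars /lin /sgn5.
set q4 : A := (4^-1)%:A.
have q4K : 4%:R * q4 = 1 by rewrite -[q4]mulr1 quarterK.
rewrite !zr5_valD !(zr5_valM s5E) !zr5_valN val4.
have val2 : val (zi 2) = 2%:R by rewrite val_zi; exact: (int_of_Z_natA A 2).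
have valN2 : val (zi (-2)) = - 2%:R.
  by rewrite -[zi (-2)]/(zr5_opp (zi 2)) zr5_valN val2.
have valp : val (Zpos 1, Zpos 1) = 1 + s5 by rewrite /zr5_val mul1r.
have valm : val (Zpos 1, Zneg 1) = 1 - s5.
  by rewrite -mulN1r; congr (_ + _ * _).
rewrite val2 valN2 valp valm.
exact: refl_identity.
Qed.

Lemma images_dvd n k : dvd (lin n vars ^+ k) D ->
  List.Forall (fun n' => dvd (lin n' vars ^+ k) D) (images n).
Proof.
move=> nD.
have Crot : dvd (lin n (rotp vars) ^+ k) D by apply: dvd_subst.
have Cswap : dvd (lin n (swapp vars) ^+ k) D by apply: dvd_subst.
have Crefl : dvd (lin n (reflp r false vars) ^+ k) D by apply: dvd_subst.
have E := lin_refl n; move: E Crot Cswap Crefl; case: n {nD} => [[[p q] s] t].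
rewrite /images; set m := refl4 _ => E Crot Cswap Crefl; constructor.
  by move: Crot; congr dvd; congr (_ ^+ _); rewrite /lin /=; ring.
constructor.
  by move: Cswap; congr dvd; congr (_ ^+ _); rewrite /lin /=; ring.
case: ifP => [/neqbP mE|_]; last exact: List.Forall_nil.
apply: List.Forall_cons; last exact: List.Forall_nil.
suff -> : lin (quarter m) vars = lin (p, q, s, t) (reflp r false vars) by [].
apply: (@natr_mulI K A 4); first by [].
by rewrite /= -E -mE lin_nscale val4.
Qed.

Lemma invariant_eq0 : congr ((u4 K ^+ 2) ^+ 2) D 0 -> (msize D <= 240)%N -> D = 0.
Proof.
move=> [c cE]; apply: mirrors_dvd0.
apply: explore_ind => [n|]; first exact: images_dvd.
(* The linear form of the starting normal is $4u_4$, so its fourth power divides [D] with quotient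
   [c] divided by 4^4. *)
constructor => //; exists ((4^-1)%:A ^+ 4 * c).
rewrite {1}cE add0r -exprM /lin /vars !val_zi (int_of_Z_natA A 4).
rewrite !mul0r !add0r exprMn mulrACA -exprMn mulrA.
by rewrite -[(4^-1)%:A]mulr1 quarterK expr1n mul1r.
Qed.

End Invariant.
End Divisibility.

(** * Degree bounds *)

Fixpoint edeg (ws : seq nat) (e : expr) : nat :=
  match e with
  | EVar i => nth 0%N ws i
  | EMulz _ e | EFrac _ _ e | ERoot _ e | EOpp e => edeg ws e
  | EAdd e1 e2 => maxn (edeg ws e1) (edeg ws e2)
  | EMul e1 e2 => (edeg ws e1 + edeg ws e2)%N
  | EExp e n => (n * edeg ws e)%N
  end.

(** The weights are the degrees in the variables: 2, 6, 10, 2 for $h_2,h_6,h_{10},u_4^2$, and seven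
    times as much for their counterparts at P. The bound 239 is the largest that 60 mirrors of
    multiplicity 4 can exclude. *)
Definition deg_check (Ze Ye : expr) : bool :=
  (edeg [:: 14; 42; 70; 14]%N Ze <= 239)%N &&
  (edeg [seq edeg [:: 2; 6; 10; 2] e | e <- [:: Z2_expr; Z12_expr; Z20_expr; Z30_expr]] Ye
     <= 239)%N.

Section Degree.
Context (K : numFieldType) (r : K).
Local Notation A := {mpoly K[4]}.

Definition bounded (env : seq A) (ws : seq nat) : Prop :=
  forall i, (msize env`_i <= (nth 0%N ws i).+1)%N.

Lemma bounded_nil : bounded [::] [::].
Proof. by move=> i; rewrite !nth_nil msize0. Qed.

Lemma bounded_cons a w env ws : (msize (a : A) <= w.+1)%N -> bounded env ws ->
  bounded (a :: env) (w :: ws).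
Proof. by move=> aw b [|i] //=. Qed.

Lemma msizeM_bound (p q : A) m n :
  (msize p <= m.+1 -> msize q <= n.+1 -> msize (p * q) <= (m + n).+1)%N.
Proof.
have [->|p0] := eqVneq p 0; first by rewrite mul0r msize0.
have [->|q0] := eqVneq q 0; first by rewrite mulr0 msize0.
by rewrite msizeM //; move: (msize p) (msize q) => i j; lia.
Qed.

Lemma msize_interp s (env : seq A) ws e : bounded env ws ->
  (msize (interp s env e) <= (edeg ws e).+1)%N.
Proof.
move=> envE; elim: e => [i|c e IH|m n e IH|n e IH|e1 IH1 e2 IH2|e IH|
  e1 IH1 e2 IH2|e IH n] //=.
- by rewrite -scaler_int; apply: leq_trans (msizeZ_le _ _) IH.
- exact: leq_trans (msizeZ_le _ _) IH.
- exact: leq_trans (msizeZ_le _ _) IH.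
- apply: leq_trans (msizeD_le _ _) _; rewrite geq_max; apply/andP; split.
    by apply: leq_trans IH1 _; rewrite ltnS leq_maxl.
  by apply: leq_trans IH2 _; rewrite ltnS leq_maxr.
- by rewrite msizeN.
- exact: msizeM_bound.
- elim: n => [|n IHn]; first by rewrite expr0 msize1.
  by rewrite exprS mulSn; apply: msizeM_bound.
Qed.

Definition pt_deg (x : point A) m : Prop :=
  let: (a, b, c, d) := x in
  [/\ (msize a <= m.+1)%N, (msize b <= m.+1)%N, (msize c <= m.+1)%N & (msize d <= m.+1)%N].

Lemma msize_sq (a : A) m : (msize a <= m.+1)%N -> (msize (a ^+ 2) <= (m + m).+1)%N.
Proof. by move=> am; rewrite expr2; apply: msizeM_bound. Qed.

Lemma msize_Zval e s x m : pt_deg x m ->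
  (msize (Zval r e s x) <= (edeg [:: m + m; edeg [:: m + m; m + m; m + m] h6_expr;
     edeg [:: m + m; m + m; m + m] h10_expr; m + m] e).+1)%N.
Proof.
case: x => [[[a b] c] d] [am bm cm dm]; rewrite /Zval.
have sqE : bounded [:: a ^+ 2; b ^+ 2; c ^+ 2] [:: m + m; m + m; m + m]%N.
  by do 3![apply: bounded_cons; first exact: msize_sq]; apply: bounded_nil.
apply: msize_interp; do 4?[apply: bounded_cons]; last exact: bounded_nil.
- by rewrite (h2E (sgn5 r s)); apply: leq_trans (msize_interp _ _ sqE) _; rewrite /= !maxnn.
- by rewrite h6E; apply: msize_interp.
- by rewrite h10E; apply: msize_interp.
- exact: msize_sq.
Qed.

Lemma pt_deg_vars : pt_deg (vars K) 1.
Proof. by split; rewrite msizeX mdeg1. Qed.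

Lemma pt_deg_Pval s : pt_deg (Pval r s (vars K)) 7.
Proof.
have fE a b c d : pt_deg (a, b, c, d) 1 -> (msize (f (sgn5 r s) a b c d) <= 8)%N.
  case=> *; rewrite f_exprE; apply: leq_trans (msizeZ_le _ _) _.
  apply: leq_trans (msize_interp (ws := [:: 1; 1; 1; 1]%N) _ _ _) _ => //.
  by do 4![apply: bounded_cons => //]; apply: bounded_nil.
by have [*] := pt_deg_vars; split; apply: fE.
Qed.

Lemma msize_Dval k Ze Ye : deg_check Ze Ye -> (msize (Dval r k Ze Ye (vars K)) <= 240)%N.
Proof.
case/andP => degZ degY; apply: leq_trans (msizeD_le _ _) _; rewrite msizeN geq_max.
(* For [m] equal to 7 the weights in [msize_Zval] compute to the list 14, 42, 70, 14 of
   [deg_check]. *)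
apply/andP; split; first by apply: leq_trans (msize_Zval _ _ (pt_deg_Pval _)) _.
apply: leq_trans (msizeZ_le _ _) _; move: degY; rewrite -ltnS.
apply: leq_trans; apply: msize_interp.
elim: [:: _; _; _; _] => [|e es IH] /=; first exact: bounded_nil.
apply: bounded_cons IH; exact: (msize_Zval e false pt_deg_vars).
Qed.

End Degree.

Lemma Z2_degree : deg_check Z2_expr Y2_expr. Proof. by vm_compute. Qed.
Lemma Z12_degree : deg_check Z12_expr Y12_expr. Proof. by vm_compute. Qed.
Lemma Z20_degree : deg_check Z20_expr Y20_expr. Proof. by vm_compute. Qed.
Lemma Z30_degree : deg_check Z30_expr Y30_expr. Proof. by vm_compute. Qed.

(** * From the congruences on one mirror to the four identities *)

Section Equality.
Context (K : numFieldType) (r : K).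
Context (r5E : r ^+ 2 = 5%:R).

Lemma Y_eq dn den n Ze Ye :
  dn <> Z0 -> den <> Z0 -> swap_check dn Ze -> deg_check Ze Ye -> Y_check dn den n Ze Ye ->
  Zval r Ze true (Pval r false (vars K)) = (int_of_Z den)%:~R^-1 *:
    interp r [seq Zval r e false (vars K) | e <- [:: Z2_expr; Z12_expr; Z20_expr; Z30_expr]] Ye.
Proof.
move=> dn0 den0 swapc degc Yc; apply/eqP; rewrite -subr_eq0; apply/eqP.
apply: (invariant_eq0 r5E (D := Dval r _ Ze Ye (vars K))).
- by rewrite Dval_morph subst_vars Dval_rot.
- by rewrite Dval_morph subst_vars (Dval_swap r5E _ _ _ dn0 swapc).
- by rewrite Dval_morph subst_vars (Dval_refl r5E).
- have [c cE] := Y_congr r5E (u1 K) (u2 K) (u3 K) (u4 K) dn0 den0 Yc.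
  by exists c; rewrite add0r /Dval {1}cE addrC addKr.
- exact: msize_Dval.
Qed.

Lemma Zval_comp e s x : Zval r e s (vars K) \mPo tup x = Zval r e s x.
Proof.
by apply: etrans (Zval_morph _ _ _ _ _) _; congr (Zval r e s _); apply: subst_vars.
Qed.

Lemma Z_values s :
  [/\ Z2 K = Zval r Z2_expr s (vars K), Z12 (sgn5 r s) = Zval r Z12_expr s (vars K),
    Z20 (sgn5 r s) = Zval r Z20_expr s (vars K)
  & Z30 (sgn5 r s) = Zval r Z30_expr s (vars K)].
Proof. by split; [exact: Z2E | exact: Z12E | exact: Z20E | exact: Z30E]. Qed.

Let P := Pval r false (vars K).

Lemma Y_eq_Z dn den n Ze Ye :
  dn <> Z0 -> den <> Z0 -> swap_check dn Ze -> deg_check Ze Ye -> Y_check dn den n Ze Ye ->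
  Zval r Ze true P =
  (int_of_Z den)%:~R^-1 *: interp r [:: Z2 K; Z12 r; Z20 r; Z30 r] Ye.
Proof.
move=> dn0 den0 Zs Zd Yc; rewrite (Y_eq dn0 den0 Zs Zd Yc).
by have [-> -> -> ->] := Z_values false.
Qed.

Lemma Y2_eq : Z2 K \mPo tup P = Y2_form (Z2 K) (Z12 r) (Z20 r) (Z30 r).
Proof.
rewrite (Y2E r) -(Y_eq_Z _ _ Z2_swap Z2_degree Y2_check) // -Zval_comp.
by have [<- _ _ _] := Z_values true.
Qed.

Lemma Y12_eq : Z12 (- r) \mPo tup P = Y12_form (Z2 K) (Z12 r) (Z20 r) (Z30 r).
Proof.
rewrite (Y12E r) -(Y_eq_Z _ _ Z12_swap Z12_degree Y12_check) // -Zval_comp.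
by have [_ <- _ _] := Z_values true.
Qed.

Lemma Y20_eq : Z20 (- r) \mPo tup P = Y20_form (Z2 K) (Z12 r) (Z20 r) (Z30 r).
Proof.
rewrite (Y20E r) -(Y_eq_Z _ _ Z20_swap Z20_degree Y20_check) // -Zval_comp.
by have [_ _ <- _] := Z_values true.
Qed.

Lemma Y30_eq : Z30 (- r) \mPo tup P = Y30_form (Z2 K) (Z12 r) (Z20 r) (Z30 r).
Proof.
rewrite (Y30E r) -(Y_eq_Z _ _ Z30_swap Z30_degree Y30_check) // -Zval_comp.
by have [_ _ _ <-] := Z_values true.
Qed.

End Equality.

Theorem theorem2 (R : rcfType) :
  let r5 : R := Num.sqrt 5 in
  let P := [tuple P1 r5; P2 r5; P3 r5; P4 r5] in
  let Y2 := Z2 R \mPo P in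
  let Y12 := Z12 (- r5) \mPo P in
  let Y20 := Z20 (- r5) \mPo P in
  let Y30 := Z30 (- r5) \mPo P in
  [/\ Y2 = Y2_form (Z2 R) (Z12 r5) (Z20 r5) (Z30 r5),
      Y12 = Y12_form (Z2 R) (Z12 r5) (Z20 r5) (Z30 r5),
      Y20 = Y20_form (Z2 R) (Z12 r5) (Z20 r5) (Z30 r5)
    & Y30 = Y30_form (Z2 R) (Z12 r5) (Z20 r5) (Z30 r5)].
Proof.
have r5E : (Num.sqrt 5 : R) ^+ 2 = 5%:R by rewrite sqr_sqrtr ?ler0n.
by split; [exact: Y2_eq | exact: Y12_eq | exact: Y20_eq | exact: Y30_eq].
Qed.
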